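(* Let $a\in\mathbb{R}$ and suppose that $\{\lambda_i,\varphi_i(a)\}_{i=1}^N$ is the interior spectral data at $a$ of some pair $(\omega,v)$, and that $\alpha\ne0$. Assume that $\lambda_1>0$ (respectively, $\lambda_N<0$). If there are exactly $k\ge1$ indices $i$ with $\varphi_i(a)=0$, then infinitely many pairs $(\omega,v)$ yield the given interior spectral data $\{\lambda_i,\varphi_i(a)\}_{i=1}^N$ at $a$. Moreover: (i) if $\varphi_N(a)=0$ (respectively, $\varphi_1(a)=0$), then $\mathcal{F}$ is a connected manifold of dimension $k$; (ii) if $\varphi_N(a)\ne0$ (respectively, $\varphi_1(a)\ne0$), then $\mathcal{F}$ is a collection of 2 disjoint manifolds, each of dimension $k$.
   Context: A pair $(\omega,v)$ means: for some $n\in\mathbb{N}$, $n\ge 1$, and real points $x_1<\dots<x_n$, $\omega=\sum_{i=1}^n\omega_i\delta_{x_i}$ and $v=\sum_{i=1}^n v_i\delta_{x_i}$ with $\omega_i\in\mathbb{R}$, $v_i\ge 0$ and $|\omega_i|+v_i>0$ ($\delta_x$ is the Dirac measure at $x$). The number $n$, the points and the weights may differ from pair to pair. For $z\in\mathbb{C}$ consider $-f''+\frac14 f=z\omega f+z^2vf$ on $\mathbb{R}$, meaning: $f$ is continuous, $-f''+\frac14 f=0$ on $\mathbb{R}\setminus\{x_1,\dots,x_n\}$, and $f'(x_i-)=f'(x_i+)+z\omega_if(x_i)+z^2v_if(x_i)$ for every $i$. An eigenvalue is a $z$ for which there is a nontrivial bounded solution. The eigenvalues form a finite set of nonzero real numbers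 $\lambda_1<\dots<\lambda_N$. For $z\in\mathbb{C}$, $\phi_\pm(z,\cdot)$ are the solutions with $\phi_\pm(z,x)=e^{\mp x/2}$ for all $x$ near $\pm\infty$. For an eigenvalue $\lambda$ put $\gamma_\lambda^2:=\int_{\mathbb{R}}|\phi_+(\lambda,x)|^2d\omega(x)+2\lambda\int_{\mathbb{R}}|\phi_+(\lambda,x)|^2dv(x)$; one has $\lambda\gamma_\lambda^2>0$. The normalized eigenfunctions are $\varphi_i(x)=\phi_+(\lambda_i,x)/\sqrt{\lambda_i\gamma_{\lambda_i}^2}$. For $a\in\mathbb{R}$, the family $\{\lambda_i,\varphi_i(a)\}_{i=1}^N$ is called the interior spectral data of $(\omega,v)$ at $a$. Put $\alpha:=1-\sum_{i=1}^N|\varphi_i(a)|^2$. The spectral data of a pair is the vector $(\lambda_1,\dots,\lambda_N,\lambda_1\gamma_{\lambda_1}^2,\dots,\lambda_N\gamma_{\lambda_N}^2)\in\mathbb{R}^{2N}$. For given interior spectral data at $a$, $\mathcal{F}\subset\mathbb{R}^{2N}$ denotes the set of spectral data of all pairs whose interior spectral data at $a$ is the given one. ''A collection of $m$ disjoint manifolds, each of dimension $k$'' means that the set has exactly $m$ connected components, each a manifold of dimension $k$. *)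

(* Defs.v *)
From HB Require Import structures.
From mathcomp Require Import all_boot all_order all_algebra.
From mathcomp Require Import all_classical all_reals all_analysis.
From mathcomp Require Export complex.

Set Implicit Arguments.
Unset Strict Implicit.
Unset Printing Implicit Defensive.

Import Order.TTheory GRing.Theory Num.Theory numFieldNormedType.Exports.
Import ComplexField Normc.

Local Open Scope classical_set_scope.
Local Open Scope complex_scope.
Local Open Scope ring_scope.

(* Calculus for complex-valued functions of a real variable, componentwise. *)
Section complex_valued.
Context {R : realType}.
Implicit Types (f : R -> R[i]) (x : R).

Definition repart f : R -> R := fun t => complex.Re (f t).
Definition impart f : R -> R := fun t => complex.Im (f t).

Definition ccvg f (F : set_system R) (l : R[i]) : Prop :=
  (repart f @ F --> complex.Re l) /\ (impart f @ F --> complex.Im l).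

Definition ccontinuous f : Prop := continuous (repart f) /\ continuous (impart f).

Definition cderivable f x : Prop :=
  derivable (repart f) x 1 /\ derivable (impart f) x 1.

Definition cderive f : R -> R[i] :=
  fun x => derive1 (repart f) x +i* derive1 (impart f) x.

End complex_valued.

Section pairs.
Context {R : realType}.

(* The triple (x, w, v) stands for the atoms w \delta_x of omega and v \delta_x
   of v.  A pair of measures is encoded by the list of its triples in
   increasing order of x; since no triple is (x, 0, 0), distinct lists
   satisfying [is_pair] encode distinct pairs of measures. *)
Definition atom : Type := (R * R * R)%type.
Definition pos (t : atom) : R := t.1.1.
Definition wgt (t : atom) : R := t.1.2.
Definition dip (t : atom) : R := t.2.

Definition is_pair (p : seq atom) : bool :=
  [&& (0 < size p)%N,
      sorted (fun x y : R => x < y) (map pos p)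
    & all (fun t => (0 <= dip t) && (0 < `|wgt t| + dip t)) p].

Definition int_omega (p : seq atom) (g : R -> R) : R :=
  \sum_(t <- p) wgt t * g (pos t).

Definition int_v (p : seq atom) (g : R -> R) : R :=
  \sum_(t <- p) dip t * g (pos t).

(* f solves -f'' + f/4 = z omega f + z^2 v f. *)
Definition solution (p : seq atom) (z : R[i]) (f : R -> R[i]) : Prop :=
  [/\ ccontinuous f,
      forall x, x \notin map pos p ->
        [/\ cderivable f x, cderivable (cderive f) x
          & - cderive (cderive f) x + 4^-1 * f x = 0]
    & forall t, t \in p ->
        exists dl dr : R[i],
          [/\ ccvg (cderive f) ((pos t)^'-) dl,
              ccvg (cderive f) ((pos t)^'+) dr
            & dl = dr + z * (wgt t)%:C * f (pos t)
                      + z ^+ 2 * (dip t)%:C * f (pos t)]].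

Definition eigenvalue (p : seq atom) (z : R[i]) : Prop :=
  exists f, [/\ solution p z f,
                exists x, f x != 0
              & exists M : R, forall x, normc (f x) <= M].

Definition eigenvalues (p : seq atom) (N : nat) (lam : 'I_N -> R) : Prop :=
  (forall i j : 'I_N, (i < j)%N -> lam i < lam j) /\
  (forall z : R[i], eigenvalue p z <-> exists i, z = (lam i)%:C).

(* There is exactly one such solution, so the default value is irrelevant. *)
Definition phi_plus (p : seq atom) (z : R[i]) : R -> R[i] :=
  xget (fun=> 0) [set f | solution p z f /\
    \forall x \near +oo, f x = (expR (- (x / 2)))%:C].

Definition gamma2 (p : seq atom) (l : R) : R :=
  int_omega p (fun x => normc (phi_plus p l%:C x) ^+ 2)
  + 2 * l * int_v p (fun x => normc (phi_plus p l%:C x) ^+ 2).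

Definition varphi (p : seq atom) (l : R) (x : R) : R[i] :=
  phi_plus p l%:C x / (Num.sqrt (l * gamma2 p l))%:C.

Definition interior_data (a : R) (p : seq atom) (N : nat)
    (lam : 'I_N -> R) (phi : 'I_N -> R[i]) : Prop :=
  eigenvalues p lam /\ forall i, phi i = varphi p (lam i) a.

Definition alpha (N : nat) (phi : 'I_N -> R[i]) : R :=
  1 - \sum_i normc (phi i) ^+ 2.

Definition pairs_with (a : R) (N : nat) (lam : 'I_N -> R) (phi : 'I_N -> R[i]) :
    set (seq atom) :=
  [set p | is_pair p /\ interior_data a p lam phi].

Definition spectral_data (p : seq atom) (N : nat) (d : 'rV[R]_(N + N)) : Prop :=
  exists2 lam : 'I_N -> R, eigenvalues p lam &
    d = row_mx (\row_i lam i) (\row_i (lam i * gamma2 p (lam i))).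

Definition spectral_set (a : R) (N : nat) (lam : 'I_N -> R)
    (phi : 'I_N -> R[i]) : set 'rV[R]_(N + N) :=
  [set d | exists2 p, pairs_with a lam phi p & spectral_data p d].

End pairs.
Arguments atom : clear implicits.

Definition homeomorphic {S T : topologicalType} (A : set S) (B : set T) : Prop :=
  exists (f : S -> T) (g : T -> S),
    [/\ {within A, continuous f}, {within B, continuous g},
        set_fun A B f, set_fun B A g
      & (forall x, A x -> g (f x) = x) /\ (forall y, B y -> f (g y) = y)].

(* Topological manifold without boundary, for the topology induced by R^d;
   Hausdorffness and second countability are inherited from R^d. *)
Definition manifold {R : realType} (k d : nat) (M : set 'rV[R]_d) : Prop :=
  forall x, M x ->
    exists (U : set 'rV[R]_d) (V : set 'rV[R]_k),
      [/\ open U, U x, open V & homeomorphic (M `&` U) V].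

Definition disjoint_manifolds {R : realType} (m k d : nat)
    (F : set 'rV[R]_d) : Prop :=
  let components := [set connected_component F x | x in F] in
  (components #= `I_m)%card /\ forall C, components C -> manifold k C.

(* Main.v *)
Require Import Defs.
From HB Require Import structures.
From mathcomp Require Import all_boot all_order all_algebra.
From mathcomp Require Import all_classical all_reals all_analysis.
From mathcomp Require Import ring lra.
Set Implicit Arguments.
Unset Strict Implicit.
Unset Printing Implicit Defensive.
Import Order.TTheory GRing.Theory Num.Theory numFieldNormedType.Exports.
Local Open Scope classical_set_scope.
Local Open Scope complex_scope.
Local Open Scope ring_scope.
Import ComplexField Normc.

(** Between consecutive atoms a solution is $A e^{-x/2} + B e^{x/2}$, and an atom
    changes $(A, B)$ by a matrix that is polynomial in $z$. The amplitudes of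
    $\phi_+(z, \cdot)$ on the far left are therefore polynomials ([jost_right]),
    and so are $\phi_+(\cdot, a)$ ([jost]) and $\phi_-(\cdot, a)$ ([jost_minus]). The
    eigenvalues are the zeros of the left amplitude $W$ of $e^{-x/2}$. Its zeros
    are simple, since at a zero its derivative is a nonzero multiple of
    $\gamma^2$, which is not zero by the energy identity ([energy_pos]); hence
    $W = \prod_i (1 - z/\lambda_i)$ ([characteristic]).

    Suppose that all the eigenvalues are positive. The diagonal Green function
    $\phi_+\phi_-/W$ at $a$ is $\alpha + \sum_i \varphi_i(a)^2/(1 - z/\lambda_i)$, so the
    interior data determine the product $\phi_+(\cdot, a)\phi_-(\cdot, a)$
    ([jost_product]). The eigenvalues with $\varphi_i(a) = 0$ are common zeros of
    the two factors; the others are the poles of this function, which is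
    increasing between them. Its zeros are thus positive, simple and interlace
    with the poles ([herglotz_zeros]), and $\phi_+(\cdot, a)$ is a product over some
    of these zeros, among them all the $\lambda_i$ with $\varphi_i(a) = 0$
    ([pair_zeros]). At a pole the sign of $\phi_+(\lambda_i, a)$ is the sign of
    $\varphi_i(a)$. Since there is exactly one zero between consecutive poles, these
    signs tell which zeros belong to $\phi_+$, with one exception: the zero beyond
    the last pole. If $\varphi_N(a) = 0$, that zero is $\lambda_N$ and belongs to
    $\phi_+$; otherwise it is free ([admissible_cases], [admissible_flip]).

    At a pole $\lambda_i\gamma_i^2 = \phi_+(\lambda_i, a)^2/\varphi_i(a)^2$ now has one or two
    possible values, and at $\lambda_N$ the two values differ ([flip_differs]). At an
    eigenvalue with $\varphi_i(a) = 0$ every positive value of $\lambda_i\gamma_i^2$ occurs: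
    the inverse of the Green function is the sum of the Weyl functions of the
    two half-lines, the mass of such a pole can be split between them in any
    ratio, and each half-line problem is solved by a Stieltjes continued
    fraction ([half_line_inverse], [realize]).

    Hence $\mathcal F$ is an open orthant of dimension $k$ in an affine subspace, or
    two of them separated by the coordinate $\lambda_N\gamma_N^2$
    ([spectral_set_topology]). Negative eigenvalues reduce to positive ones by
    $\omega \mapsto -\omega$, $z \mapsto -z$ ([norming_negative]). *)

(** * Transfer matrices and Jost polynomials *)

Section transfer.
Context {R : realType}.
Implicit Types (p l r : seq (atom R)) (t : atom R) (x z : R).
Implicit Types (u : {poly R} * {poly R}).

Definition half_exp x : R := expR (x / 2).

Lemma half_exp_gt0 x : 0 < half_exp x.
Proof. exact: expR_gt0. Qed.

Lemma half_expN x : half_exp (- x) = (half_exp x)^-1.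
Proof. by rewrite /half_exp mulNr expRN. Qed.

Lemma half_expVK x : (half_exp x)^-1 * half_exp x = 1.
Proof. by rewrite mulVf // gt_eqF // half_exp_gt0. Qed.

Lemma half_exp_lt x y : (half_exp x < half_exp y) = (x < y).
Proof. by rewrite ltr_expR ltr_pM2r // invr_gt0. Qed.

(** The factor of $f(x)$ in the jump condition at $t$. *)
Definition strength t : {poly R} := (wgt t)%:P * 'X + (dip t)%:P * 'X^2.

(** A pair $u$ stands for the solution $u_1 e^{-x/2} + u_2 e^{x/2}$ between two
    atoms; its amplitudes are polynomials in the spectral parameter. *)
Definition value x u : {poly R} :=
  (half_exp x)^-1%:P * u.1 + (half_exp x)%:P * u.2.

(** Amplitudes to the left of an atom from those to its right: continuity and
    the jump condition at the atom, solved for the two amplitudes. *)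
Definition cross t u : {poly R} * {poly R} :=
  let c := strength t * value (pos t) u in
  (u.1 - (half_exp (pos t))%:P * c, u.2 + (half_exp (pos t))^-1%:P * c).

(** Amplitudes of $\phi_+$ to the left of all the atoms of $p$. *)
Definition jost_right p := foldr cross (1, 0) p.

Definition mirror_atom t : atom R := (- pos t, wgt t, dip t).
Definition mirror p := rev (map mirror_atom p).

(** Amplitudes of $\phi_-$ to the right of all the atoms of $l$: reflecting the
    line exchanges $\phi_+$ with $\phi_-$ and the two exponentials. *)
Definition jost_left l := ((jost_right (mirror l)).2, (jost_right (mirror l)).1).

Lemma horner_strength t x : (strength t).[x] = wgt t * x + dip t * x ^+ 2.
Proof. by rewrite /strength !hornerE. Qed.

Lemma horner_strength' t x : (strength t)^`().[x] = wgt t + 2 * dip t * x.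
Proof. by rewrite /strength expr2 derivD !derivM !derivC !derivX !hornerE /=; ring. Qed.

Lemma half_expVK_poly x : (half_exp x)^-1%:P * (half_exp x)%:P = 1 :> {poly R}.
Proof. by rewrite -polyCM half_expVK. Qed.

Lemma value_cross t u : value (pos t) (cross t u) = value (pos t) u.
Proof.
rewrite /cross {1}/value /=.
set c := _ * value _ _.
have := half_expVK_poly (pos t); rewrite /value; set e := (half_exp _)%:P; set e' := _%:P => h.
ring: h.
Qed.

Lemma jost_left_rcons l t :
  let: (c, d) := jost_left l in
  let s := strength t * value (pos t) (c, d) in
  jost_left (rcons l t) =
    (c + (half_exp (pos t))%:P * s, d - (half_exp (pos t))^-1%:P * s).
Proof.
rewrite /jost_left /mirror map_rcons rev_rcons /=.
case: (jost_right _) => d c /=.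
rewrite /cross /value /= half_expN invrK.
by rewrite [X in strength t * X]addrC.
Qed.

(** Crossing the atoms of $l$ is linear with determinant one, and it maps the
    amplitudes of $\phi_-$ to $(0, 1)$. This determines its first row, which is
    therefore the Wronskian with $\phi_-$; the second row is some $(s, t')$. *)
Lemma transfer l : exists s t' : {poly R},
  let: (c, d) := jost_left l in
  d * t' + c * s = 1 /\
  forall u, foldr cross u l = (u.1 * d - u.2 * c, u.1 * s + u.2 * t').
Proof.
elim/last_ind: l => [|l t [s [t' IH]]].
  exists 0, 1; rewrite /jost_left /=; split; first by ring.
  by case=> a b /=; congr pair; ring.
move: (jost_left_rcons l t).
case: (jost_left l) IH => c d [det IH] ->.
have := half_expVK_poly (pos t).
set e := (half_exp _)%:P; set e' := _%:P => h.
pose q := strength t.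
exists (s - s * (e * q * e') + t' * (e' * q * e')),
   (t' - s * (e * q * e) + t' * (e' * q * e)); split.
  by rewrite -det /value -/e -/e' /= -/q; ring: h.
move=> u; rewrite foldr_rcons IH /cross /value -/e -/e' -/q /=.
congr pair; ring: h.
Qed.

Lemma jost_right0 p : (jost_right p).1.[0] = 1 /\ (jost_right p).2.[0] = 0.
Proof.
elim: p => [|t p [IH1 IH2]] /=; first by rewrite hornerC hornerE.
rewrite /strength !hornerE IH1 IH2 /= !(mulr0, mul0r, addr0, subr0).
by [].
Qed.

Definition is_atom (t : atom R) := (0 <= dip t) && (0 < `|wgt t| + dip t).
Definition ordered p := sorted (fun x y : R => x < y) (map pos p).

Lemma ordered_cons t p :
  ordered (t :: p) = all (fun s => pos t < pos s) p && ordered p.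
Proof.
rewrite /ordered /= path_sortedE; last by move=> a b c; apply: lt_trans.
by rewrite all_map.
Qed.

Lemma ordered_cat l r : ordered (l ++ r) =
  [&& ordered l, ordered r & all (fun t => all (fun s => pos t < pos s) r) l].
Proof.
elim: l => [|t l IH]; first by rewrite /= andbT.
rewrite cat_cons !ordered_cons IH all_cat /=.
by case: (all _ l); case: (all _ r); case: (ordered l); case: (ordered r) => /=;
   rewrite ?andbF.
Qed.

Lemma mirrorK p : mirror (mirror p) = p.
Proof.
rewrite /mirror map_rev revK -map_comp -[RHS]map_id; apply: eq_map => -[[x w] v].
by rewrite /= /mirror_atom /pos /wgt /dip /= opprK.
Qed.

Lemma mirror_ordered p : ordered p -> ordered (mirror p).
Proof.
move=> o; rewrite /ordered /mirror map_rev -map_comp rev_sorted /=.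
have -> : [seq (pos \o mirror_atom) i | i <- p] = map -%R (map pos p) by rewrite -map_comp.
by rewrite sorted_map; apply: sub_sorted o => x y /=; rewrite ltrN2; exact: id.
Qed.

(** An atom with a dipole part contributes a factor of degree two. *)
Definition atom_degree t : nat := if dip t == 0 then 1%N else 2%N.
Definition total_degree p := (\sum_(t <- p) atom_degree t)%N.

Lemma size_strength t : is_atom t -> size (strength t) = (atom_degree t).+1.
Proof.
rewrite /is_atom /strength /atom_degree => /andP[v0].
case: eqP => [-> | /eqP vn0 _].
  rewrite addr0 normr_gt0 => wn0.
  by rewrite mul0r addr0 size_mulX ?polyC_eq0 // size_polyC wn0.
have s3 : size ((dip t)%:P * 'X^2 : {poly R}) = 3%N.
  by rewrite size_Cmul // size_polyXn.
rewrite addrC size_polyDl s3 // (leq_ltn_trans (size_polyMleq _ _)) //.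
by rewrite size_polyX size_polyC; case: (wgt t != 0).
Qed.

Lemma size_lin_comb (m : nat) (c d : R) (A B : {poly R}) : (size A <= m)%N -> (size B <= m)%N ->
  (size (c%:P * A + d%:P * B)%R <= m)%N.
Proof.
move=> hA hB; rewrite (leq_trans (size_polyD _ _)) // geq_max !mul_polyC.
by rewrite !(leq_trans (size_scale_leq _ _)).
Qed.

Lemma size_jost p : all is_atom p ->
  (size (jost_right p).1 <= (total_degree p).+1)%N /\
  (size (jost_right p).2 <= (total_degree p).+1)%N.
Proof.
elim: p => [|t p IH] /=.
  by rewrite /total_degree big_nil size_poly1 size_poly0.
move=> /andP[bt /IH[hA hB]].
rewrite /total_degree big_cons -/(total_degree p).
have hc : (size (strength t * value (pos t) (jost_right p))%R
      <= (atom_degree t + total_degree p).+1)%N.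
  apply: (leq_trans (size_polyMleq _ _)).
  rewrite size_strength //= -addnS leq_add2l.
  exact: size_lin_comb.
have le : ((total_degree p).+1 <= (atom_degree t + total_degree p).+1)%N.
  by rewrite ltnS leq_addl.
split; rewrite -[X in X + _]mul1r -[1](polyC1); rewrite -?mulNr -?polyCN;
  by apply: size_lin_comb => //; apply: leq_trans le.
Qed.

(** The values at two different points of a solution determine both amplitudes,
    so no cancellation occurs in $A e^{-x/2} + B e^{x/2}$ away from the atom that
    was crossed last, and each atom adds its full degree. *)
Lemma size_value p x : all is_atom p -> ordered p -> all (fun t => x < pos t) p ->
  size (value x (jost_right p)) = (total_degree p).+1.
Proof.
elim: p x => [|t p IH] x /=.
  by rewrite /total_degree big_nil /value /= mulr0 addr0 mulr1 size_polyC invr_eq0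
    gt_eqF ?half_exp_gt0.
move=> /andP[bt bp]; rewrite ordered_cons => /andP[tp op] /andP[xt xp].
rewrite /total_degree big_cons -/(total_degree p).
set u := jost_right p.
have -> : value x (cross t u) = value x u +
   (half_exp x / half_exp (pos t) - half_exp (pos t) / half_exp x)%:P
   * (strength t * value (pos t) u).
  by rewrite polyCB !polyCM /cross; set v := value (pos t) u; rewrite /value /=; ring.
have hd : half_exp x / half_exp (pos t) - half_exp (pos t) / half_exp x != 0.
  rewrite lt_eqF // subr_lt0.
  have h := xt; rewrite -half_exp_lt in h.
  rewrite (@lt_trans _ _ 1) //.
    by rewrite ltr_pdivrMr ?half_exp_gt0 // mul1r.
  by rewrite ltr_pdivlMr ?half_exp_gt0 // mul1r.
have vn0 : value (pos t) u != 0 by rewrite -size_poly_gt0 IH.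
have sn0 : strength t != 0 by rewrite -size_poly_gt0 size_strength.
have sc : size (strength t * value (pos t) u) = (atom_degree t + total_degree p).+1.
  by rewrite size_mul // size_strength // IH // addSn addnS.
rewrite addrC size_polyDl size_Cmul // sc // IH // ltnS.
by rewrite -[X in (X < _)%N]add0n ltn_add2r /atom_degree; case: ifP.
Qed.

(** At the last crossed atom the value has lower degree than the amplitudes,
    because crossing leaves it unchanged. The two leading coefficients of the
    amplitudes therefore cancel there. *)
Lemma lead_jost t p : all is_atom (t :: p) -> ordered (t :: p) ->
  let b := (jost_right (t :: p)).2`_(total_degree (t :: p)) in
  b != 0 /\ (jost_right (t :: p)).1`_(total_degree (t :: p))
            = - (half_exp (pos t)) ^+ 2 * b.
Proof.
set s := total_degree _; set u := jost_right _ => bp op b.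
have e0 := half_exp_gt0 (pos t).
have rel : u.1`_s = - (half_exp (pos t)) ^+ 2 * b.
  have : (value (pos t) u)`_s = 0.
    apply: nth_default; rewrite /u /= value_cross.
    move: op bp; rewrite ordered_cons /= => /andP[tp op] /andP[bt bp].
    rewrite size_value // /s /total_degree big_cons.
    by rewrite -[X in (X < _)%N]add0n ltn_add2r /atom_degree; case: ifP.
  rewrite /value coefD !coefCM -/b => h.
  apply: (@mulfI _ (half_exp (pos t))^-1); first by rewrite invr_eq0 gt_eqF.
  have := mulVf (lt0r_neq0 e0); set e := half_exp _ in h * => hi.
  have -> : e^-1 * (- e ^+ 2 * b) = - (e^-1 * e * (e * b)) by ring.
  by apply/eqP; rewrite hi mul1r -addr_eq0 h.
split=> //; apply/negP => /eqP b0.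
have x1 : pos t - 1 < pos t by rewrite gtrBl.
have hx : all (fun s => pos t - 1 < pos s) (t :: p).
  rewrite /= x1 /=; move: op; rewrite ordered_cons => /andP[+ _].
  by apply: sub_all => y; apply: lt_trans.
have := size_value bp op hx; rewrite -/u -/s => sz.
have : lead_coef (value (pos t - 1) u) != 0.
  by rewrite lead_coef_eq0 -size_poly_gt0 sz.
by rewrite lead_coefE sz /= /value coefD !coefCM rel -/b b0 !mulr0 addr0 eqxx.
Qed.

Lemma coef_mul_top (A B : {poly R}) m n : (size A <= m.+1)%N -> (size B <= n.+1)%N ->
  (A * B)`_(m + n) = A`_m * B`_n.
Proof.
move=> hA hB; rewrite coefM.
have mi : (m < (m + n).+1)%N by rewrite ltnS leq_addr.
rewrite (bigD1 (Ordinal mi)) //= addKn big1 ?addr0 // => i ne.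
case: (ltngtP i m) => im.
- rewrite [B`__]nth_default ?mulr0 // (leq_trans hB) //.
  by rewrite ltn_subRL ltn_add2r.
- by rewrite nth_default ?mul0r // (leq_trans hA).
- by case/eqP: ne; apply: val_inj.
Qed.

Lemma coef_value x u m :
  (value x u)`_m = (half_exp x)^-1 * u.1`_m + half_exp x * u.2`_m.
Proof. by rewrite /value coefD !coefCM. Qed.

Lemma size_mul_le (A B : {poly R}) m n : (size A <= m.+1)%N -> (size B <= n.+1)%N ->
  (size (A * B)%R <= (m + n).+1)%N.
Proof.
move=> hA hB; rewrite (leq_trans (size_polyMleq _ _)) //.
by move: (leq_add hA hB); rewrite addSn addnS; case: (_ + _)%N.
Qed.

(** The ratio at infinity of $\phi_+\phi_-$ at $a$ to the Wronskian, both read off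
    from the leading coefficients. It is the number $\alpha$ of the theorem, whose
    sign comes from here; it vanishes exactly when $a$ carries an atom. *)
Lemma top_coef l r a : all is_atom l -> all is_atom r -> ordered l -> ordered r ->
    all (fun t => pos t < a) l -> all (fun t => a <= pos t) r ->
    l != [::] -> r != [::] ->
  let: (c, d) := jost_left l in
  let w := (jost_right r).1 * d - (jost_right r).2 * c in
  let s := (total_degree l + total_degree r)%N in
  [/\ size w = s.+1, (size (value a (jost_right r) * value a (c, d))%R <= s.+1)%N
    & exists2 rho, 0 <= rho & (value a (jost_right r) * value a (c, d))`_s = rho * w`_s].
Proof.
case/lastP: l => // l t0 bl br ol or la ra _.
case: r br or ra => // t1 r br or ra _.
set L := rcons l t0; set Rr := t1 :: r.
have tL : total_degree (mirror L) = total_degree L.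
  by rewrite /total_degree /mirror (perm_big _ (permEl (perm_rev _))) big_map.
have bL : all is_atom (mirror L) by rewrite /mirror all_rev all_map.
have oL : ordered (mirror L) := mirror_ordered ol.
have hL : mirror L = mirror_atom t0 :: mirror l.
  by rewrite /mirror /L map_rcons rev_rcons.
have [d0n0 dL] := lead_jost (etrans (congr1 _ (esym hL)) bL)
  (etrans (congr1 _ (esym hL)) oL).
rewrite -hL tL /= half_expN in d0n0 dL.
have [b0n0 dR] := lead_jost br or.
rewrite -/Rr in b0n0 dR.
have [sA sB] := size_jost br; have [sD sC] := size_jost bL; rewrite tL in sD sC.
rewrite -/Rr in sA sB.
rewrite /jost_left.
set A := (jost_right Rr).1 in dR sA *; set B := (jost_right Rr).2 in b0n0 dR sB *.
set D := (jost_right (mirror L)).1 in dL sD *.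
set C := (jost_right (mirror L)).2 in d0n0 dL sC *.
set m := total_degree L in sC sD dL d0n0 *; set n := total_degree Rr in sA sB b0n0 dR *.
have w_s : (A * D - B * C)`_(m + n) = A`_n * D`_m - B`_n * C`_m.
  by rewrite addnC coefB !coef_mul_top.
set E0 := half_exp (pos t0) in dL; set E1 := half_exp (pos t1) in dR.
have E0a : E0 < half_exp a.
  by rewrite half_exp_lt; move: la; rewrite all_rcons => /andP[].
have aE1 : half_exp a <= E1.
  by rewrite leNgt half_exp_lt -leNgt; move: ra => /andP[].
have E0p : 0 < E0 := half_exp_gt0 _; have ap : 0 < half_exp a := half_exp_gt0 _.
have key : (A * D - B * C)`_(m + n) = B`_n * C`_m * ((E1 ^+ 2 - E0 ^+ 2) / E0 ^+ 2).
  rewrite w_s dR dL; field; exact: lt0r_neq0.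
have ratio : 0 < E1 ^+ 2 - E0 ^+ 2.
  by rewrite subr_gt0 ltr_sqr ?nnegrE ?ltW // ?(lt_le_trans E0a) // (lt_trans E0p) // (lt_le_trans E0a).
have sw : size (A * D - B * C) = (m + n).+1.
  apply/eqP; rewrite eqn_leq; apply/andP; split.
    rewrite (leq_trans (size_polyD _ _)) // geq_max size_polyN addnC.
    by rewrite !size_mul_le.
  rewrite ltnNge; apply/negP => h.
  have := nth_default 0 h; rewrite key; apply/eqP.
  by rewrite !mulf_neq0 // ?invr_eq0 ?expf_neq0 // gt_eqF.
split => //.
  by rewrite addnC size_mul_le // size_lin_comb.
exists ((E1 ^+ 2 - half_exp a ^+ 2) * (half_exp a ^+ 2 - E0 ^+ 2)
    / (half_exp a ^+ 2 * (E1 ^+ 2 - E0 ^+ 2))).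
  have E1p : 0 <= E1 by exact: le_trans (ltW ap) aE1.
  apply: divr_ge0; apply: mulr_ge0; rewrite ?sqr_ge0 //; last exact: ltW.
    by rewrite subr_ge0 ler_sqr // nnegrE ltW.
  by rewrite subr_ge0 ler_sqr ?nnegrE; apply: ltW.
rewrite key addnC coef_mul_top; last first.
- exact: size_lin_comb.
- exact: size_lin_comb.
rewrite !coef_value [(C, D).1]/= [(C, D).2]/= -/A -/B dR dL.
field.
by rewrite !lt0r_neq0.
Qed.

(** The polynomial $z \mapsto \phi_+(z, x)$. *)
Definition jost p x : {poly R} :=
  value x (jost_right [seq t <- p | x < pos t]).

Lemma filter_ordered t p : all (fun s => pos t < pos s) p ->
  [seq s <- t :: p | pos t < pos s] = p.
Proof. by move=> /= h; rewrite ltxx; apply/all_filterP. Qed.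

Lemma jost_head t p : ordered (t :: p) ->
  jost (t :: p) (pos t) = value (pos t) (jost_right p).
Proof. by rewrite ordered_cons /jost => /andP[h _]; rewrite filter_ordered. Qed.

Lemma sum_jost t p (Q : atom R -> {poly R} -> {poly R}) : ordered (t :: p) ->
  \sum_(s <- t :: p) Q s (jost (t :: p) (pos s)) =
  Q t (value (pos t) (jost_right p)) + \sum_(s <- p) Q s (jost p (pos s)).
Proof.
move=> o; rewrite big_cons jost_head //; congr (_ + _).
apply: eq_big_seq => s sp; congr (Q s _); rewrite /jost /= ifF //.
by move: o; rewrite ordered_cons => /andP[/allP/(_ s sp) h _]; apply: lt_gtF.
Qed.

(** Lagrange identity: each crossing changes the Wronskian of $\phi_+$ and its
    derivative in $z$ by the square of the value at the atom. At a zero of the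
    left amplitude the right-hand side is $-\gamma^2$. *)
Lemma wronskian_deriv p : ordered p ->
  (jost_right p).1^`() * (jost_right p).2 - (jost_right p).1 * (jost_right p).2^`()
  = - \sum_(t <- p) (strength t)^`() * jost p (pos t) ^+ 2.
Proof.
elim: p => [|t p IH] o; first by rewrite big_nil /= derivC; ring.
have := o; rewrite ordered_cons => /andP[_ /IH {}IH].
rewrite (sum_jost (fun s f => (strength s)^`() * f ^+ 2)) // opprD -IH.
move: (half_expVK_poly (pos t)) => h; rewrite /=.
move: (jost_right p) (strength t) => [A B] q.
rewrite /cross /value /= !(derivB, derivN, derivD, derivM, derivC).
set e := (half_exp _)%:P in h *; set e' := _%:P in h *; ring: h.
Qed.

(** The sum is $\int |f'|^2 + |f|^2/4$ for the eigenfunction $f$. On a gap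
    between atoms $2 f f'$ is increasing, and it jumps by $2 q f^2$ when an atom
    of strength $q$ is crossed from right to left; it starts negative and ends
    nonnegative at an eigenvalue. *)
Lemma energy_pos p z : all is_atom p -> ordered p -> p != [::] ->
  (jost_right p).1.[z] = 0 ->
  0 < (\sum_(t <- p) strength t * jost p (pos t) ^+ 2).[z].
Proof.
pose H x (u : {poly R} * {poly R}) :=
   half_exp x ^+ 2 * u.2.[z] ^+ 2 - (half_exp x)^-1 ^+ 2 * u.1.[z] ^+ 2.
have Hle x y u : x < y -> H x u <= H y u.
  rewrite -half_exp_lt => xy; have x0 := half_exp_gt0 x.
  have y0 := half_exp_gt0 y.
  by apply: lerB; apply: ler_wpM2r; rewrite ?sqr_ge0 // ler_sqr ?nnegrE ?invr_ge0
    ?ltW // ltf_pV2.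
have Hcross t u : H (pos t) (cross t u) =
    H (pos t) u + (strength t * value (pos t) u ^+ 2).[z] *+ 2.
  have := half_expVK (pos t).
  rewrite /H /cross /value; move: (strength t) => q; rewrite !hornerE /=.
  set e := half_exp _; set e' := _^-1 => h; ring: h.
have main t p' : ordered (t :: p') -> H (pos t) (jost_right (t :: p')) <
    (\sum_(s <- t :: p') strength s * jost (t :: p') (pos s) ^+ 2).[z] *+ 2.
  elim: p' t => [|t' p' IH] t o.
    rewrite (sum_jost (fun s f => strength s * f ^+ 2)) // big_nil addr0.
    rewrite [jost_right _]/= Hcross gtrDr /H /= !hornerC expr0n /= mulr0 sub0r.
    by rewrite expr1n mulr1 oppr_lt0 exprn_gt0 // invr_gt0 half_exp_gt0.
  rewrite (sum_jost (fun s f => strength s * f ^+ 2)) // hornerD mulrnDl.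
  have -> : jost_right (t :: t' :: p') = cross t (jost_right (t' :: p')) by [].
  rewrite Hcross addrC ltrD2l.
  move: o; rewrite ordered_cons => /andP[/= /andP[tt' _] o].
  exact: le_lt_trans (Hle _ _ _ tt') (IH _ o).
case: p => // t p _ o _ A0.
have := main t p o; rewrite /H A0 expr0n /= mulr0 subr0.
move=> /(le_lt_trans _) h.
have : 0 < (\sum_(s <- t :: p) strength s * jost (t :: p) (pos s) ^+ 2).[z] *+ 2.
  by apply: h; rewrite mulr_ge0 ?sqr_ge0.
by rewrite pmulrn_lgt0.
Qed.

End transfer.

(** * Zeros of rational Herglotz functions *)

Section herglotz_functions.
Context {R : realType}.
Implicit Types (s Z : seq R) (p : {poly R}) (c : R -> R) (x mu b : R) (z : R[i]).

Definition ceval p z : R[i] := (map_poly (real_complex R) p).[z].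

Lemma cevalD p q z : ceval (p + q) z = ceval p z + ceval q z.
Proof. by rewrite /ceval rmorphD hornerD. Qed.

Lemma cevalN p z : ceval (- p) z = - ceval p z.
Proof. by rewrite /ceval rmorphN hornerN. Qed.

Lemma cevalM p q z : ceval (p * q) z = ceval p z * ceval q z.
Proof. by rewrite /ceval rmorphM hornerM. Qed.

Lemma cevalC x z : ceval x%:P z = x%:C.
Proof. by rewrite /ceval map_polyC hornerC. Qed.

Lemma cevalX z : ceval 'X z = z.
Proof. by rewrite /ceval map_polyX hornerX. Qed.

Lemma ceval_real p x : ceval p x%:C = (p.[x])%:C.
Proof. by rewrite /ceval horner_map. Qed.

(** Linear factors are normalized at zero, because the polynomials below have
    known values at $z = 0$ and not known leading coefficients. *)
Definition lin_factor x : {poly R} := 1 - (x^-1)%:P * 'X.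

Lemma lin_factorE x y : (lin_factor x).[y] = 1 - y / x.
Proof. by rewrite /lin_factor !hornerE mulrC. Qed.

Lemma lin_factor_root x y : x != 0 -> ((lin_factor x).[y] == 0) = (y == x).
Proof.
move=> x0; rewrite lin_factorE subr_eq0 eq_sym; apply/eqP/eqP => [h|->]; last exact: divff.
by rewrite -[x]mul1r -h mulfVK.
Qed.

Lemma XsubC_lin_factor x : x != 0 -> 'X - x%:P = (- x)%:P * lin_factor x.
Proof.
move=> x0; rewrite /lin_factor mulrBr mulr1 mulrA -polyCM mulNr divff // polyCN.
by rewrite polyCN; ring.
Qed.

Definition root_prod s := \prod_(x <- s) lin_factor x.
Definition omit_prod s mu := \prod_(x <- s | x != mu) lin_factor x.

Lemma root_prod0 s : (root_prod s).[0] = 1.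
Proof. by rewrite horner_prod big1 // => x _; rewrite lin_factorE mul0r subr0. Qed.

Lemma omit0 s mu : (omit_prod s mu).[0] = 1.
Proof. by rewrite horner_prod big1 // => x _; rewrite lin_factorE mul0r subr0. Qed.

Lemma root_prod_omit s mu : uniq s -> mu \in s -> root_prod s = lin_factor mu * omit_prod s mu.
Proof. by move=> us ms; rewrite /root_prod (bigD1_seq mu). Qed.

Lemma size_lin_factor x : x != 0 -> size (lin_factor x) = 2%N.
Proof.
move=> x0; rewrite /lin_factor addrC size_polyDl size_polyN size_Cmul ?invr_eq0 ?size_polyX //.
by rewrite size_poly1.
Qed.

Lemma lin_factor_neq0 x : lin_factor x != 0.
Proof. by apply/eqP => /(congr1 (horner^~ 0)) /eqP; rewrite lin_factorE horner0 mul0r subr0 oner_eq0. Qed.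

Lemma root_prod_root s x : all (fun y => y != 0) s -> ((root_prod s).[x] == 0) = (x \in s).
Proof.
move=> /allP s0; rewrite horner_prod prodf_seq_eq0 /=.
apply/hasP/idP => [[y ys]|xs]; first by rewrite lin_factor_root ?s0 // => /eqP->.
by exists x => //; rewrite lin_factor_root ?s0.
Qed.

Lemma size_root_prod s : all (fun y => y != 0) s -> size (root_prod s) = (size s).+1.
Proof.
elim: s => [|x s IH]; first by rewrite /root_prod big_nil size_poly1.
move=> /= /andP[x0 /IH {}IH]; rewrite /root_prod big_cons -/(root_prod s).
have pn0 : root_prod s != 0 by rewrite -size_poly_gt0 IH.
by rewrite size_mul ?lin_factor_neq0 // IH size_lin_factor.
Qed.

Lemma omit_rem s mu : uniq s -> omit_prod s mu = root_prod (rem mu s).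
Proof. by move=> us; rewrite rem_filter // /root_prod big_filter. Qed.

Lemma size_omit s mu : uniq s -> all (fun y => y != 0) s -> mu \in s ->
  size (omit_prod s mu) = size s.
Proof.
move=> us s0 ms; rewrite omit_rem // size_root_prod ?size_rem //.
  by rewrite prednK //; case: s ms {us s0}.
by apply/allP => y /mem_rem; apply: (allP s0).
Qed.

Lemma omit_root s mu x : uniq s -> all (fun y => y != 0) s ->
  ((omit_prod s mu).[x] == 0) = (x \in s) && (x != mu).
Proof.
move=> us s0; rewrite omit_rem // root_prod_root; first by rewrite mem_rem_uniq // inE andbC.
by apply/allP => y /mem_rem; apply: (allP s0).
Qed.

(** Splitting over the complex numbers, where all the roots turn out to be real. *)
Lemma split_real p : p.[0] != 0 ->
    (forall z, ceval p z = 0 -> exists x, z = x%:C) ->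
    (forall x, p.[x] = 0 -> p^`().[x] != 0) ->
  exists s, [/\ uniq s, all (fun y => y != 0) s & p = (p.[0])%:P * root_prod s].
Proof.
move=> p0 real simple.
have pn0 : p != 0 by apply: contraNneq p0 => ->; rewrite horner0.
set pC := map_poly (real_complex R) p.
have [r hr] := closed_field_poly_normal pC.
have lc0 : lead_coef pC != 0 by rewrite lead_coef_eq0 map_poly_eq0.
have rootr z : z \in r -> exists x, z = x%:C.
  move=> zr; apply: real; rewrite /ceval -/pC hr hornerZ.
  by rewrite horner_prod (big_rem z) //= hornerXsubC subrr mul0r mulr0.
pose s := map (@complex.Re R) r.
have rs : r = map (real_complex R) s.
  rewrite /s -map_comp -[LHS]map_id; apply/eq_in_map => z /rootr[x ->] //=.
have pE : p = lead_coef p *: \prod_(x <- s) ('X - x%:P).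
  apply: (map_poly_inj (real_complex R)); rewrite -/pC hr map_polyZ lead_coef_map.
  rewrite rmorph_prod rs big_map; congr (_ *: _); apply: eq_bigr => x _ /=.
  by rewrite rmorphB /= map_polyX map_polyC.
have s0 x : x \in s -> x != 0.
  move=> xs; apply: contraNneq p0 => x0; rewrite pE hornerZ horner_prod.
  by rewrite (big_rem x) //= hornerXsubC x0 subrr mul0r mulr0.
have us : uniq s.
  apply: contraT => /(uniqPn 0)[i [j [ij js eij]]].
  set x := nth 0 s i in eij; have xs : x \in s by rewrite eij mem_nth.
  have [q qE] : exists q, p = ('X - x%:P) ^+ 2 * q.
    rewrite pE (big_nth 0) big_mkord.
    have is_ : (i < size s)%N := ltn_trans ij js.
    rewrite (bigD1 (Ordinal is_)) //= (bigD1 (Ordinal js)) /=; last first.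
      by rewrite -val_eqE /= gtn_eqF.
    rewrite -eij -/x; eexists; rewrite !mulrA -expr2 scalerAr; reflexivity.
  have px : p.[x] = 0 by rewrite qE !hornerE subrr expr0n /= mul0r.
  have := simple x px; suff -> : p^`().[x] = 0 by rewrite eqxx.
  by rewrite qE expr2 !derivM !derivXsubC !(hornerXsubC, hornerM, hornerD) subrr !(mul0r, mulr0, addr0).
exists s; split=> //; first exact/allP.
have [k kE] : exists k : R, p = k%:P * root_prod s.
  exists (lead_coef p * \prod_(x <- s) (- x)).
  rewrite {1}pE -mul_polyC polyCM -mulrA; congr (_ * _).
  rewrite rmorph_prod /root_prod -big_split /=; apply: eq_big_seq => x /s0 xn0.
  exact: XsubC_lin_factor.
by rewrite {2}kE hornerM root_prod0 hornerC mulr1.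
Qed.

Lemma Im_sum (T : Type) (r : seq T) (P : pred T) (F : T -> R[i]) :
  complex.Im (\sum_(x <- r | P x) F x) = \sum_(x <- r | P x) complex.Im (F x).
Proof. by apply: big_morph => // -[a b] [c d]. Qed.

Lemma Im_inv z : complex.Im z^-1 = - complex.Im z / (complex.Re z ^+ 2 + complex.Im z ^+ 2).
Proof. by case: z => a b /=; rewrite mulNr. Qed.

Lemma Im_scale x z : complex.Im (x%:C * z) = x * complex.Im z.
Proof. by case: z => a b /=; rewrite mul0r addr0. Qed.

Lemma sum_pos s (F : R -> R) : s != [::] -> (forall x, x \in s -> 0 < F x) ->
  0 < \sum_(x <- s) F x.
Proof.
case: s => // x s _ h; rewrite big_cons ltr_pwDl ?h ?mem_head // big_seq sumr_ge0 //.
by move=> y ys; rewrite ltW // h // in_cons ys orbT.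
Qed.

(** The numerator of $b + \sum_\mu c_\mu / (1 - z/\mu)$ over the common denominator
    [root_prod s]. *)
Definition herglotz b c s : {poly R} :=
  b%:P * root_prod s + \sum_(mu <- s) (c mu)%:P * omit_prod s mu.

Lemma herglotz_at b c s mu : uniq s -> all (fun y => y != 0) s -> mu \in s ->
  (herglotz b c s).[mu] = c mu * (omit_prod s mu).[mu].
Proof.
move=> us s0 ms; rewrite /herglotz hornerD hornerM.
have /eqP -> : (root_prod s).[mu] == 0 by rewrite root_prod_root.
rewrite mulr0 add0r horner_sum (bigD1_seq mu) //= !hornerE big_seq_cond big1 ?addr0 //.
move=> x /andP[xs xm]; rewrite hornerM.
have /eqP -> : (omit_prod s x).[mu] == 0 by rewrite omit_root // ms eq_sym.
by rewrite mulr0.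
Qed.

(** This is the derivative of the quotient of [herglotz b c s] by [root_prod s],
    cleared of denominators; it is positive on the real line. *)
Lemma herglotz_wronskian b c s : uniq s ->
  root_prod s * (herglotz b c s)^`() - (root_prod s)^`() * herglotz b c s =
  \sum_(mu <- s) (c mu / mu)%:P * omit_prod s mu ^+ 2.
Proof.
move=> us; rewrite /herglotz derivD derivM derivC mul0r add0r (raddf_sum (@deriv R)) /=.
rewrite mulrDr mulrDr !mulr_sumr opprD addrACA.
have -> : root_prod s * (b%:P * (root_prod s)^`()) - (root_prod s)^`() * (b%:P * root_prod s) = 0 by ring.
rewrite add0r -sumrB; apply: eq_big_seq => mu ms.
rewrite derivM derivC mul0r add0r (root_prod_omit us ms) derivM.
rewrite {2}/lin_factor derivB derivM derivX !derivC mul0r add0r mulr1 add0r polyCM.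
ring.
Qed.

(** Zeros of $g(z) = b + \sum_\mu c_\mu/(1 - z/\mu)$ with positive $c_\mu$. They are
    real since the imaginary part of $g(z)$ has the sign of that of $z$, positive
    since the numerator is at least $1$ on $z \leq 0$, simple and separated by
    the poles since $g$ increases between two poles. *)
Lemma herglotz_zeros b c s : uniq s -> (forall mu, mu \in s -> 0 < mu) ->
    (forall mu, mu \in s -> 0 < c mu) -> 0 <= b -> b + \sum_(mu <- s) c mu = 1 ->
  exists Z, [/\ uniq Z, (forall x, x \in Z -> 0 < x), herglotz b c s = root_prod Z,
    (forall x, x \in Z -> 0 < (herglotz b c s)^`().[x] * (root_prod s).[x]) &
    (forall x y, x \in Z -> y \in Z -> x < y -> exists2 mu, mu \in s & x < mu < y)].
Proof.
move=> us sp cp b0 sum1; set n := herglotz b c s.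
have s0 : all (fun y => y != 0) s by apply/allP => y /sp /lt0r_neq0.
have n0 : n.[0] = 1.
  rewrite /n /herglotz hornerD hornerM root_prod0 hornerC mulr1 horner_sum -[RHS]sum1.
  by congr (_ + _); apply: eq_bigr => x _; rewrite hornerM hornerC omit0 mulr1.
have nmu mu : mu \in s -> n.[mu] != 0.
  move=> ms; rewrite /n herglotz_at // mulf_neq0 //; first by rewrite lt0r_neq0 ?cp.
  by rewrite omit_root // eqxx andbF.
have posn x : x <= 0 -> n.[x] != 0.
  move=> x0; suff : 1 <= n.[x] by move=> h; rewrite gt_eqF // (lt_le_trans ltr01).
  have lx mu : mu \in s -> 1 <= (lin_factor mu).[x].
    by move=> /sp m0; rewrite lin_factorE lerDl oppr_ge0 mulr_le0_ge0 // invr_ge0 ltW.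
  rewrite /n /herglotz hornerD hornerM hornerC horner_sum -sum1.
  have pl (P : pred R) : 1 <= (\prod_(y <- s | P y) lin_factor y).[x].
    rewrite horner_prod big_seq_cond; elim/big_ind: _ => //.
      by move=> u v u1 v1; rewrite -[1]mulr1 ler_pM.
    by move=> y /andP[ys _]; apply: lx.
  apply: lerD; first by rewrite -[leLHS]mulr1 ler_wpM2l // pl.
  rewrite big_seq [leRHS]big_seq; apply: ler_sum => mu ms.
  by rewrite hornerM hornerC -[leLHS]mulr1 ler_wpM2l ?pl // ltW ?cp.
have evC z : (forall mu, mu \in s -> z != mu%:C) -> ceval n z =
   ceval (root_prod s) z * (b%:C + \sum_(mu <- s) (c mu)%:C * (1 - z / mu%:C)^-1).
  move=> zs; rewrite /n /herglotz cevalD cevalM cevalC mulrDr mulrC; congr (_ + _).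
  rewrite (big_morph (fun p => ceval p z) (fun p q => cevalD p q z)
     (_ : ceval 0 z = 0)); last by rewrite -[0]polyC0 cevalC.
  rewrite mulr_sumr; apply: eq_big_seq => mu ms.
  rewrite (root_prod_omit us ms) !cevalM cevalC.
  have -> : ceval (lin_factor mu) z = 1 - z / mu%:C.
    by rewrite /lin_factor cevalD cevalN cevalM -[1]polyC1 !cevalC cevalX mulrC fmorphV.
  have m0 : mu%:C != 0 :> R[i] by rewrite fmorph_eq0 lt0r_neq0 ?sp.
  have h : 1 - z / mu%:C != 0.
    rewrite subr_eq0; apply: contraNneq (zs _ ms) => e.
    by rewrite -[z](mulfVK m0) -e mul1r.
  by move: (1 - _) (ceval (omit_prod s mu) z) h => L o h; field.
have real z : ceval n z = 0 -> exists x, z = x%:C.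
  move=> nz; have [/hasP[mu ms /eqP ->]|] := boolP (has (fun mu => z == mu%:C) s).
    by exists mu.
  move=> /hasPn zs; have {}zs mu : mu \in s -> z != mu%:C by apply: zs.
  have Yz : ceval (root_prod s) z != 0.
    rewrite /ceval rmorph_prod horner_prod prodf_seq_neq0; apply/allP => mu ms /=.
    have -> : (map_poly (real_complex R) (lin_factor mu)).[z] = 1 - z / mu%:C.
      by rewrite -/(ceval _ _) /lin_factor cevalD cevalN cevalM -[1]polyC1 !cevalC cevalX mulrC fmorphV.
    have m0 : mu%:C != 0 :> R[i] by rewrite fmorph_eq0 lt0r_neq0 ?sp.
    rewrite subr_eq0; apply: contraNneq (zs _ ms) => e.
    by rewrite -[z](mulfVK m0) -e mul1r.
  (* At a + i d the imaginary part of the sum is d times a positive number. *)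
  move: nz; rewrite evC // => /eqP; rewrite mulf_eq0 (negPf Yz) /= => /eqP g0.
  case: z zs {evC Yz} g0 => a d zs g0; have [->|dn0] := eqVneq d 0; first by exists a.
  have := congr1 (@complex.Im R) g0.
  have -> : complex.Im (b%:C + \sum_(mu <- s) (c mu)%:C * (1 - (a +i* d) / mu%:C)^-1) =
    d * \sum_(mu <- s) c mu / mu * ((1 - a / mu) ^+ 2 + (d / mu) ^+ 2)^-1.
    have ImD u v : complex.Im (u + v) = complex.Im u + complex.Im v :> R by case: u v => ? ? [].
    rewrite ImD /= add0r Im_sum mulr_sumr; apply: eq_big_seq => mu /sp m0.
    rewrite Im_scale Im_inv.
    have -> : 1 - (a +i* d) / mu%:C = (1 - a / mu) +i* (- (d / mu)).
      rewrite -fmorphV; apply/eqP; rewrite eq_complex.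
      by apply/andP; split; apply/eqP => /=; ring.
    by rewrite /= opprK sqrrN; ring.
  have [s_nil|s_cons] := eqVneq s [::].
    move: g0 sum1; rewrite s_nil !big_nil !addr0 => + b1; rewrite b1 => /eqP.
    by rewrite fmorph_eq0 oner_eq0.
  move=> /eqP; rewrite mulf_eq0 (negPf dn0) /= gt_eqF // sum_pos // => mu ms.
  have m0 := sp _ ms.
  rewrite mulr_gt0 ?divr_gt0 ?cp // invr_gt0 ltr_wpDl ?sqr_ge0 // exprn_even_gt0 //=.
  by rewrite mulf_neq0 // invr_eq0 lt0r_neq0.
have disj x : n.[x] = 0 -> x \notin s.
  by move=> nx; apply/negP => /nmu; rewrite nx eqxx.
have sne x : n.[x] = 0 -> s != [::].
  move=> nx; apply/eqP => s_nil; move: nx sum1.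
  rewrite /n /herglotz s_nil !big_nil !addr0 /root_prod big_nil mulr1 hornerC => -> /eqP.
  by rewrite eq_sym oner_eq0.
have slope x : n.[x] = 0 -> 0 < n^`().[x] * (root_prod s).[x].
  move=> nx; have := congr1 (horner^~ x) (herglotz_wronskian b c us); rewrite -/n.
  rewrite hornerD hornerN !hornerM nx mulr0 subr0 mulrC => ->.
  rewrite horner_sum sum_pos ?(sne x) // => mu ms; rewrite hornerM hornerC.
  apply: mulr_gt0; first by rewrite divr_gt0 ?cp ?sp.
  rewrite horner_exp exprn_even_gt0 //=.
  by rewrite omit_root // (negPf (disj _ nx)).
have [Z [uZ Z0 nZ]] : exists s',
    [/\ uniq s', all (fun y => y != 0) s' & n = (n.[0])%:P * root_prod s'].
  apply: split_real => //; first by rewrite n0 oner_eq0.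
  by move=> x /slope; apply: contraTneq => ->; rewrite mul0r ltxx.
rewrite n0 polyC1 mul1r in nZ.
have Zn x : x \in Z -> n.[x] = 0.
  by move=> xZ; apply/eqP; rewrite nZ root_prod_root.
exists Z.
have Zpos x : x \in Z -> 0 < x.
  by move=> /Zn nx; rewrite ltNge; apply/negP => /posn; rewrite nx eqxx.
split=> // [x /Zn /slope //|x y xZ yZ xy].
have [/hasP[mu ms mxy]|/hasPn none] := boolP (has (fun mu => x < mu < y) s).
  by exists mu.
pose g u := b + \sum_(mu <- s) c mu / (1 - u / mu).
have g0 u : u \in Z -> g u = 0.
  move=> /Zn nu; have us' := disj _ nu.
  have : ceval n u%:C = 0 by rewrite ceval_real nu.
  rewrite evC; last by move=> mu ms; apply: contraNneq us' => /complexI ->.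
  rewrite ceval_real => /eqP; rewrite mulf_eq0 fmorph_eq0 root_prod_root // (negPf us') /=.
  move=> h; apply: (@complexI R); rewrite rmorph0 -(eqP h) /g rmorphD rmorph_sum /=.
  congr (_ + _); apply: eq_bigr => mu _.
  by rewrite rmorphM fmorphV rmorphB rmorph1 rmorphM fmorphV.
have : 0 < g y - g x; last by rewrite !g0 // subrr ltxx.
rewrite /g opprD addrACA subrr add0r -sumrB sum_pos ?(sne x) ?Zn // => mu ms.
have m0 := sp _ ms.
have dx : 1 - x / mu != 0.
  by rewrite -lin_factorE lin_factor_root ?lt0r_neq0 //; apply: contraTneq ms => <-; apply/disj/Zn.
have dy : 1 - y / mu != 0.
  by rewrite -lin_factorE lin_factor_root ?lt0r_neq0 //; apply: contraTneq ms => <-; apply/disj/Zn.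
have -> : c mu / (1 - y / mu) - c mu / (1 - x / mu) =
   c mu * ((y - x) / mu) / ((1 - y / mu) * (1 - x / mu)).
  have -> : (y - x) / mu = (1 - x / mu) - (1 - y / mu) by ring.
  by move: (1 - _) (1 - _) dx dy => u v dx dy; field; rewrite dx dy.
have num : 0 < c mu * ((y - x) / mu) by rewrite mulr_gt0 ?cp ?divr_gt0 ?subr_gt0.
apply: divr_gt0 => //; have := none _ ms; rewrite negb_and -!leNgt => /orP[mx|ym].
  have lx : 1 - x / mu < 0 by rewrite lt_neqAle dx subr_le0 ler_pdivlMr // mul1r.
  have ly : 1 - y / mu < 0.
    by rewrite lt_neqAle dy subr_le0 ler_pdivlMr // mul1r (le_trans mx) ?ltW.
  by rewrite nmulr_rgt0.
have ly : 0 < 1 - y / mu by rewrite lt_def dy subr_ge0 ler_pdivrMr // mul1r.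
have lx : 0 < 1 - x / mu.
  by rewrite lt_def dx subr_ge0 ler_pdivrMr // mul1r (le_trans _ ym) ?ltW.
exact: mulr_gt0.
Qed.
End herglotz_functions.

(** * The inverse problem on a half-line *)

Section half_line.
Context {R : realType}.
Implicit Types (s Z : seq R) (p : {poly R}) (k : R -> R).

Lemma poly_eq0_roots p s : uniq s -> (forall x, x \in s -> p.[x] = 0) ->
  (size p <= size s)%N -> p = 0.
Proof.
move=> us ps sz; apply: (roots_geq_poly_eq0 _ us sz).
by apply/allP => x /ps px; apply/rootP.
Qed.

(** Lagrange interpolation on the nodes $s$. *)
Lemma lagrange p s : uniq s -> all (fun y => y != 0) s -> (size p <= size s)%N ->
  p = herglotz 0 (fun x => p.[x] / (omit_prod s x).[x]) s.
Proof.
move=> us s0 sz; apply/eqP; rewrite -subr_eq0; apply/eqP; apply: (poly_eq0_roots us).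
  move=> x xs; rewrite hornerD hornerN herglotz_at // divfK ?subrr //.
  by rewrite omit_root // eqxx andbF.
rewrite (leq_trans (size_polyD _ _)) // geq_max sz size_polyN /herglotz mul0r add0r.
rewrite big_seq; apply: (leq_trans (size_sum _ _ _)); apply/bigmax_leqP_seq => x xs _.
by rewrite mul_polyC (leq_trans (size_scale_leq _ _)) // size_omit.
Qed.

Lemma deriv_root_prod s x : uniq s -> x \in s -> x != 0 ->
  (root_prod s)^`().[x] = - x^-1 * (omit_prod s x).[x].
Proof.
move=> us xs x0; rewrite (root_prod_omit us xs) derivM hornerD !hornerM lin_factorE divff // subrr mul0r addr0.
by rewrite /lin_factor derivB derivM derivX !derivC !hornerE.
Qed.

Lemma coef_omit s x : uniq s -> all (fun y => y != 0) s -> x \in s ->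
  (omit_prod s x)`_(size s).-1 = - x * lead_coef (root_prod s).
Proof.
move=> us s0 xs; have x0 := allP s0 _ xs; have szo := size_omit us s0 xs.
have lo : lead_coef (omit_prod s x) = (omit_prod s x)`_(size s).-1 by rewrite lead_coefE szo.
rewrite (root_prod_omit us xs) lead_coefM -lo mulrA.
have -> : lead_coef (lin_factor x) = - x^-1.
  by rewrite lead_coefE size_lin_factor // /lin_factor coefB coefCM coefX coef1 /= mulr1 sub0r.
by rewrite mulrNN divff ?mul1r.
Qed.

Lemma size_herglotz0 k s : uniq s -> all (fun y => y != 0) s ->
  (size (herglotz 0 k s) <= size s)%N.
Proof.
move=> us s0; rewrite /herglotz mul0r add0r.
rewrite big_seq; apply: (leq_trans (size_sum _ _ _)); apply/bigmax_leqP_seq => x xs _.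
by rewrite mul_polyC (leq_trans (size_scale_leq _ _)) // size_omit.
Qed.

Lemma coef_herglotz0 k s : uniq s -> all (fun y => y != 0) s ->
  (herglotz 0 k s)`_(size s).-1 = - lead_coef (root_prod s) * \sum_(x <- s) k x * x.
Proof.
move=> us s0; rewrite /herglotz mul0r add0r coef_sum mulr_sumr.
by apply: eq_big_seq => x xs; rewrite coefCM coef_omit //; ring.
Qed.

Lemma half_exp_sq (x : R) : half_exp x ^+ 2 = expR x.
Proof. by rewrite /half_exp expr2 -expRD -splitr. Qed.

Lemma size_drop p m : (size p <= m.+1)%N -> p`_m = 0 -> (size p <= m)%N.
Proof.
move=> sz pm; apply/leq_sizeP => j mj; case: (ltngtP m j) mj => // [mj|<-] _ //.
by rewrite nth_default // (leq_trans sz).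
Qed.

(** Stieltjes continued fraction. The last two equations prescribe $\psi'/\psi$ at
    $a$ for $\psi = A + B e^x$, which is affine in $t = e^x$. The first atom sits
    where the degree of $\psi$ drops, and its mass is what lowers the degree of
    $B$; what remains is a problem of the same form with one pole less. *)
Lemma half_line_inverse s (a : R) k : uniq s -> (forall x, x \in s -> 0 < x) ->
    (forall x, x \in s -> 0 < k x) ->
  exists r, [/\ all is_atom r, ordered r, all (fun t => a < pos t) r,
    (jost_right r).1 + (expR a)%:P * (jost_right r).2 = root_prod s
  & (expR a)%:P * (jost_right r).2 = 'X * herglotz 0 k s].
Proof.
move: {2}(size s) (erefl (size s)) => m; elim: m s a k => [|m IH] s a k.
  move=> /size0nil -> _ _ _; exists [::]; split => //=.
    by rewrite mulr0 addr0 /root_prod big_nil.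
  by rewrite /herglotz big_nil mul0r !mulr0 addr0 mulr0.
move=> szs us sp kp.
have s0 : all (fun y => y != 0) s by apply/allP => y /sp /lt0r_neq0.
have sn : s != [::] by rewrite -size_eq0 szs.
(* With t = e^a, the value A + B t1 drops in degree at t1 = t (1 + th). *)
pose th := (\sum_(x <- s) k x * x)^-1.
have S1 : 0 < \sum_(x <- s) k x * x.
  by apply: sum_pos => // x xs; rewrite mulr_gt0 ?kp ?sp.
have th0 : 0 < th by rewrite invr_gt0.
pose c x := th * (k x * x).
have cp x : x \in s -> 0 < c x.
  by move=> xs; apply: mulr_gt0 => //; rewrite mulr_gt0 ?kp ?sp.
have [|||Z [uZ Zp nZ dZ _]] := @herglotz_zeros R 0 c s us sp.
- exact: cp.
- by [].
- by rewrite add0r -mulr_sumr mulVf ?gt_eqF.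
have Z0 : all (fun y => y != 0) Z by apply/allP => y /Zp /lt0r_neq0.
set u := herglotz 0 k s; set y1 := herglotz 0 c s in nZ dZ.
have L0 : lead_coef (root_prod s) != 0 by rewrite lead_coef_eq0 -size_poly_gt0 size_root_prod.
have S2 : 0 < \sum_(x <- s) c x * x.
  by apply: sum_pos => // x xs; rewrite mulr_gt0 ?cp ?sp.
have y1c : y1`_m != 0.
  have := coef_herglotz0 c us s0; rewrite szs -/y1 /= => ->.
  by rewrite mulf_neq0 ?oppr_eq0 // gt_eqF.
have szZ : size Z = m.
  apply: succn_inj; rewrite -size_root_prod // -nZ; apply/eqP.
  rewrite eqn_leq -{1}szs size_herglotz0 //= ltnNge.
  by apply: contra y1c => /(nth_default 0) ->.
have y1E : y1 = root_prod s + th%:P * 'X * u.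
  rewrite /y1 /u /herglotz !mul0r !add0r.
  have -> : root_prod s = th%:P * \sum_(x <- s) (k x)%:P * (x%:P * lin_factor x * omit_prod s x).
    rewrite (eq_big_seq (fun x => (k x * x)%:P * root_prod s)); last first.
      by move=> x xs; rewrite -mulrA -(root_prod_omit us xs) mulrA -polyCM.
    rewrite -mulr_suml mulrA -(raddf_sum (@polyC R)) -polyCM mulVf ?gt_eqF //.
    by rewrite polyC1 mul1r.
  rewrite mulr_sumr mulr_sumr -big_split /=; apply: eq_big_seq => x xs.
  have x0 := lt0r_neq0 (sp _ xs).
  have xx : x%:P * x^-1%:P = 1 :> {poly R} by rewrite -polyCM divff.
  by rewrite /c /lin_factor !polyCM; ring: xx.
(* The quotient of the leading coefficients, for which u - w0 y1 drops in degree. *)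
pose w0 := u`_m / y1`_m.
have w00 : 0 < w0.
  have um := coef_herglotz0 k us s0; have ym := coef_herglotz0 c us s0.
  rewrite szs -/u -/y1 /= in um ym.
  by rewrite /w0 um ym -mulf_div divff ?mul1r ?oppr_eq0 // divr_gt0.
pose u2 := (1 + th)%:P * (u - w0%:P * y1).
have thp : 0 < 1 + th by rewrite addr_gt0.
have szu2 : (size u2 <= size Z)%N.
  rewrite szZ; apply: size_drop.
    rewrite /u2 mul_polyC (leq_trans (size_scale_leq _ _)) //.
    rewrite (leq_trans (size_polyD _ _)) // geq_max size_polyN mul_polyC.
    by rewrite (leq_trans (size_scale_leq _ _)) -?szs ?size_herglotz0.
  by rewrite /u2 coefCM coefB coefCM /w0 divfK // subrr mulr0.
have u2E := lagrange uZ Z0 szu2.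
pose x1 := a + ln (1 + th).
have ax1 : a < x1 by rewrite ltrDl ln_gt0 // ltrDl.
have ex1 : expR x1 = expR a * (1 + th) by rewrite expRD lnK.
have [|r [br or ra rA rB]] := IH Z x1 (fun x => u2.[x] / (omit_prod Z x).[x]) szZ uZ Zp.
  move=> x xZ; have := dZ x xZ; rewrite {1}nZ deriv_root_prod ?(allP Z0) //.
  have y1x : y1.[x] = 0 by apply/eqP; rewrite nZ root_prod_root.
  have -> : (root_prod s).[x] = - (th * x * u.[x]).
    have := congr1 (horner^~ x) y1E; rewrite y1x !hornerE => /eqP.
    by rewrite eq_sym addr_eq0 => /eqP ->.
  have -> : u2.[x] = (1 + th) * u.[x] by rewrite /u2 !hornerM hornerD hornerN hornerM y1x mulr0 subr0 hornerC.
  have on : (omit_prod Z x).[x] != 0 by rewrite omit_root // eqxx andbF.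
  have x0 := Zp _ xZ.
  have -> : - x^-1 * (omit_prod Z x).[x] * - (th * x * u.[x]) =
     th * (omit_prod Z x).[x] ^+ 2 * (u.[x] / (omit_prod Z x).[x]).
    by field; rewrite on lt0r_neq0.
  rewrite pmulr_rgt0; last by rewrite mulr_gt0 // exprn_even_gt0.
  by move=> h; rewrite -mulrA mulr_gt0.
rewrite -u2E in rB; rewrite -nZ in rA; pose t1 : atom R := (x1, w0 * (1 + th), 0); exists (t1 :: r).
set A := (jost_right r).1 in rA rB; set B := (jost_right r).2 in rA rB.
have ee : (half_exp x1)%:P * (half_exp x1)%:P = (expR a)%:P * (1 + th)%:P :> {poly R}.
  by rewrite -polyCM -expr2 half_exp_sq ex1 polyCM.
have e'e : (half_exp x1)^-1%:P * (half_exp x1)%:P = 1 :> {poly R} := half_expVK_poly x1.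
have TB : (expR a)%:P * B = 'X * (u - w0%:P * y1).
  apply: (@mulfI _ (1 + th)%:P); first by rewrite polyC_eq0 gt_eqF.
  by rewrite mulrA -polyCM mulrC [(1 + th) * _]mulrC -ex1 mulrC rB /u2; ring.
have F1 : value x1 (A, B) = (half_exp x1)^-1%:P * y1.
  by rewrite /value /= -rA ex1 polyCM -ee; ring: e'e.
have q1 : strength t1 = w0%:P * (1 + th)%:P * 'X.
  by rewrite /strength /= polyC0 mul0r addr0 polyCM.
have xB : (expR a)%:P * (B + (half_exp x1)^-1%:P * (strength t1 * ((half_exp x1)^-1%:P * y1)))
   = 'X * u.
  have h : (half_exp x1)^-1%:P * (half_exp x1)^-1%:P * ((expR a)%:P * (1 + th)%:P) = 1 :> {poly R}.
    by rewrite -ee; ring: e'e.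
  rewrite mulrDr TB q1.
  set e' := (half_exp x1)^-1%:P in h *; set T := (expR a)%:P in h *; set H := (1 + th)%:P in h *.
  have -> : T * (e' * (w0%:P * H * 'X * (e' * y1))) = (e' * e' * (T * H)) * (w0%:P * 'X * y1) by ring.
  by rewrite h; ring.
split.
- by rewrite /= br /is_atom /= lexx addr0 normr_gt0 mulf_neq0 // gt_eqF.
- by rewrite ordered_cons or andbT; apply: sub_all ra.
- rewrite /= ax1 /=; apply: sub_all ra => t /=; exact: lt_trans.
- have -> : jost_right (t1 :: r) = cross t1 (A, B) by rewrite /A /B /=; case: (jost_right r).
  rewrite /cross [pos t1]/= F1 [X in X + _]/= [X in _ * X]/= xB.
  have -> : A = y1 - 'X * u2 by rewrite -rB -rA; ring.
  have -> : root_prod s = y1 - th%:P * 'X * u by rewrite y1E; ring.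
  by rewrite q1 /u2 polyCD polyC1; ring: e'e.
- have -> : jost_right (t1 :: r) = cross t1 (A, B) by rewrite /A /B /=; case: (jost_right r).
  by rewrite /cross [pos t1]/= F1 [X in _ * X]/= xB.
Qed.
End half_line.

(** * Exponential waves and the equation between atoms *)

Section waves.
Context {R : realType}.
Implicit Types (a b c x y : R) (g h : R -> R).

Definition rwave a b x : R := (half_exp x)^-1 * a + half_exp x * b.

Lemma is_derive_half x : is_derive x 1 (fun y : R => y / 2) 2^-1.
Proof.
have -> : (fun y : R => y / 2) = id * cst 2^-1 by apply/funext.
by apply: is_derive_eq; rewrite /GRing.scale /= mulr0 add0r mulr1.
Qed.

Lemma is_derive_half_exp x : is_derive x 1 (@half_exp R) (half_exp x / 2).
Proof.
exact: (@is_derive1_comp _ expR (fun y => y / 2) x _ _ (is_derive_expR _) (is_derive_half x)).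
Qed.

Lemma is_derive_half_expV x :
  is_derive x 1 (fun x => (half_exp x)^-1) (- ((half_exp x)^-1 / 2)).
Proof.
have -> : (fun x => (half_exp x)^-1) = @half_exp R \o -%R.
  by apply/funext => y /=; rewrite half_expN.
rewrite -half_expN -mulrN1.
by apply: is_derive1_comp; apply: is_derive_half_exp.
Qed.

Lemma is_derive_rwave a b x : is_derive x 1 (rwave a b) (rwave (- (a / 2)) (b / 2) x).
Proof.
have := is_derive_half_exp x; have := is_derive_half_expV x => h1 h2.
have -> : rwave a b = (fun x => (half_exp x)^-1) * cst a + (@half_exp R) * cst b.
  by apply/funext.
apply: (is_derive_eq (is_deriveD (is_deriveM h1 (is_derive_cst a x 1))
  (is_deriveM h2 (is_derive_cst b x 1)))).
rewrite /GRing.scale /= /rwave; ring.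
Qed.

Lemma derive1_rwave a b : derive1 (rwave a b) = rwave (- (a / 2)) (b / 2).
Proof.
by apply/funext => x; rewrite derive1E; apply: (@derive_val _ _ _ _ _ _ _ (is_derive_rwave a b x)).
Qed.

Lemma derivable_rwave a b x : derivable (rwave a b) x 1.
Proof. exact: (@ex_derive _ _ _ _ _ _ _ (is_derive_rwave a b x)). Qed.

Lemma continuous_rwave a b : continuous (rwave a b).
Proof.
by move=> x; apply/differentiable_continuous/derivable1_diffP/derivable_rwave.
Qed.

Lemma const_of_derive0 g x y : x <= y ->
  (forall t, x <= t <= y -> is_derive t 1 g 0) -> g x = g y.
Proof.
move=> xy dg; have [||c _] := @MVT_segment R g (cst 0) x y xy.
- by move=> t; rewrite in_itv /= => /andP[xt ty]; apply: dg; rewrite !ltW.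
- apply: derivable_within_continuous => t; rewrite in_itv /= => xty.
  by have [] := dg t xty.
by rewrite /= mul0r => /eqP; rewrite subr_eq0 => /eqP.
Qed.

(** The functions $(g' + g/2) e^{-x/2}$ and $(g' - g/2) e^{x/2}$ have zero
    derivative. The set $P$ is convex, for instance an open gap between atoms or
    a half-line. *)
Lemma rwave_ode g (P : R -> Prop) :
    (forall x y t, P x -> P y -> x <= t <= y -> P t) ->
    (forall x, P x -> [/\ derivable g x 1, derivable (derive1 g) x 1
       & - derive1 (derive1 g) x + 4^-1 * g x = 0]) ->
  exists a b, forall x, P x -> g x = rwave a b x.
Proof.
move=> cvx ode; have [[x0 P0]|no] := pselect (exists x, P x); last first.
  by exists 0, 0 => x Px; case: no; exists x.
pose u1 x := (derive1 g x + g x / 2) * (half_exp x)^-1.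
pose u2 x := (derive1 g x - g x / 2) * half_exp x.
have d1 x : P x -> is_derive x 1 u1 0 /\ is_derive x 1 u2 0.
  move=> /ode[dg ddg e].
  have ig : is_derive x 1 g (derive1 g x).
    exact (DeriveDef dg (esym (derive1E g x))).
  have igg : is_derive x 1 (derive1 g) (derive1 (derive1 g) x).
    exact (DeriveDef ddg (esym (derive1E (derive1 g) x))).
  have e2 : derive1 (derive1 g) x = 4^-1 * g x.
    by apply/eqP; rewrite eq_sym -subr_eq0 addrC e.
  have h1 := is_derive_half_exp x; have h2 := is_derive_half_expV x.
  split.
    have -> : u1 = (derive1 g + g * cst 2^-1) * (fun x => (half_exp x)^-1) by apply/funext.
    have hh := is_deriveM (is_deriveD igg
      (is_deriveM ig (is_derive_cst (2^-1 : R) x 1))) h2.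
    apply: (is_derive_eq hh).
    rewrite /GRing.scale /= e2 /=.
    rewrite -[(_ + _) x]/(derive1 g x + g x * 2^-1) /=.
    by set k := (half_exp x)^-1; field.
  have -> : u2 = (derive1 g - g * cst 2^-1) * (@half_exp R) by apply/funext.
  apply: (is_derive_eq (is_deriveM (is_deriveB igg
    (is_deriveM ig (is_derive_cst (2^-1 : R) x 1))) h1)).
  rewrite /GRing.scale /= e2 /=.
  rewrite -[(_ - _) x]/(derive1 g x - g x * 2^-1) /=.
  by field.
have cst1 x : P x -> u1 x = u1 x0 /\ u2 x = u2 x0.
  move=> Px; case: (leP x x0) => [xx0|/ltW xx0].
    by split; apply: const_of_derive0 => // t xt; have [] := d1 t (cvx _ _ _ Px P0 xt).
  by split; apply/esym; apply: const_of_derive0 => // t xt; have [] := d1 t (cvx _ _ _ P0 Px xt).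
exists (- u2 x0), (u1 x0) => x /cst1[<- <-].
rewrite /rwave /u1 /u2; have := half_exp_gt0 x => /lt0r_neq0 h; by field.
Qed.

Implicit Types (A B z : R[i]) (f : R -> R[i]).

(** The solution with complex amplitudes $A$ and $B$ of $-f'' + f/4 = 0$. *)
Definition wave A B x : R[i] := (half_exp x)^-1%:C * A + (half_exp x)%:C * B.

Lemma repart_wave A B : repart (wave A B) = rwave (complex.Re A) (complex.Re B).
Proof.
apply/funext => x; rewrite /repart /wave /rwave; case: A B => [a1 a2] [b1 b2] /=.
by rewrite !mul0r !subr0.
Qed.

Lemma impart_wave A B : impart (wave A B) = rwave (complex.Im A) (complex.Im B).
Proof.
apply/funext => x; rewrite /impart /wave /rwave; case: A B => [a1 a2] [b1 b2] /=.
by rewrite !mul0r !addr0.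
Qed.

Lemma wave_parts A B x : wave A B x =
  rwave (complex.Re A) (complex.Re B) x +i* rwave (complex.Im A) (complex.Im B) x.
Proof. by rewrite -repart_wave -impart_wave /repart /impart; case: (wave _ _ _). Qed.

Lemma halfc A : (complex.Re A / 2) +i* (complex.Im A / 2) = A / 2.
Proof.
have -> : (2 : R[i])^-1 = (2^-1)%:C by rewrite fmorphV rmorph_nat.
by case: A => a b; rewrite /= -[RHS]/(_ +i* _) !mulr0 subr0 add0r.
Qed.

Lemma Re_half A : complex.Re (A / 2) = complex.Re A / 2.
Proof. by rewrite -halfc. Qed.

Lemma Im_half A : complex.Im (A / 2) = complex.Im A / 2.
Proof. by rewrite -halfc. Qed.

Lemma ReN A : complex.Re (- A) = - complex.Re A. Proof. by case: A. Qed.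
Lemma ImN A : complex.Im (- A) = - complex.Im A. Proof. by case: A. Qed.

Lemma cderive_wave A B : cderive (wave A B) = wave (- (A / 2)) (B / 2).
Proof.
apply/funext => x; rewrite /cderive repart_wave impart_wave !derive1_rwave.
by rewrite wave_parts !ReN !ImN !Re_half !Im_half.
Qed.

Lemma derive1_near g h x : (\forall t \near x, g t = h t) -> derive1 g x = derive1 h x.
Proof. by move=> gh; rewrite !derive1E; apply: near_eq_derive. Qed.

Lemma cderive_near f1 f2 x : (\forall t \near x, f1 t = f2 t) -> cderive f1 x = cderive f2 x.
Proof.
move=> e; rewrite /cderive; congr (_ +i* _); apply: derive1_near;
  by apply: filterS e => t; rewrite /repart /impart => ->.
Qed.

Lemma cderivable_near f1 f2 x : (\forall t \near x, f1 t = f2 t) ->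
  cderivable f1 x -> cderivable f2 x.
Proof.
move=> e [d1 d2]; split; [apply: near_eq_derivable d1|apply: near_eq_derivable d2];
  by apply: filterS e => t; rewrite /repart /impart => ->.
Qed.

Lemma cderivable_wave A B x : cderivable (wave A B) x.
Proof. by split; rewrite ?repart_wave ?impart_wave; apply: derivable_rwave. Qed.

Lemma wave_solves f A B (P : set R) x : open P -> P x ->
    (forall t, P t -> f t = wave A B t) ->
  [/\ cderivable f x, cderivable (cderive f) x
    & - cderive (cderive f) x + 4^-1 * f x = 0].
Proof.
move=> oP Px fP.
have nP y : P y -> \forall t \near y, P t by move=> Py; apply: open_nbhs_nbhs.
have nf y : P y -> \forall t \near y, wave A B t = f t.
  by move=> /nP; apply: filterS => t /fP.
have nf' y : P y -> \forall t \near y, wave (- (A / 2)) (B / 2) t = cderive f t.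
  by move=> /nP; apply: filterS => t Pt; rewrite -cderive_wave; apply/cderive_near/nf.
split.
- by apply: (cderivable_near (nf x Px)); apply: cderivable_wave.
- by apply: (cderivable_near (nf' x Px)); apply: cderivable_wave.
rewrite -(cderive_near (nf' x Px)) cderive_wave fP // /wave.
by move: (_ %:C) (_ %:C) => u v; field.
Qed.

Lemma wave_ode f (P : R -> Prop) :
    (forall x y t, P x -> P y -> x <= t <= y -> P t) ->
    (forall x, P x -> [/\ cderivable f x, cderivable (cderive f) x
       & - cderive (cderive f) x + 4^-1 * f x = 0]) ->
  exists A B, forall x, P x -> f x = wave A B x.
Proof.
move=> cvx ode.
have e4 : (4 : R[i])^-1 = (4^-1)%:C by rewrite fmorphV rmorph_nat.
have [|a [b ab]] := @rwave_ode (repart f) P cvx.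
  move=> x /ode[[d1 _] [d2 _] e]; split => //.
  have := congr1 (@complex.Re R) e; rewrite e4 /repart.
  by case: (f x) => u v /=; rewrite mul0r subr0.
have [|c [d cd]] := @rwave_ode (impart f) P cvx.
  move=> x /ode[[_ d1] [_ d2] e]; split => //.
  have := congr1 (@complex.Im R) e; rewrite e4 /impart.
  by case: (f x) => u v /=; rewrite mul0r addr0.
exists (a +i* c), (b +i* d) => x Px; rewrite wave_parts /= -ab // -cd //.
by rewrite /repart /impart; case: (f x).
Qed.
End waves.

(** * A solution is determined by its behaviour on the right *)

Section uniqueness.
Context {R : realType}.
Implicit Types (p l r : seq (atom R)) (x y : R).
Implicit Types (A B z : R[i]) (f : R -> R[i]).

Lemma near_ccvg_wave (F : set_system R) {FF : Filter F} f A B x : F --> x ->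
  (\forall t \near F, f t = wave A B t) -> ccvg f F (wave A B x).
Proof.
move=> Fx e; split.
  have -> : complex.Re (wave A B x) = repart (wave A B) x by [].
  apply: (@cvg_trans _ (repart (wave A B) @ F)).
    by apply: near_eq_cvg; apply: filterS e => t; rewrite /repart => ->.
  apply: (cvg_trans (cvg_app _ Fx)); rewrite repart_wave; exact: continuous_rwave.
have -> : complex.Im (wave A B x) = impart (wave A B) x by [].
apply: (@cvg_trans _ (impart (wave A B) @ F)).
  by apply: near_eq_cvg; apply: filterS e => t; rewrite /impart => ->.
apply: (cvg_trans (cvg_app _ Fx)); rewrite impart_wave; exact: continuous_rwave.
Qed.

Lemma ccvg_unique (F : set_system R) {FF : ProperFilter F} f (l1 l2 : R[i]) :
  ccvg f F l1 -> ccvg f F l2 -> l1 = l2.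
Proof.
move=> [r1 i1] [r2 i2]; apply/eqP; rewrite eq_complex.
by apply/andP; split; apply/eqP; [apply: cvg_unique r1 r2|apply: cvg_unique i1 i2].
Qed.

Lemma left_to x : x^'- --> x. Proof. exact: cvg_within. Qed.
Lemma right_to x : x^'+ --> x. Proof. exact: cvg_within. Qed.

Lemma ccvg_at (F : set_system R) f x : ccontinuous f -> F --> x -> ccvg f F (f x).
Proof. by move=> [c1 c2] Fx; split; apply: (cvg_trans (cvg_app _ Fx)); [apply: c1|apply: c2]. Qed.

Lemma near_left (P : R -> Prop) x y : y < x -> (forall t, y < t < x -> P t) ->
  \forall t \near x^'-, P t.
Proof.
move=> yx h; near=> t; apply: h; apply/andP; split; near: t.
  exact: nbhs_left_gt.
exact: nbhs_left_lt.
Unshelve. all: by end_near. Qed.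

Lemma near_right (P : R -> Prop) x y : x < y -> (forall t, x < t < y -> P t) ->
  \forall t \near x^'+, P t.
Proof.
move=> yx h; near=> t; apply: h; apply/andP; split; near: t.
  exact: nbhs_right_gt.
exact: nbhs_right_lt.
Unshelve. all: by end_near. Qed.

(** Just to the right of $x$, and at $x$ itself, the same atoms remain to be
    crossed. *)
Lemma gap_right p x : exists2 y, x < y & forall t, x <= t < y ->
  [seq s <- p | t < pos s] = [seq s <- p | x < pos s].
Proof.
elim: p => [|s p [y xy IH]] /=; first by exists (x + 1); rewrite ?ltrDl.
exists (if x < pos s then Num.min y (pos s) else y).
  by case: ifP => // xs; rewrite lt_min xy.
move=> t; case: ifP => xs /andP[xt ty].
  move: ty; rewrite lt_min => /andP[ty ts]; rewrite ts IH //; exact/andP.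
rewrite ifF ?IH //; first exact/andP.
by apply: contraFF xs; apply: le_lt_trans.
Qed.

Lemma gap_left p x : exists2 y, y < x & forall t, y < t < x ->
  [seq s <- p | t < pos s] = [seq s <- p | x <= pos s].
Proof.
elim: p => [|s p [y xy IH]] /=; first by exists (x - 1); rewrite ?gtrBl.
exists (if x <= pos s then y else Num.max y (pos s)).
  by case: ifP => // /negbT; rewrite -ltNge gt_max xy => ->.
move=> t; case: ifP => [xs /andP[xt ty]|/negbT]; first by rewrite (lt_le_trans ty xs) IH ?xt.
rewrite -ltNge => xs /andP[]; rewrite gt_max => /andP[yt st] tx.
by rewrite lt_gtF // IH // yt.
Qed.

Definition jostC p z x : R[i] := ceval (jost p x) z.

Definition wave_of (u : {poly R} * {poly R}) z := wave (ceval u.1 z) (ceval u.2 z).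

Lemma ceval_value u z x : ceval (value x u) z = wave_of u z x.
Proof. by rewrite /value cevalD !cevalM !cevalC. Qed.

(** [cross] produces the jump of the derivative required of a solution. *)
Lemma cderive_jump u (t : atom R) z :
  wave (- (ceval (cross t u).1 z / 2)) (ceval (cross t u).2 z / 2) (pos t) =
  wave (- (ceval u.1 z / 2)) (ceval u.2 z / 2) (pos t)
    + ceval (strength t) z * wave_of u z (pos t).
Proof.
rewrite -ceval_value -cevalM /cross; move: (strength t * value _ _) => c.
rewrite !(cevalD, cevalN, cevalM, cevalC) /wave.
have h : (half_exp (pos t))^-1%:C * (half_exp (pos t))%:C = 1 :> R[i].
  by rewrite -rmorphM half_expVK rmorph1.
set e' := (half_exp (pos t))^-1%:C in h *; set e := (half_exp (pos t))%:C in h *.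
move: e e' (ceval c z) h => e e' k h.
have -> : - ((ceval u.1 z - e * k) / 2) = - (ceval u.1 z / 2) + e * k / 2 by ring.
have -> : e' * (- (ceval u.1 z / 2) + e * k / 2) + e * ((ceval u.2 z + e' * k) / 2) =
  e' * - (ceval u.1 z / 2) + e * (ceval u.2 z / 2) + (e' * e) * k by field.
by rewrite h mul1r.
Qed.

Lemma ceval_strength (t : atom R) z : ceval (strength t) z = z * (wgt t)%:C + z ^+ 2 * (dip t)%:C.
Proof.
rewrite /strength !(cevalD, cevalM, cevalC, cevalX); ring.
Qed.

(** Cauchy data at one point determine the amplitudes. *)
Lemma wave_inj A B A' B' x : wave A B x = wave A' B' x ->
  wave (- (A / 2)) (B / 2) x = wave (- (A' / 2)) (B' / 2) x -> A = A' /\ B = B'.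
Proof.
rewrite /wave.
have h : (half_exp x)^-1%:C * (half_exp x)%:C = 1 :> R[i].
  by rewrite -rmorphM half_expVK rmorph1.
set e' := (half_exp x)^-1%:C in h *; set e := (half_exp x)%:C in h *.
move: e e' h => e e' h h1 h2; split.
  have : e' * A = e' * A'.
    have -> : e' * A = ((e' * A + e * B) - 2 * (e' * - (A / 2) + e * (B / 2))) / 2 by field.
    by rewrite h1 h2; field.
  by move=> /(congr1 ( *%R e)); rewrite !mulrA [e * e']mulrC h !mul1r.
have : e * B = e * B'.
  have -> : e * B = ((e' * A + e * B) + 2 * (e' * - (A / 2) + e * (B / 2))) / 2 by field.
  by rewrite h1 h2; field.
by move=> /(congr1 ( *%R e')); rewrite !mulrA h !mul1r.
Qed.

Lemma split_at p x : ordered p ->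
  p = [seq s <- p | pos s < x] ++ [seq s <- p | x <= pos s].
Proof.
elim: p => [//|t p IH]; rewrite ordered_cons => /andP[tp op] /=.
case: (ltP (pos t) x) => tx /=; first by rewrite -IH.
have xp s : s \in p -> x < pos s by move=> /(allP tp); apply: le_lt_trans.
rewrite (eq_in_filter (a2 := pred0)) ?filter_pred0; last first.
  by move=> s /xp /ltW; rewrite leNgt => /negPf.
by rewrite (eq_in_filter (a2 := predT)) ?filter_predT // => s /xp /ltW ->.
Qed.

(** Whether or not an atom at $x$ itself has been crossed does not matter for the
    value at $x$. *)
Lemma value_at p x : ordered p -> value x (jost_right [seq s <- p | x <= pos s]) =
  value x (jost_right [seq s <- p | x < pos s]).
Proof.
elim: p => [//|t p IH]; rewrite ordered_cons => /andP[tp op] /=.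
case: (ltgtP x (pos t)) => xt /=; last 2 first.
- exact: IH.
- rewrite [in LHS]xt value_cross -xt (eq_in_filter (a2 := (fun s => x < pos s))) //.
  by move=> s /(allP tp); rewrite -xt => xs; rewrite xs ltW.
have xp s : s \in p -> (x < pos s) by move=> /(allP tp); apply: lt_trans.
by rewrite (@eq_in_filter _ _ (fun s => x < pos s)) // => s /xp xs; rewrite xs ltW.
Qed.

Lemma room_left l x : all (fun s => pos s < x) l ->
  exists2 y, y < x & all (fun s => pos s < y) l.
Proof.
elim: l => [_|s l IH /= /andP[sx /IH[y yx yl]]]; first by exists (x - 1); rewrite ?gtrBl.
exists (Num.max y ((pos s + x) / 2)); first by rewrite gt_max yx; lra.
rewrite lt_max; apply/andP; split; first by apply/orP; right; lra.
by apply: sub_all yl => q; rewrite lt_max => ->.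
Qed.

Lemma room_right r x : all (fun s => x < pos s) r ->
  exists2 y, x < y & all (fun s => y < pos s) r.
Proof.
elim: r => [_|s r IH /= /andP[sx /IH[y yx yr]]]; first by exists (x + 1); rewrite ?ltrDl.
exists (Num.min y ((pos s + x) / 2)); first by rewrite lt_min yx; lra.
rewrite gt_min; apply/andP; split; first by apply/orP; right; lra.
by apply: sub_all yr => q; rewrite gt_min => ->.
Qed.

Lemma cderive_wave_on f A B (x y s : R) : x < s < y ->
    (forall t, x < t < y -> f t = wave A B t) ->
  cderive f s = wave (- (A / 2)) (B / 2) s.
Proof.
move=> sy h; rewrite -cderive_wave; apply: cderive_near.
have : s \in `]x, y[%R by rewrite in_itv.
by move=> /near_in_itvoo; apply: filterS => t; rewrite in_itv /=; apply: h.
Qed.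

(** Uniqueness: on each gap the solution is a wave, and the conditions at the
    atom on its right determine the two amplitudes from those of the next gap. *)
Lemma solution_jost p z f A : ordered p -> solution p z f ->
    (forall x, all (fun s => pos s < x) p -> f x = A * wave_of (1, 0) z x) ->
  forall x, f x = A * jostC p z x.
Proof.
move=> op [cf ode jump] tail.
have wA u x : A * wave_of u z x = wave (A * ceval u.1 z) (A * ceval u.2 z) x.
  by rewrite /wave_of /wave mulrDr ![A * (_ * _)]mulrCA.
have main r l : p = l ++ r -> forall x, all (fun s => pos s < x) l ->
    all (fun s => x <= pos s) r -> f x = A * wave_of (jost_right r) z x.
  elim: r l => [|t r IH] l pE x lx xr.
    by apply: tail; move: pE; rewrite cats0 => ->.
  have tp : t \in p by rewrite pE mem_cat mem_head orbT.
  move: (op); rewrite pE ordered_cat ordered_cons => /and3P[_ /andP[tr _] lo].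
  have lt : all (fun s => pos s < pos t) l.
    by apply/allP => s sl; have /allP/(_ s sl)/= /andP[] := lo.
  have [dl [dr [cl cr jmp]]] := jump t tp.
  have pE' : p = rcons l t ++ r by rewrite cat_rcons.
  have IHr y : pos t < y -> all (fun s => y <= pos s) r ->
      f y = A * wave_of (jost_right r) z y.
    move=> ty yr; apply: (IH _ pE') => //; rewrite all_rcons ty /=.
    by apply: sub_all lt => s st; apply: lt_trans st ty.
  have [y ty yr] := room_right tr.
  set u := jost_right r in IHr.
  have fr y' : pos t < y' < y -> f y' = wave (A * ceval u.1 z) (A * ceval u.2 z) y'.
    move=> /andP[ty' yy']; rewrite -wA; apply: IHr => //.
    by apply: sub_all yr => q /ltW; apply: le_trans (ltW yy').
  have [y0 y0t yl] := room_left lt.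
  pose P (s : R) := all (fun q => pos q < s) l /\ s < pos t.
  have Pl s : y0 < s < pos t -> P s.
    move=> /andP[ys st]; split => //; apply: sub_all yl => q qy; exact: lt_trans ys.
  have [|s Ps|A1 [B1 fl]] := @wave_ode _ f P.
  - move=> s1 s2 s [l1 _] [_ l2] /andP[s1s ss2]; split; last exact: le_lt_trans ss2 l2.
    by apply: sub_all l1 => q; move/lt_le_trans; apply.
  - apply: ode; rewrite pE map_cat mem_cat /= in_cons !negb_or; case: Ps => Ps st.
    rewrite (lt_eqF st) /=; apply/andP; split; apply/mapP => -[q ql sq].
      by have := allP Ps _ ql; rewrite sq ltxx.
    by have := lt_trans st (allP tr _ ql); rewrite sq ltxx.
  have {}fl0 s : y0 < s < pos t -> f s = wave A1 B1 s by move=> /Pl /fl.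
  have near_l (h : R -> Prop) : (forall s, y0 < s < pos t -> h s) ->
    \forall s \near (pos t)^'-, h s by exact: near_left.
  have near_r (h : R -> Prop) : (forall s, pos t < s < y -> h s) ->
    \forall s \near (pos t)^'+, h s by exact: near_right.
  have fl' s : y0 < s < pos t -> cderive f s = wave (- (A1 / 2)) (B1 / 2) s.
    by move=> sy; apply: cderive_wave_on sy fl0.
  have fr' s : pos t < s < y ->
      cderive f s = wave (- (A * ceval u.1 z / 2)) (A * ceval u.2 z / 2) s.
    by move=> sy; apply: cderive_wave_on sy fr.
  have nR h a b : (forall s, pos t < s < y -> h s = wave a b s) ->
      ccvg h (pos t)^'+ (wave a b (pos t)).
    by move=> e; apply: near_ccvg_wave; [exact: right_to|exact: near_r].
  have nL h a b : (forall s, y0 < s < pos t -> h s = wave a b s) ->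
      ccvg h (pos t)^'- (wave a b (pos t)).
    by move=> e; apply: near_ccvg_wave; [exact: left_to|exact: near_l].
  have ftr : f (pos t) = wave (A * ceval u.1 z) (A * ceval u.2 z) (pos t).
    apply: ccvg_unique (nR _ _ _ fr); exact: ccvg_at cf (@right_to (pos t)).
  have ftl : f (pos t) = wave A1 B1 (pos t).
    apply: ccvg_unique (nL _ _ _ fl0); exact: ccvg_at cf (@left_to (pos t)).
  have dlE : dl = wave (- (A1 / 2)) (B1 / 2) (pos t) by apply: ccvg_unique cl (nL _ _ _ fl').
  have drE : dr = wave (- (A * ceval u.1 z / 2)) (A * ceval u.2 z / 2) (pos t).
    by apply: ccvg_unique cr (nR _ _ _ fr').
  have [A1E B1E] : A1 = A * ceval (cross t u).1 z /\ B1 = A * ceval (cross t u).2 z.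
    apply: (@wave_inj _ _ _ _ (pos t)).
      by rewrite -ftl -wA -ceval_value value_cross ceval_value wA.
    have wA2 a b : wave (- (A * a / 2)) (A * b / 2) (pos t) =
        A * wave (- (a / 2)) (b / 2) (pos t) by rewrite /wave; ring.
    rewrite -dlE jmp drE !wA2.
    have wA' a b : wave (A * a) (A * b) (pos t) = A * wave a b (pos t).
      by rewrite /wave mulrDr ![A * (_ * _)]mulrCA.
    rewrite cderive_jump ceval_strength ftr wA' /wave_of; ring.
  have -> : wave_of (jost_right (t :: r)) z x = wave_of (cross t u) z x by [].
  rewrite wA -A1E -B1E; move: xr => /= /andP[]; rewrite le_eqVlt => /orP[/eqP -> //|xt] _.
  exact: fl.
move=> x; rewrite (main [seq s <- p | x <= pos s] [seq s <- p | pos s < x]); last 3 first.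
- exact: split_at.
- exact: filter_all.
- exact: filter_all.
by rewrite /jostC -ceval_value value_at.
Qed.
End uniqueness.

(** * Existence of the Jost solution, eigenvalues and norming constants *)

Section jost_solutions.
Context {R : realType}.
Implicit Types (p l r : seq (atom R)) (x y : R).
Implicit Types (A B z : R[i]) (f : R -> R[i]).

(** Existence: the waves selected by [cross] fit together at the atoms. *)
Lemma jostC_solution p z : ordered p -> solution p z (jostC p z).
Proof.
move=> op.
have right x : exists2 y, x < y & forall s, x <= s < y ->
    jostC p z s = wave_of (jost_right [seq s <- p | x < pos s]) z s.
  have [y xy e] := gap_right p x; exists y => // s /e h.
  by rewrite /jostC /jost h ceval_value.
have left x : exists2 y, y < x & forall s, y < s < x ->
    jostC p z s = wave_of (jost_right [seq s <- p | x <= pos s]) z s.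
  have [y xy e] := gap_left p x; exists y => // s /e h.
  by rewrite /jostC /jost h ceval_value.
have at_x x : jostC p z x = wave_of (jost_right [seq s <- p | x < pos s]) z x.
  by rewrite /jostC ceval_value.
have at_x' x : jostC p z x = wave_of (jost_right [seq s <- p | x <= pos s]) z x.
  by rewrite -ceval_value value_at.
have cR x : ccvg (jostC p z) x^'+ (jostC p z x).
  have [y xy e] := right x; rewrite at_x; apply: near_ccvg_wave; first exact: right_to.
  by apply: (near_right xy) => s /andP[xs sy]; apply: e; rewrite ltW.
have cL x : ccvg (jostC p z) x^'- (jostC p z x).
  have [y xy e] := left x; rewrite at_x'; apply: near_ccvg_wave; first exact: left_to.
  exact: (near_left xy) e.
split.
- by split=> x; apply/left_right_continuousP; split;
   [case: (cL x)|case: (cR x)|case: (cL x)|case: (cR x)].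
- move=> x xp; have [y1 xy1 e1] := right x; have [y2 xy2 e2] := left x.
  have ef : [seq s <- p | x <= pos s] = [seq s <- p | x < pos s].
    apply: eq_in_filter => s sp; rewrite le_eqVlt; case: eqP => //= xs.
    by case/mapP: xp; exists s.
  rewrite ef in e2; set u := jost_right _ in e1 e2.
  apply: (@wave_solves _ _ (ceval u.1 z) (ceval u.2 z) [set` `]y2, y1[%R]).
  + exact: interval_open.
  + by rewrite /= in_itv /= xy1 xy2.
  move=> s; rewrite /= in_itv /= => /andP[s1 s2].
  by case: (ltP s x) => sx; [apply: e2; rewrite s1|apply: e1; rewrite sx].
move=> t tp.
have [y1 ty1 e1] := right (pos t); have [y2 ty2 e2] := left (pos t).
have [l [r pE]] : exists l r, p = l ++ t :: r.
  by case/splitPr: tp op => l r _; exists l, r.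
have := op; rewrite [X in ordered X]pE ordered_cat ordered_cons => /and3P[_ /andP[tr _] lo].
have lt s : s \in l -> pos s < pos t by move=> sl; have /andP[] := allP lo _ sl.
have er : [seq s <- p | pos t < pos s] = r.
  rewrite pE filter_cat /= ltxx (eq_in_filter (a2 := pred0)) ?filter_pred0 /=.
    exact/all_filterP.
  by move=> s /lt /lt_gtF.
have el : [seq s <- p | pos t <= pos s] = t :: r.
  rewrite pE filter_cat /= lexx (eq_in_filter (a2 := pred0)) ?filter_pred0 /=.
    by congr cons; apply/all_filterP; apply: sub_all tr => s; apply: ltW.
  by move=> s /lt; rewrite leNgt => ->.
rewrite er in e1; rewrite el (_ : jost_right (t :: r) = cross t (jost_right r)) // in e2; set u := jost_right r in e1 e2.
exists (wave (- (ceval (cross t u).1 z / 2)) (ceval (cross t u).2 z / 2) (pos t)),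
   (wave (- (ceval u.1 z / 2)) (ceval u.2 z / 2) (pos t)).
split.
- apply: near_ccvg_wave; first exact: left_to.
  apply: (near_left ty2) => s sy; apply: cderive_wave_on sy _ => q; exact: e2.
- apply: near_ccvg_wave; first exact: right_to.
  apply: (near_right ty1) => s sy; apply: cderive_wave_on sy _ => q /andP[q1 q2].
  by apply: e1; rewrite ltW.
by rewrite cderive_jump ceval_strength at_x er -/u; ring.
Qed.

Lemma wave_of_free z x : wave_of (1, 0) z x = wave 1 0 x.
Proof. by rewrite /wave_of /= /ceval rmorph1 rmorph0 hornerC horner0. Qed.

Lemma jostC_tail p z x : all (fun s => pos s < x) p ->
  jostC p z x = (expR (- (x / 2)))%:C.
Proof.
move=> px; rewrite /jostC /jost (eq_in_filter (a2 := pred0)) ?filter_pred0.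
  by rewrite ceval_value wave_of_free /wave mulr0 addr0 mulr1 expRN.
by move=> s /(allP px) /lt_gtF.
Qed.

Lemma above_all p : exists x, all (fun s => pos s < x) p.
Proof.
elim: p => [|s p [x px]]; first by exists 0.
exists (Num.max x (pos s + 1)) => /=; rewrite lt_max ltrDl ltr01 orbT /=.
by apply: sub_all px => q; rewrite lt_max => ->.
Qed.

Lemma solution_wave_right p z f : solution p z f ->
  exists A B, forall x, all (fun s => pos s < x) p -> f x = wave A B x.
Proof.
move=> [_ ode _]; apply: wave_ode.
  by move=> x y t xp _ /andP[xt _]; apply: sub_all xp => q qx; apply: lt_le_trans xt.
by move=> x xp; apply: ode; apply/mapP => -[s sp xs]; have := allP xp _ sp; rewrite xs ltxx.
Qed.

(** Two points near $+\infty$ suffice to see that a solution equal to $e^{-x/2}$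
    there has amplitudes $(1, 0)$ on the whole right half-line. *)
Lemma phi_plus_jost p z : ordered p -> phi_plus p z = jostC p z.
Proof.
move=> op; rewrite /phi_plus; set S := [set f | _].
have S0 : S (jostC p z).
  split; first exact: jostC_solution.
  have [x px] := above_all p; near=> y; apply: jostC_tail.
  apply: sub_all px => q qx; apply: lt_trans qx _.
  by near: y; apply: nbhs_pinfty_gt; rewrite num_real.
have [sol nr] : S (xget (fun=> 0) S) by apply: xgetPex; exists (jostC p z).
set f := xget _ _ in sol nr *.
have [x0 px0] := above_all p.
have [A [B AB]] := solution_wave_right sol.
have [M [_ hM]] := nr.
have up y : x0 < y -> all (fun s => pos s < y) p.
  by move=> xy; apply: sub_all px0 => q qx; apply: lt_trans qx xy.
have key y : M < y -> x0 < y -> A + (expR y)%:C * B = 1.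
  move=> My xy; have := AB y (up y xy); rewrite hM //.
  have -> : expR (- (y / 2)) = (half_exp y)^-1 by rewrite expRN.
  rewrite /wave -half_exp_sq rmorphXn /= => h.
  have hn : (half_exp y)%:C != 0 :> R[i] by rewrite fmorph_eq0 gt_eqF // half_exp_gt0.
  rewrite fmorphV /= in h; apply: (@mulfI _ (half_exp y)%:C^-1); first by rewrite invr_eq0.
  by rewrite mulr1 [RHS]h; field.
pose y := Num.max M x0 + 1.
have yM : M < y by rewrite /y ltr_pwDr // le_max lexx.
have yx : x0 < y by rewrite /y ltr_pwDr // le_max lexx orbT.
have k1 := key y yM yx.
have k2 : A + (expR (y + 1))%:C * B = 1 by apply: key; lra.
have B0 : B = 0.
  have : ((expR (y + 1))%:C - (expR y)%:C) * B = 0.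
    by rewrite mulrBl -[RHS](subrr 1) -{1}k2 -k1; ring.
  move=> /eqP; rewrite mulf_eq0 -rmorphB fmorph_eq0 subr_eq0 gt_eqF ?ltr_expR ?ltrDl //=.
  by move=> /eqP.
have A1 : A = 1 by rewrite -k1 B0 mulr0 addr0.
apply/funext => x; rewrite -[RHS]mul1r.
by apply: solution_jost => // y' /AB ->; rewrite mul1r A1 B0 wave_of_free.
Unshelve. all: by end_near.
Qed.

Lemma normcD A B : normc (A + B) <= normc A + normc B.
Proof. by rewrite -lecR rmorphD; exact: (lec_normD A B). Qed.

Lemma normc_real (x : R) : normc x%:C = `|x|.
Proof. by rewrite /= expr0n addr0 sqrtr_sqr. Qed.

Lemma Re_le_normc A : `|complex.Re A| <= normc A.
Proof. by case: A => a b /=; rewrite -sqrtr_sqr ler_wsqrtr // lerDl sqr_ge0. Qed.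

Lemma Im_le_normc A : `|complex.Im A| <= normc A.
Proof. by case: A => a b /=; rewrite -sqrtr_sqr ler_wsqrtr // lerDr sqr_ge0. Qed.

Lemma normc_ge0 A : 0 <= normc A.
Proof. by case: A => a b; apply: sqrtr_ge0. Qed.

Lemma half_exp_le (x y : R) : (half_exp x <= half_exp y) = (x <= y).
Proof. by rewrite leNgt half_exp_lt -leNgt. Qed.

Lemma wave_bound A B (x y v : R) : x <= v -> v <= y ->
  normc (wave A B v) <= (half_exp x)^-1 * normc A + half_exp y * normc B.
Proof.
move=> xv vy; apply: (le_trans (normcD _ _)); have v0 := half_exp_gt0 v.
rewrite !normcM !normc_real !gtr0_norm ?invr_gt0 //.
apply: lerD; apply: ler_wpM2r; rewrite ?normc_ge0 // ?half_exp_le //.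
by rewrite lef_pV2 ?posrE ?half_exp_gt0 // half_exp_le.
Qed.

Lemma jost_bounded_right p z (x0 : R) : ordered p ->
  exists M : R, forall x, x0 <= x -> normc (jostC p z x) <= M.
Proof.
elim: p => [_|t p IH op].
  exists (half_exp x0)^-1 => x xx0; rewrite jostC_tail // normc_real gtr0_norm ?expR_gt0 //.
  by rewrite expRN -/(half_exp x) lef_pV2 ?posrE ?half_exp_gt0 // half_exp_le.
have [tp op'] : all (fun s => pos t < pos s) p /\ ordered p.
  by move: op; rewrite ordered_cons => /andP[].
have [M hM] := IH op'; set u := jost_right (t :: p).
exists (Num.max M ((half_exp x0)^-1 * normc (ceval u.1 z)
   + half_exp (pos t) * normc (ceval u.2 z))) => x xx0; rewrite le_max.
case: (ltP x (pos t)) => xt; last first.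
  by rewrite /jostC /jost /= ltNge xt /= -/(jost p x) -/(jostC p z x) hM.
apply/orP; right; rewrite /jostC /jost.
have -> : [seq s <- t :: p | x < pos s] = t :: p.
  by apply/all_filterP; rewrite /= xt /=; apply: sub_all tp => q; apply: lt_trans.
by rewrite ceval_value; apply: wave_bound => //; apply: ltW.
Qed.

Lemma rwave_bounded (a b x0 M : R) :
  (forall x, x0 < x -> `|rwave a b x| <= M) -> b = 0.
Proof.
move=> bnd; apply/eqP; apply: contraT => b0.
have nb : 0 < `|b| by rewrite normr_gt0.
pose C := M + (half_exp x0)^-1 * `|a|.
pose x := Num.max (x0 + 1) (2 * C / `|b|).
have x0x : x0 < x by rewrite /x lt_max ltrDl ltr01.
have Cx : C <= x / 2 * `|b|.
  have : 2 * C / `|b| <= x by rewrite /x le_max lexx orbT.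
  by rewrite ler_pdivrMr // => h; lra.
have ex : 1 + x / 2 <= half_exp x by exact: expR_ge1Dx.
have := bnd x x0x; rewrite leNgt => /negP; case.
have lo : half_exp x * `|b| - (half_exp x0)^-1 * `|a| <= `|rwave a b x|.
  rewrite /rwave [X in _ <= `|X|]addrC; apply: (le_trans _ (lerB_normD (half_exp x * b) ((half_exp x)^-1 * a))).
  have h1 := half_exp_gt0 x; have h0 := half_exp_gt0 x0.
  rewrite !normrM (gtr0_norm h1) (@gtr0_norm _ (half_exp x)^-1) ?invr_gt0 //.
  apply: lerB => //.
  by apply: ler_wpM2r => //; rewrite lef_pV2 ?posrE // half_exp_le ltW.
apply: lt_le_trans lo; rewrite ltrBrDr -/C (le_lt_trans Cx) //.
by rewrite ltr_pM2r //; lra.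
Qed.

Lemma wave_bounded_right A B (x0 M : R) :
  (forall x, x0 < x -> normc (wave A B x) <= M) -> B = 0.
Proof.
move=> bnd; apply/eqP; rewrite eq_complex /=; apply/andP; split; apply/eqP.
  apply: (@rwave_bounded (complex.Re A) _ x0 M) => x /bnd; apply: le_trans.
  by rewrite -repart_wave Re_le_normc.
apply: (@rwave_bounded (complex.Im A) _ x0 M) => x /bnd; apply: le_trans.
by rewrite -impart_wave Im_le_normc.
Qed.

Lemma waveN A B (x : R) : wave A B (- x) = wave B A x.
Proof. by rewrite /wave half_expN invrK addrC. Qed.

Lemma wave_bounded_left A B (x0 M : R) :
  (forall x, x < x0 -> normc (wave A B x) <= M) -> A = 0.
Proof.
move=> bnd; apply: (@wave_bounded_right B A (- x0) M) => x xx.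
by rewrite -waveN bnd // ltrNl.
Qed.

Lemma below_all p : exists x, all (fun s => x < pos s) p.
Proof.
elim: p => [|s p [x px]]; first by exists 0.
exists (Num.min x (pos s - 1)) => /=; rewrite gt_min gtrBl ltr01 orbT /=.
by apply: sub_all px => q; rewrite gt_min => ->.
Qed.

Lemma jostC_left p z x : all (fun s => x < pos s) p ->
  jostC p z x = wave_of (jost_right p) z x.
Proof. by move=> /all_filterP e; rewrite /jostC /jost e ceval_value. Qed.

(** Boundedness at $+\infty$ forces a multiple of $\phi_+$, and boundedness at
    $-\infty$ then forces its decaying amplitude on the left to vanish. *)
Lemma eigenvalue_jost p z : ordered p -> Defs.eigenvalue p z <-> ceval (jost_right p).1 z = 0.
Proof.
move=> op; have [x1 lx1] := below_all p; have [x2 lx2] := above_all p; split.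
  move=> [f [sol [x fx] [M fM]]].
  have [A [B AB]] := solution_wave_right sol.
  have B0 : B = 0.
    apply: (@wave_bounded_right A B x2 M) => y yx2; rewrite -AB //.
    by apply: sub_all lx2 => q /lt_trans; apply.
  have fE y : f y = A * jostC p z y.
    by apply: solution_jost => // v /AB ->; rewrite B0 wave_of_free /wave; ring.
  have A0 : A != 0 by apply: contraNneq fx => A0; rewrite fE A0 mul0r.
  have : A * ceval (jost_right p).1 z = 0.
    apply: (@wave_bounded_left _ (A * ceval (jost_right p).2 z) x1 M) => y yx1.
    have -> : wave (A * ceval (jost_right p).1 z) (A * ceval (jost_right p).2 z) y = f y.
      rewrite fE jostC_left; first by rewrite /wave_of /wave; ring.
      by apply: sub_all lx1 => q; apply: lt_trans.
    exact: fM.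
  by move=> /eqP; rewrite mulf_eq0 (negPf A0) => /eqP.
move=> A0; exists (jostC p z); split; first exact: jostC_solution.
  by exists x2; rewrite jostC_tail // fmorph_eq0 gt_eqF // expR_gt0.
have [M hM] := jost_bounded_right z x1 op.
exists (Num.max M (half_exp x1 * normc (ceval (jost_right p).2 z))) => x.
rewrite le_max; case: (leP x1 x) => xx1; first by rewrite hM.
apply/orP; right; rewrite jostC_left; last by apply: sub_all lx1 => q; apply: lt_trans.
have := @wave_bound 0 (ceval (jost_right p).2 z) x x1 x (lexx _) (ltW xx1).
by rewrite normc0 mulr0 add0r /wave_of A0.
Qed.

Lemma gamma2_jost p (x : R) : ordered p ->
  gamma2 p x = \sum_(t <- p) (strength t)^`().[x] * (jost p (pos t)).[x] ^+ 2.
Proof.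
move=> op; rewrite /gamma2 /int_omega /int_v phi_plus_jost //.
rewrite mulr_sumr -big_split /=; apply: eq_bigr => t _.
rewrite /jostC ceval_real normc_real -normrX ger0_norm ?sqr_ge0 //=.
move: (jost p (pos t)).[x] => j.
rewrite horner_strength'; ring.
Qed.

Lemma varphi_jost p (x y : R) : ordered p ->
  varphi p x y = ((jost p y).[x] / Num.sqrt (x * gamma2 p x))%:C.
Proof.
by move=> op; rewrite /varphi phi_plus_jost // /jostC ceval_real rmorphM fmorphV.
Qed.
End jost_solutions.

(** * The Jost polynomials at an interior point *)

Section interior_point.
Context {R : realType}.
Implicit Types (p l r : seq (atom R)) (x y a : R) (s Z : seq R).

Lemma is_pairP p : is_pair p -> [/\ p != [::], ordered p & all is_atom p].
Proof. by rewrite /is_pair -size_eq0 lt0n => /and3P[]. Qed.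

(** By [energy_pos]: $\lambda\gamma^2$ exceeds the energy by $\lambda^2\int|\phi_+|^2 dv$. *)
Lemma norming_pos p x : is_pair p -> (jost_right p).1.[x] = 0 ->
  0 < x * gamma2 p x.
Proof.
move=> /is_pairP[pn op bp] W0; rewrite gamma2_jost //.
have e := energy_pos bp op pn W0; apply: (lt_le_trans e).
rewrite horner_sum mulr_sumr big_seq [leRHS]big_seq; apply: ler_sum => t tp.
rewrite hornerM horner_exp [x * _]mulrA; apply: ler_wpM2r; first exact: sqr_ge0.
have /andP[v0 _] := allP bp t tp.
rewrite horner_strength horner_strength' -subr_ge0.
have -> : x * (wgt t + 2 * dip t * x) - (wgt t * x + dip t * x ^+ 2)
  = dip t * x ^+ 2 by ring.
by rewrite mulr_ge0 ?sqr_ge0.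
Qed.

Lemma deriv_gamma2 p x : ordered p -> (jost_right p).1.[x] = 0 ->
  (jost_right p).1^`().[x] * (jost_right p).2.[x] = - gamma2 p x.
Proof.
move=> op W0; have := congr1 (horner^~ x) (wronskian_deriv op).
rewrite gamma2_jost // !hornerE W0 mul0r subr0 => ->; congr (- _).
by rewrite horner_sum; apply: eq_bigr => t _; rewrite hornerM horner_exp.
Qed.

Lemma left_amplitude_neq0 p x : is_pair p -> (jost_right p).1.[x] = 0 ->
  (jost_right p).2.[x] != 0.
Proof.
move=> ip W0; have [_ op _] := is_pairP ip.
have := norming_pos ip W0; apply: contraTneq => B0; have := deriv_gamma2 op W0.
by rewrite B0 mulr0 => /eqP; rewrite eq_sym oppr_eq0 => /eqP ->; rewrite mulr0 ltxx.
Qed.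

Definition points N (lam : 'I_N -> R) := map lam (enum 'I_N).

Lemma mem_points N (lam : 'I_N -> R) x : reflect (exists i, x = lam i) (x \in points lam).
Proof.
apply: (iffP mapP) => [[i _ ->]|[i ->]]; first by exists i.
by exists i; rewrite ?mem_enum.
Qed.

Lemma incr_inj N (lam : 'I_N -> R) :
  (forall i j : 'I_N, (i < j)%N -> lam i < lam j) -> injective lam.
Proof.
move=> inc i j e; apply: val_inj; case: (ltngtP i j) => // h;
  by have := inc _ _ h; rewrite e ltxx.
Qed.

Lemma root_eigen p x : ordered p -> (jost_right p).1.[x] = 0 <-> Defs.eigenvalue p x%:C.
Proof.
move=> op; rewrite eigenvalue_jost // ceval_real; split=> [->|/eqP]; first by rewrite rmorph0.
by rewrite fmorph_eq0 => /eqP.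
Qed.

(** The zeros of the left amplitude are the eigenvalues, and they are simple
    because its derivative there is a nonzero multiple of $\gamma^2$. *)
Lemma characteristic p N (lam : 'I_N -> R) : is_pair p -> eigenvalues p lam ->
  (jost_right p).1 = root_prod (points lam).
Proof.
move=> ip [inc ev]; have [pn op bp] := is_pairP ip.
have [|z /(eigenvalue_jost z op)/ev[i ->]|x W0|s [us s0 sE]] := @split_real R (jost_right p).1.
- by have [-> _] := jost_right0 p; rewrite oner_eq0.
- by exists (lam i).
- have := norming_pos ip W0; have := deriv_gamma2 op W0 => e.
  apply: contraTneq => W'; move: e; rewrite W' mul0r => /eqP.
  by rewrite eq_sym oppr_eq0 => /eqP ->; rewrite mulr0 ltxx.
have [W00 _] := jost_right0 p.
rewrite {1}sE W00 polyC1 mul1r; apply: perm_big; apply: uniq_perm => //.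
  by rewrite map_inj_uniq ?enum_uniq //; apply: incr_inj.
move=> x; apply/idP/mem_points => [xs|[i ->]].
  have : (jost_right p).1.[x] = 0.
    by apply/eqP; rewrite sE W00 polyC1 mul1r root_prod_root.
  by move=> /(root_eigen _ op)/ev[i /complexI ->]; exists i.
have : (jost_right p).1.[lam i] = 0 by apply/(root_eigen _ op)/ev; exists i.
by move=> /eqP; rewrite sE W00 polyC1 mul1r root_prod_root.
Qed.

(** The polynomial $z \mapsto \phi_-(z, a)$. *)
Definition jost_minus p a : {poly R} :=
  value a (jost_left [seq s <- p | pos s < a]).

(** The characteristic polynomial is the Wronskian of $\phi_+$ and $\phi_-$ at $a$.
    At an eigenvalue the two are proportional, and the factor is the amplitude
    of $\phi_+$ on the far left. *)
Lemma left_right p a : ordered p ->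
  let r := [seq s <- p | a <= pos s] in
  let: (c, d) := jost_left [seq s <- p | pos s < a] in
  (jost_right p).1 = (jost_right r).1 * d - (jost_right r).2 * c /\
  forall x, (jost_right p).1.[x] = 0 ->
    (jost_right r).1.[x] = (jost_right p).2.[x] * c.[x] /\
    (jost_right r).2.[x] = (jost_right p).2.[x] * d.[x].
Proof.
move=> op r; set l := [seq s <- p | pos s < a].
have [s [t]] := transfer l; case: (jost_left l) => c d [det tr].
have pE : jost_right p = ((jost_right r).1 * d - (jost_right r).2 * c,
   (jost_right r).1 * s + (jost_right r).2 * t).
  by rewrite -tr /jost_right -foldr_cat -split_at.
split=> [|x W0]; first by rewrite pE.
have dx : d.[x] * t.[x] + c.[x] * s.[x] = 1.
  by rewrite -!hornerM -hornerD det hornerC.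
have Wx : (jost_right r).1.[x] * d.[x] - (jost_right r).2.[x] * c.[x] = 0.
  by rewrite -W0 pE /= !hornerE.
rewrite pE /= !hornerE.
move: (jost_right r).1.[x] (jost_right r).2.[x] c.[x] d.[x] s.[x] t.[x] dx Wx.
move=> A B C D S T dx Wx; split; apply/eqP; rewrite -subr_eq0; apply/eqP.
  have -> : A - (A * S + B * T) * C = A * (1 - (D * T + C * S)) + T * (A * D - B * C) by ring.
  by rewrite dx Wx subrr !mulr0 addr0.
have -> : B - (A * S + B * T) * D = B * (1 - (D * T + C * S)) - S * (A * D - B * C) by ring.
by rewrite dx Wx subrr !mulr0 subr0.
Qed.

Lemma jost_ge p a : ordered p -> jost p a = value a (jost_right [seq s <- p | a <= pos s]).
Proof. by move=> op; rewrite value_at. Qed.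

Lemma jost_prop p a x : ordered p -> (jost_right p).1.[x] = 0 ->
  (jost p a).[x] = (jost_right p).2.[x] * (jost_minus p a).[x].
Proof.
move=> op W0; rewrite jost_ge // /jost_minus; have := left_right a op.
case: (jost_left _) => c d [_ /(_ x W0)[e1 e2]].
by rewrite /value /= !hornerE /= e1 e2; ring.
Qed.

Lemma jost0 p a : (jost p a).[0] = (half_exp a)^-1.
Proof.
rewrite /jost /value !hornerE; have [-> ->] := jost_right0 [seq s <- p | a < pos s].
by rewrite mulr1 mulr0 addr0.
Qed.

Lemma jost_minus0 p a : (jost_minus p a).[0] = half_exp a.
Proof.
rewrite /jost_minus /jost_left /value /= !hornerE.
by have [-> ->] := jost_right0 (mirror [seq s <- p | pos s < a]); rewrite mulr0 mulr1 add0r.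
Qed.

Lemma roots_eq (P Q : {poly R}) s : uniq s -> (forall x, x \in s -> P.[x] = Q.[x]) ->
  (size P <= size s)%N -> (size Q <= size s)%N -> P = Q.
Proof.
move=> us e sP sQ; apply/eqP; rewrite -subr_eq0; apply/eqP; apply: (poly_eq0_roots us).
  by move=> x /e; rewrite hornerD hornerN => ->; rewrite subrr.
by rewrite (leq_trans (size_polyD _ _)) // geq_max size_polyN sP.
Qed.

(** The weight at $\lambda_i$ is $f_i^2$. Residues are indexed by eigenvalues, not by
    their positions, to fit [herglotz]. *)
Definition weight N (lam f : 'I_N -> R) x : R := \sum_(i | lam i == x) f i ^+ 2.

Lemma weightE N (lam f : 'I_N -> R) i : injective lam -> weight lam f (lam i) = f i ^+ 2.
Proof.
by move=> inj; rewrite /weight (eq_bigl (pred1 i)) ?big_pred1_eq // => j; rewrite /= inj_eq.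
Qed.

Lemma sum_points N (lam f : 'I_N -> R) : injective lam ->
  \sum_(x <- points lam) weight lam f x = \sum_i f i ^+ 2.
Proof.
move=> inj; rewrite /points big_map big_enum /=.
by apply: eq_bigr => i _; rewrite weightE.
Qed.

Lemma size_herglotz b c s : uniq s -> all (fun y => y != 0) s ->
  (size (herglotz b c s) <= (size s).+1)%N.
Proof.
move=> us s0; rewrite /herglotz (leq_trans (size_polyD _ _)) // geq_max.
rewrite mul_polyC (leq_trans (size_scale_leq _ _)) ?size_root_prod //=.
by have := size_herglotz0 c us s0; rewrite /herglotz mul0r add0r; apply: leqW.
Qed.

Lemma herglotz_at0 b c s : (herglotz b c s).[0] = b + \sum_(x <- s) c x.
Proof.
rewrite /herglotz hornerD hornerM root_prod0 hornerC mulr1 horner_sum; congr (_ + _).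
by apply: eq_bigr => x _; rewrite hornerM hornerC omit0 mulr1.
Qed.

Definition residue_data N (lam : 'I_N -> R) (f : 'I_N -> R) p a :=
  forall i, f i = (jost p a).[lam i] / Num.sqrt (lam i * gamma2 p (lam i)).

(** Both sides have degree at most $N$ and agree at zero and at the $N$
    eigenvalues, where the Lagrange identity and the proportionality of
    $\phi_+$ and $\phi_-$ give the value. Divided by the characteristic polynomial
    this is the partial fraction expansion of the diagonal Green function.
    A vanishing $f_i$ ensures that there are atoms on both sides of $a$. *)
Lemma jost_product p a N (lam f : 'I_N -> R) : is_pair p -> eigenvalues p lam ->
    residue_data lam f p a -> (exists i, f i = 0) ->
  let al := 1 - \sum_i f i ^+ 2 in
  0 <= al /\ jost p a * jost_minus p a = herglotz al (weight lam f) (points lam).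
Proof.
move=> ip ev rd [i0 fi0] al; have [pn op bp] := is_pairP ip.
have WE := characteristic ip ev; have inj := incr_inj ev.1.
set ls := points lam in WE *; set W := (jost_right p).1 in WE.
have us : uniq ls by rewrite map_inj_uniq ?enum_uniq.
have W0 x : x \in ls -> W.[x] = 0.
  move=> /mem_points[i ->]; apply/(root_eigen _ op)/ev.2; by exists i.
have s0 : all (fun y => y != 0) ls.
  apply/allP => x /W0; apply: contraPneq => ->; have [-> _] := jost_right0 p.
  by apply/eqP; rewrite oner_eq0.
have li i : lam i \in ls by apply/mem_points; exists i.
have g0 i : 0 < lam i * gamma2 p (lam i) by apply: norming_pos => //; apply: W0.
have Bn0 x : x \in ls -> (jost_right p).2.[x] != 0.
  by move=> /W0; apply: left_amplitude_neq0.
have Pi0 : (jost p a).[lam i0] = 0.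
  move: fi0 => /eqP; rewrite rd mulf_eq0 invr_eq0 sqrtr_eq0 leNgt g0 orbF.
  by move=> /eqP.
have Mi0 : (jost_minus p a).[lam i0] = 0.
  move: Pi0 => /eqP; rewrite (jost_prop _ op (W0 _ (li i0))) mulf_eq0.
  by rewrite (negPf (Bn0 _ (li i0))) => /eqP.
set l := [seq s <- p | pos s < a]; set r := [seq s <- p | a <= pos s].
have rn : r != [::].
  apply: contra_eqN Pi0 => /eqP rnil; rewrite jost_ge // -/r rnil /value /= mulr0 addr0 mulr1.
  by rewrite hornerC invr_eq0 gt_eqF ?half_exp_gt0.
have ln : l != [::].
  apply: contra_eqN Mi0 => /eqP lnil; rewrite /jost_minus -/l lnil /value /jost_left /=.
  by rewrite mulr0 add0r mulr1 hornerC gt_eqF ?half_exp_gt0.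
have bl : all is_atom l by apply/allP => t; rewrite mem_filter => /andP[_ /(allP bp)].
have br : all is_atom r by apply/allP => t; rewrite mem_filter => /andP[_ /(allP bp)].
have := op; rewrite [X in ordered X](split_at a op) ordered_cat => /and3P[ol or _].
have := top_coef bl br ol or (filter_all _ _) (filter_all _ _) ln rn.
have := left_right a op; rewrite -/l -/r -/W.
have Pm : jost_minus p a =
  value a ((jost_right (mirror l)).2, (jost_right (mirror l)).1) by [].
rewrite jost_ge // -/r /jost_left.
move: (jost_right (mirror l)).2 (jost_right (mirror l)).1 Pm => c d Pm [We _].
rewrite Pm -We; move=> [szW szP [rho rho0 rhoE]].
have szls : (total_degree l + total_degree r)%N = size ls.
  by apply: succn_inj; rewrite -szW WE size_root_prod.
rewrite szls in szP rhoE.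
set PP := value a (jost_right r) * value a (c, d) in szP rhoE *.
have PE : PP = herglotz al (weight lam f) ls.
  have PPE : PP = jost p a * jost_minus p a.
    by rewrite jost_ge // -/r Pm.
  apply: (@roots_eq _ _ (0 :: ls)) => //=; last 1 first.
  - exact: size_herglotz.
  - by rewrite us andbT; apply/negP => /(allP s0); rewrite eqxx.
  move=> x; rewrite in_cons => /orP[/eqP ->|/mem_points[i ->]].
    rewrite PPE hornerM jost0 jost_minus0 half_expVK herglotz_at0 sum_points //.
    by rewrite /al subrK.
  have w0 := W0 _ (li i); have gi := g0 i.
  rewrite herglotz_at // weightE // PPE hornerM.
  have Wd : W^`().[lam i] = - (lam i)^-1 * (omit_prod ls (lam i)).[lam i].
    by rewrite WE deriv_root_prod // (allP s0).
  have := deriv_gamma2 op w0; rewrite -/W Wd => WB.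
  have l0 : lam i != 0 by apply: (allP s0).
  have f2 : f i ^+ 2 * (lam i * gamma2 p (lam i)) = (jost p a).[lam i] ^+ 2.
    by rewrite rd expr_div_n sqr_sqrtr ?ltW // divfK // gt_eqF.
  have J := jost_prop a op w0; have B0 := Bn0 _ (li i).
  apply: (mulfI B0); rewrite mulrCA -J -expr2 -f2.
  have -> : gamma2 p (lam i) = (lam i)^-1 * (omit_prod ls (lam i)).[lam i] * (jost_right p).2.[lam i].
    by rewrite -[LHS]opprK -WB; ring.
  by field.
split=> //.
have W_s : W`_(size ls) != 0.
  rewrite -[size ls]/((size ls).+1.-1) -size_root_prod // -WE -lead_coefE lead_coef_eq0.
  by rewrite -size_poly_gt0 WE size_root_prod.
move: rhoE; rewrite PE /herglotz coefD coefCM -/W -WE.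
have -> : (\sum_(mu <- ls) (weight lam f mu)%:P * omit_prod ls mu)`_(size ls) = 0.
  apply: nth_default; have := size_herglotz0 (weight lam f) us s0.
  by rewrite /herglotz mul0r add0r.
by rewrite addr0 => /(mulIf W_s) ->.
Qed.
End interior_point.

(** * Divisors with prescribed signs *)

Section divisors.
Context {R : realType}.
Implicit Types (P Q : {poly R}) (x y nu : R) (s Z ss : seq R) (S : pred R) (c : R -> R).

Lemma root_prod_filter s S :
  root_prod s = root_prod [seq x <- s | S x] * root_prod [seq x <- s | ~~ S x].
Proof. by rewrite /root_prod !big_filter (bigID S). Qed.

(** Poles of weight zero cancel. *)
Lemma herglotz_split b c s : herglotz b c s =
  root_prod [seq x <- s | c x == 0] * herglotz b c [seq x <- s | c x != 0].
Proof.
rewrite /herglotz mulrDr mulrCA -root_prod_filter; congr (_ + _).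
rewrite mulr_sumr big_filter [LHS](bigID (fun x => c x == 0)) /= big1 ?add0r; last first.
  by move=> x /eqP ->; rewrite polyC0 mul0r.
apply: eq_bigr => x cx; rewrite mulrCA; congr (_ * _).
rewrite /omit_prod /root_prod (bigID (fun y => c y == 0)) /= big_filter big_filter_cond; congr (_ * _).
  apply: eq_bigl => y; case: (eqVneq y x) => [->|//]; by rewrite (negPf cx).
by apply: eq_bigl => y; rewrite andbC.
Qed.

Lemma vanish_factor P s : uniq s -> all (fun y => y != 0) s ->
  (forall x, x \in s -> P.[x] = 0) -> exists Q, P = root_prod s * Q.
Proof.
move=> us s0 Ps; have [||q ->] := @uniq_roots_prod_XsubC _ P s.
- by apply/allP => x /Ps /eqP.
- by rewrite uniq_rootsE.
exists (q * (\prod_(x <- s) (- x))%:P); rewrite [RHS]mulrC -mulrA; congr (_ * _).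
rewrite rmorph_prod /root_prod -big_split /=; apply: eq_big_seq => x /(allP s0) xn0.
exact: XsubC_lin_factor.
Qed.

(** A divisor of a polynomial with simple roots is the product over the roots it
    has: neither of the two factors has more roots than its degree, and the
    degrees add up. *)
Lemma divisor_root_prod P Q Z : uniq Z -> all (fun y => y != 0) Z ->
  P * Q = root_prod Z -> P = (P.[0])%:P * root_prod [seq x <- Z | root P x].
Proof.
move=> uZ Z0 PQ; set S := [seq x <- Z | root P x].
have uS : uniq S by rewrite filter_uniq.
have sub x : x \in S -> x \in Z by rewrite mem_filter => /andP[].
have S0 : all (fun y => y != 0) S by apply/allP => x /sub /(allP Z0).
have ZPQ : root_prod Z != 0 by rewrite -size_poly_gt0 size_root_prod.
have P0 : P != 0 by apply: contraNneq ZPQ => P0; rewrite -PQ P0 mul0r.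
have Q0 : Q != 0 by apply: contraNneq ZPQ => Q0; rewrite -PQ Q0 mulr0.
have szZ : (size P + size Q).-1 = (size Z).+1 by rewrite -size_mul // PQ size_root_prod.
have szS : (size S < size P)%N.
  by apply: max_poly_roots => //; apply/allP => x; rewrite mem_filter => /andP[].
pose T := [seq x <- Z | ~~ root P x].
have szT : (size T < size Q)%N.
  apply: max_poly_roots => //; last by rewrite filter_uniq.
  apply/allP => x; rewrite mem_filter => /andP[nP xZ].
  have : (root_prod Z).[x] == 0 by rewrite root_prod_root.
  by rewrite -PQ hornerM mulf_eq0 -[P.[x] == 0]/(root P x) (negPf nP).
have sz : (size S + size T = size Z)%N.
  by rewrite !size_filter count_predC.
have szP : (size P <= (size S).+1)%N.
  move: szZ szS szT sz; case: (size P) (size Q) => [|m] [|m'] //=.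
  rewrite addnS /= => -[e]; rewrite !ltnS => h1 h2 h3.
  by rewrite -(leq_add2r (size T)) h3 -e leq_add2l.
apply: (@roots_eq _ _ _ (0 :: S)) => //.
- rewrite /= uS andbT; by apply/negP => /(allP S0); rewrite eqxx.
- move=> x; rewrite in_cons => /orP[/eqP ->|xS]; first by rewrite hornerM root_prod0 hornerC mulr1.
  have /eqP px : (root_prod S).[x] == 0 by rewrite root_prod_root.
  by rewrite hornerM px mulr0; move: xS; rewrite mem_filter => /andP[/rootP].
by rewrite mul_polyC (leq_trans (size_scale_leq _ _)) // size_root_prod.
Qed.

Lemma seq_min (T : eqType) (F : T -> R) (s : seq T) : s != [::] ->
  exists2 x : T, x \in s & forall y : T, y \in s -> F x <= F y.
Proof.
elim: s => // x s IH _; have [->|/IH[y ys ym]] := eqVneq s [::].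
  by exists x => [|y]; rewrite inE // => /eqP ->.
case: (leP (F x) (F y)) => xy.
  exists x; first by rewrite mem_head.
  by move=> v; rewrite in_cons => /orP[/eqP ->//|/ym]; apply: le_trans.
exists y; first by rewrite in_cons ys orbT.
by move=> v; rewrite in_cons => /orP[/eqP ->|/ym //]; apply: ltW.
Qed.

Lemma lin_factor_gt0 x nu : 0 < x -> (0 < (lin_factor x).[nu]) = (nu < x).
Proof. by move=> x0; rewrite lin_factorE subr_gt0 ltr_pdivrMr // mul1r. Qed.

Lemma lin_factor_lt0 x nu : 0 < x -> ((lin_factor x).[nu] < 0) = (x < nu).
Proof. by move=> x0; rewrite lin_factorE subr_lt0 ltr_pdivlMr // mul1r. Qed.

(** Two subsets of $Z$ whose products have the same signs on $ss$ can only differ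
    beyond $ss$. Otherwise take the smallest zero $u_1$ in which they differ and the
    first point $v$ of $ss$ above it: no other zero lies between them, so the
    product of the two values at $v$ is negative. *)
Lemma same_signs Z ss (S S0 : pred R) u : uniq Z -> (forall x, x \in Z -> 0 < x) ->
    (forall x y, x \in Z -> y \in Z -> x < y -> exists2 nu, nu \in ss & x < nu < y) ->
    (forall x, x \in Z -> x \notin ss) ->
    (forall nu, nu \in ss -> 0 < (root_prod [seq x <- Z | S x]).[nu] * (root_prod [seq x <- Z | S0 x]).[nu]) ->
    u \in Z -> S u != S0 u ->
  forall nu, nu \in ss -> nu < u.
Proof.
move=> uZ Zp inter disj sgn uZ' Su.
pose D := [seq x <- Z | S x != S0 x].
have uD : u \in D by rewrite mem_filter Su.
have [|u1 u1D u1min] := @seq_min _ id D; first by apply: contraTneq uD => ->.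
have [u1Z u1S] : u1 \in Z /\ S u1 != S0 u1 by move: u1D; rewrite mem_filter => /andP[].
suff h nu : nu \in ss -> nu < u1 by move=> nu /h nu1; apply: lt_le_trans nu1 (u1min _ uD).
move=> nus; rewrite ltNge; apply/negP => u1nu.
pose E := [seq x <- ss | u1 < x].
have nuE : nu \in E.
  rewrite mem_filter nus andbT lt_neqAle u1nu andbT.
  by apply: contraTneq nus => <-; apply: disj.
have [|v vE vmin] := @seq_min _ id E; first by apply: contraTneq nuE => ->.
have [u1v vss] : u1 < v /\ v \in ss by move: vE; rewrite mem_filter => /andP[].
have := sgn v vss; rewrite /root_prod !big_filter !horner_prod.
rewrite [X in X * _]big_mkcond [X in _ * X]big_mkcond /= -big_split /=.
rewrite (bigD1_seq u1) //= ltNge pmulr_lle0; last first.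
  rewrite big_seq_cond; apply: prodr_gt0 => x /andP[xZ xu1].
  have [->|Sx] := eqVneq (S x) (S0 x).
    case: (S0 x); last by rewrite mulr1.
    have x0 : x != 0 by rewrite lt0r_neq0 ?Zp.
    rewrite -expr2 exprn_even_gt0 //= lin_factor_root //; apply: contraTneq vss => ->; exact: disj.
  have : 0 < (lin_factor x).[v].
    rewrite lin_factor_gt0 ?Zp //.
    have u1x : u1 < x by rewrite lt_neqAle eq_sym xu1 u1min // mem_filter Sx.
    rewrite ltNge; apply/negP => xv.
    have [w wss /andP[u1w wx]] := inter _ _ u1Z xZ u1x.
    have := vmin w; rewrite mem_filter u1w wss => /(_ isT).
    rewrite leNgt => /negP; apply.
    rewrite (lt_le_trans wx) //.
  by case: (S x) (S0 x) Sx => [] [] //=; rewrite ?mulr1 ?mul1r.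
move=> /negP; apply; apply: ltW.
have : (lin_factor u1).[v] < 0 by rewrite lin_factor_lt0 ?Zp.
by case: (S u1) (S0 u1) u1S => [] [] //=; rewrite ?mulr1 ?mul1r.
Qed.
End divisors.

(** * Seen and blind eigenvalues *)

Section setting.
Context {R : realType} (a : R) (N : nat) (lam f : 'I_N -> R).
Implicit Types (p : seq (atom R)) (x nu : R) (S : pred R) (Z : seq R).

Let ls := points lam.
Let w := weight lam f.
Let al := 1 - \sum_i f i ^+ 2.
(** These eigenvalues are not seen from $a$: the eigenfunction vanishes there. *)
Definition blind := [seq x <- points lam | weight lam f x == 0].
Definition seen := [seq x <- points lam | weight lam f x != 0].

(** $Z$ lists the zeros of the diagonal Green function at $a$, with their slopes
    and their interlacing with its poles. *)
Definition green_zeros Z :=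
  [/\ uniq Z, (forall x, x \in Z -> 0 < x),
      herglotz (1 - \sum_i f i ^+ 2) (weight lam f) seen = root_prod Z,
      (forall x, x \in Z -> 0 < (root_prod Z)^`().[x] * (root_prod seen).[x]) &
      (forall x y, x \in Z -> y \in Z -> x < y -> exists2 nu, nu \in seen & x < nu < y)].

Context (inc : forall i j : 'I_N, (i < j)%N -> lam i < lam j).
Context (lpos : forall i, 0 < lam i).

Let inj : injective lam := incr_inj inc.

Lemma uniq_points : uniq ls.
Proof. by rewrite map_inj_uniq ?enum_uniq. Qed.

Lemma points_neq0 : all (fun y => y != 0) ls.
Proof. by apply/allP => x /mem_points[i ->]; rewrite lt0r_neq0. Qed.

Lemma blindP x : reflect (exists2 i, x = lam i & f i = 0) (x \in blind).
Proof.
rewrite mem_filter; apply: (iffP andP) => [[/eqP wx /mem_points[i xi]]|[i -> fi]].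
  exists i => //; move: wx; rewrite xi weightE // => /eqP; rewrite sqrf_eq0.
  by move=> /eqP.
by rewrite weightE // fi expr0n eqxx; split=> //; apply/mem_points; exists i.
Qed.

Lemma seenP x : reflect (exists2 i, x = lam i & f i != 0) (x \in seen).
Proof.
rewrite mem_filter; apply: (iffP andP) => [[wx /mem_points[i xi]]|[i -> fi]].
  by exists i => //; move: wx; rewrite xi weightE // sqrf_eq0.
by rewrite weightE // sqrf_eq0 fi; split=> //; apply/mem_points; exists i.
Qed.

Lemma uniq_blind : uniq blind. Proof. by rewrite filter_uniq ?uniq_points. Qed.
Lemma uniq_seen : uniq seen. Proof. by rewrite filter_uniq ?uniq_points. Qed.

Lemma blind_pos x : x \in blind -> 0 < x. Proof. by move=> /blindP[i -> _]. Qed.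
Lemma seen_pos x : x \in seen -> 0 < x. Proof. by move=> /seenP[i -> _]. Qed.

Lemma neq0_of_pos (s : seq R) : (forall x, x \in s -> 0 < x) -> all (fun y => y != 0) s.
Proof. by move=> sp; apply/allP => x /sp /lt0r_neq0. Qed.

Lemma sum_seen : \sum_(x <- seen) w x = \sum_i f i ^+ 2.
Proof.
rewrite -(sum_points f inj) /seen big_filter [RHS](bigID (fun x => w x == 0)) /=.
by rewrite [X in _ = X + _]big1 ?add0r // => x /eqP.
Qed.

Lemma green_zeros_exist : 0 <= al -> exists Z, green_zeros Z.
Proof.
move=> al0; have [|||Z [uZ Zp nZ sl it]] := @herglotz_zeros R al w seen uniq_seen seen_pos.
- by move=> x /seenP[i -> fi]; rewrite /w weightE // exprn_even_gt0.
- exact: al0.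
- by rewrite sum_seen /al subrK.
by exists Z; split => // x /sl; rewrite nZ.
Qed.

Context (Z : seq R) (gz : green_zeros Z).
Context (al0 : 0 < al).

Lemma zeros_unseen x : x \in Z -> x \notin seen.
Proof.
case: gz => uZ Zp nZ _ _ xZ; apply/negP => xs.
have : (root_prod Z).[x] == 0 by rewrite root_prod_root ?neq0_of_pos.
rewrite -nZ herglotz_at ?uniq_seen ?neq0_of_pos //; last exact: seen_pos.
move: (xs) => /seenP[i xi fi]; rewrite {1}xi weightE // mulf_eq0 sqrf_eq0 (negPf fi) /=.
by rewrite omit_root ?uniq_seen ?neq0_of_pos ?eqxx ?andbF //; apply: seen_pos.
Qed.

(** There are as many zeros as poles because $\alpha \neq 0$. *)
Lemma size_zeros : size Z = size seen.
Proof.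
case: gz => uZ Zp nZ _ _; have sn0 := neq0_of_pos seen_pos.
apply: succn_inj; rewrite -size_root_prod ?neq0_of_pos // -nZ; apply/eqP.
rewrite eqn_leq size_herglotz ?uniq_seen //= ltnNge; apply/negP => /(nth_default 0).
rewrite /herglotz coefD coefCM.
have -> : (\sum_(mu <- seen) (w mu)%:P * omit_prod seen mu)`_(size seen) = 0.
  apply: nth_default; have := size_herglotz0 w uniq_seen sn0.
  by rewrite /herglotz mul0r add0r.
rewrite addr0 => /eqP; rewrite mulf_eq0 gt_eqF //=.
rewrite -[size seen]/((size seen).+1.-1) -size_root_prod // -lead_coefE lead_coef_eq0.
by rewrite -size_poly_eq0 size_root_prod.
Qed.

Lemma green_product : herglotz al w ls = root_prod blind * root_prod Z.
Proof. by case: gz => _ _ <- _ _; apply: herglotz_split. Qed.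

(** A blind eigenvalue is a zero of $\phi_+$ and of $\phi_-$ at $a$. Dividing their
    product by one copy of each such factor shows that $\phi_+$ divides the
    numerator of the reduced Green function, so it is a product over zeros in $Z$. *)
Lemma pair_zeros p : is_pair p -> eigenvalues p lam -> residue_data lam f p a ->
    (exists i, f i = 0) ->
  [/\ jost p a = (half_exp a)^-1%:P * root_prod [seq x <- Z | root (jost p a) x],
      (forall x, x \in blind -> x \in Z /\ root (jost p a) x) &
      (forall i, f i != 0 -> 0 < (jost p a).[lam i] * f i /\
          lam i * gamma2 p (lam i) = (jost p a).[lam i] ^+ 2 / f i ^+ 2)].
Proof.
move=> ip ev rd ex; have [pn op bp] := is_pairP ip.
have [_ prod] := jost_product ip ev rd ex.
have WE := characteristic ip ev.
have li i : lam i \in ls by apply/mem_points; exists i.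
have W0 i : (jost_right p).1.[lam i] = 0.
  by apply/eqP; rewrite WE root_prod_root ?points_neq0.
have g0 i : 0 < lam i * gamma2 p (lam i) by apply: norming_pos.
have Bn0 i : (jost_right p).2.[lam i] != 0 by apply: left_amplitude_neq0.
have Pb i : f i = 0 -> (jost p a).[lam i] = 0.
  by move=> /eqP; rewrite rd mulf_eq0 invr_eq0 sqrtr_eq0 leNgt g0 orbF => /eqP.
have Mb i : f i = 0 -> (jost_minus p a).[lam i] = 0.
  move=> /Pb /eqP; rewrite (jost_prop _ op (W0 i)) mulf_eq0 (negPf (Bn0 i)).
  by move=> /eqP.
have bn0 := neq0_of_pos blind_pos.
have [|Q1 QE1] := @vanish_factor R (jost_minus p a) blind uniq_blind bn0.
  by move=> x /blindP[i -> fi]; apply: Mb.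
have dv : jost p a * Q1 = root_prod Z.
  apply: (@mulfI _ (root_prod blind)); first by rewrite -size_poly_gt0 size_root_prod.
  by rewrite mulrCA -QE1 prod -green_product.
have [uZ Zp _ _ _] := gz.
split.
- by rewrite {1}(divisor_root_prod uZ (neq0_of_pos Zp) dv) jost0.
- move=> x /blindP[i -> fi]; have rx : root (jost p a) (lam i) by apply/rootP/Pb.
  split=> //; rewrite -root_prod_root ?neq0_of_pos // -dv hornerM (rootP rx).
  by rewrite mul0r.
move=> i fi; have gi := g0 i; have sg : 0 < Num.sqrt (lam i * gamma2 p (lam i)) by rewrite sqrtr_gt0.
have Pf : (jost p a).[lam i] = f i * Num.sqrt (lam i * gamma2 p (lam i)).
  by rewrite rd divfK // gt_eqF.
rewrite Pf; split.
  by rewrite mulrAC -expr2 mulr_gt0 // exprn_even_gt0.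
by rewrite exprMn sqr_sqrtr ?(ltW gi) // [f i ^+ 2 * _]mulrC mulfK // sqrf_eq0.
Qed.

End setting.

(** * At most one zero is free *)

Section dichotomy.
Context {R : realType} (a : R) (n : nat) (lam f : 'I_n.+1 -> R).
Context (inc : forall i j : 'I_n.+1, (i < j)%N -> lam i < lam j).
Context (lpos : forall i, 0 < lam i).
Context (Z : seq R) (gz : green_zeros lam f Z) (al0 : 0 < 1 - \sum_i f i ^+ 2).
Implicit Types (p : seq (atom R)) (x y nu : R) (S : pred R).

Let ss := seen lam f.
Let kk := blind lam f.

Definition beyond x := all (fun nu => nu < x) (seen lam f).

Lemma lam_le i : lam i <= lam ord_max.
Proof.
have [->|ne] := eqVneq i ord_max; first exact: lexx.
apply/ltW/inc; rewrite ltn_neqAle leq_ord andbT; apply: contra ne => /eqP e.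
exact/eqP/val_inj.
Qed.

Lemma beyond_unique x y : x \in Z -> y \in Z -> beyond x -> beyond y -> x = y.
Proof.
case: gz => _ _ _ _ inter xZ yZ /allP bx /allP b_y.
case: (ltgtP x y) => // [xy|yx].
  by have [nu /bx nx /andP[xn _]] := inter _ _ xZ yZ xy; have := lt_trans nx xn; rewrite ltxx.
by have [nu /b_y nx /andP[xn _]] := inter _ _ yZ xZ yx; have := lt_trans nx xn; rewrite ltxx.
Qed.

Lemma sign_root_prod (s : seq R) y : (forall x, x \in s -> 0 < x < y) ->
  0 < (-1) ^+ size s * (root_prod s).[y].
Proof.
elim: s => [|x s IH] h; first by rewrite /root_prod big_nil hornerC expr0 mulr1.
have /andP[x0 xy] := h x (mem_head _ _).
rewrite /root_prod big_cons hornerM exprS -/(root_prod s) mulrACA mulr_gt0 //.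
  by rewrite mulN1r oppr_gt0 lin_factor_lt0.
by apply: IH => v vs; apply: h; rewrite in_cons vs orbT.
Qed.

(** The numerator has as many negative factors as poles if all its zeros lie
    below $\lambda_N$, whereas its value at $\lambda_N$ is a positive weight times a
    product with one factor less: the signs disagree. *)
Lemma beyond_exists : f ord_max != 0 -> exists2 x, x \in Z & beyond x.
Proof.
move=> fN; have [/hasP[x xZ bx]|/hasPn none] := boolP (has beyond Z); first by exists x.
have [uZ Zp nZ _ _] := gz; set L := lam ord_max.
have Ls : L \in ss by apply/seenP => //; exists ord_max.
have us := uniq_seen f inc; have s0 := neq0_of_pos (seen_pos (f := f) inc lpos).
have ZL x : x \in Z -> 0 < x < L.
  move=> xZ; rewrite Zp //=; have /allPn[nu nus] := none _ xZ.
  rewrite -leNgt => xnu; have : x <= L.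
    by apply: le_trans xnu _; move: nus => /(seenP f inc)[i -> _]; apply: lam_le.
  rewrite le_eqVlt => /orP[/eqP xL|//].
  by have := zeros_unseen inc lpos gz xZ; rewrite xL Ls.
have := sign_root_prod ZL; rewrite (size_zeros inc lpos gz al0) -nZ herglotz_at //.
rewrite (weightE _ _ (incr_inj inc)).
have := @sign_root_prod (rem L ss) L _; rewrite -omit_rem // size_rem // => h.
have {}h : 0 < (-1) ^+ (size ss).-1 * (omit_prod ss L).[L].
  apply: h => x; rewrite mem_rem_uniq // => /andP[xL xs].
  rewrite (seen_pos inc lpos xs) /= lt_neqAle xL /=.
  by move: xs => /(seenP f inc)[i -> _]; apply: lam_le.
have sz : size ss = (size ss).-1.+1 by rewrite prednK //; case: (ss) Ls.
rewrite sz exprS mulN1r mulNr oppr_gt0 mulrCA pmulr_rlt0 ?exprn_even_gt0 //.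
by move=> h2; have := lt_trans h h2; rewrite ltxx.
Qed.

(** The constraints that the interior data put on the zeros of $\phi_+(\cdot, a)$. *)
Definition admissible S :=
  (forall x, x \in blind lam f -> x \in Z /\ S x) /\
  (forall i, f i != 0 -> 0 < (root_prod [seq x <- Z | S x]).[lam i] * f i).

(** Exchanges membership for the zero beyond all the seen eigenvalues. *)
Definition flip (b : bool) S : pred R := fun x => if b || ~~ beyond x then S x else ~~ S x.

Lemma pair_admissible p : is_pair p -> eigenvalues p lam -> residue_data lam f p a ->
  (exists i, f i = 0) -> admissible (root (jost p a)).
Proof.
move=> ip ev rd ex; have [PE bl sg] := pair_zeros inc lpos gz ip ev rd ex.
split=> [x /bl //|i fi]; have [+ _] := sg i fi.
rewrite {1}PE hornerM hornerC -mulrA pmulr_rgt0 // invr_gt0 half_exp_gt0 //.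
Qed.

Lemma admissible_prod S S0 : admissible S -> admissible S0 -> forall nu, nu \in seen lam f ->
  0 < (root_prod [seq x <- Z | S x]).[nu] * (root_prod [seq x <- Z | S0 x]).[nu].
Proof.
move=> [_ h] [_ h0] nu /(seenP f inc)[i -> fi].
have := mulr_gt0 (h i fi) (h0 i fi); rewrite mulrACA -expr2.
by rewrite pmulr_lgt0 // exprn_even_gt0.
Qed.

(** If $\varphi_N(a) = 0$, the zero beyond the seen eigenvalues is $\lambda_N$ itself,
    which is blind and hence always a zero of $\phi_+$. *)
Lemma admissible_cases S S0 : admissible S -> admissible S0 ->
  exists b, (f ord_max = 0 -> b = true) /\ {in Z, forall x, S x = flip b S0 x}.
Proof.
move=> aS a0; have [uZ Zp nZ _ inter] := gz.
have far u : u \in Z -> S u != S0 u -> beyond u.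
  move=> uZ' Su; apply/allP => nu; apply: (@same_signs R Z ss S S0 u) => //.
  - exact: zeros_unseen.
  - exact: admissible_prod.
have [/hasP[u uZ' Su]|/hasPn same] := boolP (has (fun u => S u != S0 u) Z).
  have bu := far u uZ' Su; exists false; split.
    move=> fN; have Lk : lam ord_max \in kk by apply/blindP => //; exists ord_max.
    have [[LZ SL] [_ SL0]] := (aS.1 _ Lk, a0.1 _ Lk).
    have uL : u = lam ord_max.
      apply: beyond_unique => //; apply/allP => nu /(seenP f inc)[i -> fi].
      rewrite lt_neqAle lam_le andbT.
      by apply: contraNneq fi => /(incr_inj inc) ->; rewrite fN.
    by move: Su; rewrite uL SL SL0.
  move=> x xZ; rewrite /flip /=; have [bx|nbx] /= := boolP (beyond x).
    have -> : x = u by apply: beyond_unique.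
    by case: (S u) (S0 u) Su => [] [].
  by apply/eqP; apply: contraNT nbx; apply: far.
exists true; split=> // x xZ; rewrite /flip /=.
by have := same x xZ; rewrite negbK => /eqP.
Qed.

(** A linear factor that vanishes beyond the seen eigenvalues is positive on them. *)
Lemma admissible_flip S : f ord_max != 0 -> admissible S -> admissible (flip false S).
Proof.
move=> fN aS; have [uZ Zp nZ _ inter] := gz; split.
  move=> x xk; have [xZ Sx] := aS.1 x xk; split=> //.
  rewrite /flip /= ifT //; apply/allPn; exists (lam ord_max).
    by apply/seenP => //; exists ord_max.
  by move: xk => /(blindP f inc)[i -> _]; rewrite -leNgt lam_le.
move=> i fi; have := aS.2 i fi; set A := (root_prod _).[_]; set B := (root_prod _).[_] => Af.
have Ls : lam i \in seen lam f by apply/seenP => //; exists i.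
suff AB : 0 < A * B.
  have A2 : 0 < A ^+ 2 by rewrite exprn_even_gt0 //=; apply: contraTneq AB => ->; rewrite mul0r ltxx.
  rewrite -(pmulr_lgt0 _ A2) (_ : B * f i * A ^+ 2 = (A * B) * (A * f i)); last by ring.
  exact: mulr_gt0.
rewrite /A /B /root_prod !big_filter !horner_prod.
rewrite [X in X * _]big_mkcond [X in _ * X]big_mkcond /= -big_split /=.
rewrite big_seq; apply: prodr_gt0 => x xZ; rewrite /flip /=.
have := zeros_unseen inc lpos gz xZ => xs.
have lx : (lin_factor x).[lam i] != 0.
  by rewrite lin_factor_root ?lt0r_neq0 ?Zp //; apply: contraNneq xs => <-.
have [bx|nbx] /= := boolP (beyond x).
  have : 0 < (lin_factor x).[lam i] by rewrite lin_factor_gt0 ?Zp //; apply: (allP bx).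
  by case: (S x) => /= h; rewrite ?mulr1 ?mul1r.
by case: (S x); rewrite ?mulr1 // -expr2 exprn_even_gt0.
Qed.

(** The factor by which the two products differ lies strictly between $0$ and $1$
    at $\lambda_N$. *)
Lemma flip_differs S : f ord_max != 0 ->
  (root_prod [seq x <- Z | S x]).[lam ord_max] ^+ 2 !=
  (root_prod [seq x <- Z | flip false S x]).[lam ord_max] ^+ 2.
Proof.
move=> fN; have [uZ Zp nZ _ inter] := gz.
have [u uZ' bu] := beyond_exists fN; set L := lam ord_max.
have Ls : L \in ss by apply/seenP => //; exists ord_max.
pose rest := \prod_(x <- Z | S x && (x != u)) (lin_factor x).[L].
have t1 : (lin_factor u).[L] < 1 by rewrite lin_factorE gtrDl oppr_lt0; apply: divr_gt0; [exact: lpos|exact: Zp].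
have t0 : 0 < (lin_factor u).[L] by rewrite lin_factor_gt0 ?Zp //; apply: (allP bu).
have r0 : rest != 0.
  rewrite /rest prodf_seq_neq0; apply/allP => x xZ; apply/implyP => _.
  rewrite lin_factor_root ?lt0r_neq0 ?Zp //; apply: contraTneq Ls => ->.
  exact: zeros_unseen xZ.
have eS (T : pred R) : {in Z, forall x, x != u -> T x = S x} ->
    (root_prod [seq x <- Z | T x]).[L] = (if T u then (lin_factor u).[L] else 1) * rest.
  move=> TS; rewrite /root_prod big_filter horner_prod big_mkcond (bigD1_seq u) //=; congr (_ * _).
  rewrite /rest [RHS]big_mkcondl big_seq_cond [RHS]big_seq_cond.
  by apply: eq_bigr => x /andP[xZ xu]; rewrite TS.
rewrite (eS S) // (eS (flip false S)); last first.
  move=> x xZ xu; rewrite /flip /= ifT //; apply: contraNN xu => bx.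
  by apply/eqP; apply: beyond_unique.
rewrite /flip /= bu /= !exprMn; set t := (lin_factor u).[L] in t0 t1 *.
have t2 : t ^+ 2 < 1 by rewrite exprn_ilt1 // ltW.
have tn : t ^+ 2 != 1 by rewrite lt_eqF.
apply/negP => /eqP /mulIf; rewrite expf_eq0 (negPf r0) andbF => /(_ isT).
by case: (S u) => /= /eqP; rewrite expr1n ?(negPf tn) // eq_sym (negPf tn).
Qed.
End dichotomy.

(** * Realizing prescribed norming constants *)

Section realize.
Context {R : realType} (a : R) (n : nat) (lam f : 'I_n.+1 -> R).
Context (inc : forall i j : 'I_n.+1, (i < j)%N -> lam i < lam j).
Context (lpos : forall i, 0 < lam i).
Context (Z : seq R) (gz : green_zeros lam f Z) (al0 : 0 < 1 - \sum_i f i ^+ 2).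
Implicit Types (p : seq (atom R)) (x y nu : R) (S : pred R).

Lemma ceval_root_prod (s : seq R) (z : R[i]) : all (fun y => y != 0) s ->
  ceval (root_prod s) z = 0 -> exists2 x, x \in s & z = x%:C.
Proof.
elim: s => [|x s IH] /=.
  by rewrite /root_prod big_nil /ceval rmorph1 hornerC => _ /eqP; rewrite oner_eq0.
move=> /andP[x0 s0]; rewrite /root_prod big_cons cevalM => /eqP; rewrite mulf_eq0 => /orP[].
  rewrite /lin_factor cevalD cevalN cevalM -[1]polyC1 !cevalC cevalX subr_eq0 => /eqP e.
  exists x; first exact: mem_head.
  have xn : x%:C != 0 :> R[i] by rewrite fmorph_eq0.
  by rewrite fmorphV /= in e; rewrite -[RHS]mulr1 -[1]/(1%:C) e mulrA mulfV // mul1r.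
by move=> /eqP /(IH s0)[y ys ->]; exists y => //; rewrite in_cons ys orbT.
Qed.

Let ss := seen lam f.
Let kk := blind lam f.

(** The mass at $x$ in the expansion of the inverse $1 - z\sum_x m_x/(1 - z/x)$ of
    the reduced Green function. *)
Definition mass x := - (root_prod ss).[x] / (x * (omit_prod Z x).[x]).

Lemma mass_pos x : x \in Z -> 0 < mass x.
Proof.
move=> xZ; have [uZ Zp nZ sl _] := gz; have x0 := Zp _ xZ; have := sl x xZ.
rewrite deriv_root_prod ?lt0r_neq0 // => h.
have on : (omit_prod Z x).[x] != 0 by rewrite omit_root ?neq0_of_pos // eqxx andbF.
have -> : mass x = (- x^-1 * (omit_prod Z x).[x] * (root_prod ss).[x]) / (omit_prod Z x).[x] ^+ 2.
  by rewrite /mass; field; rewrite on lt0r_neq0.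
by rewrite divr_gt0 // exprn_even_gt0.
Qed.

Lemma seen_expansion : root_prod ss = root_prod Z - 'X * herglotz 0 mass Z.
Proof.
have [uZ Zp nZ sl _] := gz; have Z0 := neq0_of_pos Zp.
have sZ := size_zeros inc lpos gz al0.
have s0 := neq0_of_pos (seen_pos (f := f) inc lpos).
apply: (@roots_eq _ _ _ (0 :: Z)).
- by rewrite /= uZ andbT; apply/negP => /(allP Z0); rewrite eqxx.
- move=> x; rewrite in_cons => /orP[/eqP ->|xZ].
    by rewrite hornerD hornerN hornerM hornerX mul0r subr0 !root_prod0.
  have on : (omit_prod Z x).[x] != 0 by rewrite omit_root ?neq0_of_pos // eqxx andbF.
  have /eqP px : (root_prod Z).[x] == 0 by rewrite root_prod_root.
  rewrite hornerD hornerN hornerM hornerX px herglotz_at // /mass.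
  by have x0 := lt0r_neq0 (Zp _ xZ); field; rewrite on x0.
- by rewrite /= size_root_prod // sZ.
rewrite (leq_trans (size_polyD _ _)) // geq_max size_root_prod // size_polyN leqnn /=.
rewrite (leq_trans (size_polyMleq _ _)) // size_polyX ltnS.
exact: size_herglotz0.
Qed.

(** The inverse of the Green function at $a$ is the sum of the Weyl functions of
    the two half-lines. A pole outside the blind eigenvalues belongs to the side
    prescribed by $S$; the mass of a blind one is shared between the two sides,
    and the ratio of its parts tunes $\lambda\gamma^2$ over all positive values.
    Solving both half-line problems and gluing the atoms gives the pair. *)
Lemma realize S (h : 'I_n.+1 -> R) : admissible lam f Z S -> (exists i, f i = 0) ->
    (forall i, f i = 0 -> 0 < h i) ->
  exists p, [/\ is_pair p, eigenvalues p lam, residue_data lam f p a,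
      jost p a = (half_exp a)^-1%:P * root_prod [seq x <- Z | S x] &
      forall i, f i = 0 -> lam i * gamma2 p (lam i) = h i].
Proof.
move=> [aK aS] [i0 fi0] hp; have [uZ Zp nZ sl _] := gz; have Z0 := neq0_of_pos Zp.
have inj := incr_inj inc.
set Sp := [seq x <- Z | S x]; pose Sm := [seq x <- Z | (x \in kk) || ~~ S x].
have uSp : uniq Sp by rewrite filter_uniq.
have uSm : uniq Sm by rewrite filter_uniq.
have ukk : uniq kk by apply: uniq_blind.
have Spp x : x \in Sp -> 0 < x by rewrite mem_filter => /andP[_ /Zp].
have Smp x : x \in Sm -> 0 < x by rewrite mem_filter => /andP[_ /Zp].
have kSp x : x \in kk -> x \in Sp by move=> /aK[xZ Sx]; rewrite mem_filter Sx.
have kSm x : x \in kk -> x \in Sm by move=> xk; have [xZ _] := aK x xk; rewrite mem_filter xk.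
have prods : root_prod Sp * root_prod Sm = root_prod kk * root_prod Z.
  have -> : root_prod kk = root_prod [seq x <- Z | x \in kk].
    apply: perm_big; apply: (uniq_perm ukk (filter_uniq _ uZ)) => x.
    by rewrite mem_filter; apply/idP/andP => [xk|[]//]; have [] := aK x xk.
  rewrite /root_prod !big_filter [X in X * _]big_mkcond [X in _ * X]big_mkcond /= -big_split /=.
  rewrite [X in X * _]big_mkcond -big_split /=; apply: eq_bigr => x _.
  have [xk|xk] /= := boolP (x \in kk); first by have [_ ->] := aK x xk.
  by case: (S x) => /=; rewrite ?mulr1 ?mul1r.
have lin0 x : lin_factor x != 0 := lin_factor_neq0 x.
have Mp x : x \in Sp -> omit_prod Sp x * root_prod Sm = root_prod kk * omit_prod Z x.
  move=> xs; have xZ : x \in Z by move: xs; rewrite mem_filter => /andP[].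
  apply: (mulfI (lin0 x)); rewrite mulrA -root_prod_omit // prods.
  by rewrite [in LHS](root_prod_omit uZ xZ); ring.
have Mm x : x \in Sm -> root_prod Sp * omit_prod Sm x = root_prod kk * omit_prod Z x.
  move=> xs; have xZ : x \in Z by move: xs; rewrite mem_filter => /andP[].
  apply: (mulfI (lin0 x)); rewrite mulrCA -root_prod_omit // prods.
  by rewrite [in LHS](root_prod_omit uZ xZ); ring.
pose T := expR a; have T0 : 0 < T := expR_gt0 a.
pose hx x := \sum_(i | lam i == x) h i.
have hxE i : hx (lam i) = h i.
  by rewrite /hx (eq_bigl (pred1 i)) ?big_pred1_eq // => j; rewrite /= inj_eq.
have hxp x : x \in kk -> 0 < hx x by move=> /(blindP f inc)[i -> fi]; rewrite hxE hp.
(* A mass shared in the ratio rho : 1 gives lambda gamma^2 = q rho. *)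
pose q x := x * mass x * (omit_prod Sp x).[x] ^+ 2 / T.
have qp x : x \in kk -> 0 < q x.
  move=> xk; have [xZ _] := aK x xk; rewrite /q; apply: divr_gt0 => //.
  apply: mulr_gt0; first by apply: mulr_gt0; [exact: Zp|exact: mass_pos].
  by rewrite exprn_even_gt0 //= omit_root ?neq0_of_pos // eqxx andbF.
pose kp x := if x \in kk then mass x * (hx x / (q x + hx x)) else mass x.
pose km x := if x \in kk then mass x * (q x / (q x + hx x)) else mass x.
have kpp x : x \in Sp -> 0 < kp x.
  rewrite mem_filter => /andP[_ xZ]; rewrite /kp; case: ifP => xk; last exact: mass_pos.
  by rewrite mulr_gt0 ?mass_pos // divr_gt0 ?addr_gt0 ?hxp ?qp.
have kmp x : x \in Sm -> 0 < km x.
  rewrite mem_filter => /andP[_ xZ]; rewrite /km; case: ifP => xk; last exact: mass_pos.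
  by rewrite mulr_gt0 ?mass_pos // divr_gt0 ?addr_gt0 ?hxp ?qp.
have [r [br or ra rA rB]] := half_line_inverse a uSp Spp kpp.
have [r' [br' or' ra' rA' rB']] := half_line_inverse (- a) uSm Smp kmp.
rewrite -/T in rA rB; rewrite expRN -/T in rA' rB'.
pose l := mirror r'; pose p := l ++ r.
have lft : all (fun t => pos t < a) l.
  rewrite /l /mirror all_rev all_map; apply: sub_all ra' => t /=.
  by rewrite /pos /= ltrNl.
have bl : all is_atom l by rewrite /l /mirror all_rev all_map.
have op : ordered p.
  rewrite /p ordered_cat or mirror_ordered //=; apply: sub_all lft => t ta.
  by apply: sub_all ra => s; apply: lt_trans.
have bp : all is_atom p by rewrite all_cat bl br.
have fl : [seq s <- p | pos s < a] = l.
  rewrite filter_cat (all_filterP lft) (eq_in_filter (a2 := pred0)) ?filter_pred0 ?cats0 //.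
  by move=> s /(allP ra) /lt_gtF.
have fr : [seq s <- p | a < pos s] = r.
  rewrite filter_cat (all_filterP ra) (eq_in_filter (a2 := pred0)) ?filter_pred0 //.
  by move=> s /(allP lft) /lt_gtF.
have fr' : [seq s <- p | a <= pos s] = r.
  rewrite filter_cat (eq_in_filter (a2 := pred0)) ?filter_pred0 /=; last first.
    by move=> s /(allP lft) /lt_geF.
  by apply/all_filterP; apply: sub_all ra => s /ltW.
have jl : jost_left l = ((jost_right r').2, (jost_right r').1).
  by rewrite /jost_left /l mirrorK.
have := left_right a op; rewrite fl fr' jl => -[WE LR].
set A := (jost_right r).1 in rA rB WE LR; set B := (jost_right r).2 in rA rB WE LR.
set D := (jost_right r').1 in rA' rB' WE LR; set C := (jost_right r').2 in rA' rB' WE LR.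
have TT : T%:P * T^-1%:P = 1 :> {poly R} by rewrite -polyCM divff ?gt_eqF.
pose cp := herglotz 0 kp Sp; pose cm := herglotz 0 km Sm.
have W1 : A * D - B * C = root_prod Sp * root_prod Sm - 'X * (cp * root_prod Sm + root_prod Sp * cm).
  have -> : B * C = (T%:P * B) * (T^-1%:P * C) by ring: TT.
  have -> : A = root_prod Sp - T%:P * B by rewrite -rA; ring.
  have -> : D = root_prod Sm - T^-1%:P * C by rewrite -rA'; ring.
  by rewrite rB rB' /cp /cm; ring.
(* A blind zero occurs in both sums, and its two parts add up to its mass. *)
have W2 : cp * root_prod Sm + root_prod Sp * cm = root_prod kk * herglotz 0 mass Z.
  rewrite /cp /cm /herglotz !mul0r !add0r mulr_suml !mulr_sumr.
  rewrite (eq_big_seq (fun x => (kp x)%:P * (root_prod kk * omit_prod Z x))); last first.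
    by move=> x xs; rewrite -mulrA Mp.
  rewrite [X in _ + X](eq_big_seq (fun x => (km x)%:P * (root_prod kk * omit_prod Z x))); last first.
    by move=> x xs; rewrite mulrCA Mm.
  rewrite !big_filter [X in X + _]big_mkcond [X in _ + X]big_mkcond /= -big_split /=.
  apply: eq_big_seq => x xZ; rewrite /kp /km [RHS]mulrCA.
  have [xk|xk] /= := boolP (x \in kk).
    have [_ ->] := aK x xk; rewrite -mulrDl -polyCD -mulrDr -mulrDl addrC divff ?mulr1 //.
    by rewrite gt_eqF // addr_gt0 ?hxp ?qp.
  by case: (S x) => /=; rewrite ?addr0 ?add0r.
have WW : (jost_right p).1 = root_prod (points lam).
  rewrite WE W1 W2 prods mulrCA -mulrBr -seen_expansion.
  by rewrite [RHS](root_prod_filter _ (fun x => weight lam f x == 0)).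
have pn : p != [::].
  apply/eqP => p0; have := congr1 (fun P : {poly R} => size P) WW.
  by rewrite p0 size_root_prod ?points_neq0 // size_map size_enum_ord /= size_poly1.
have ip : is_pair p.
  by apply/and3P; split; [rewrite lt0n size_eq0|exact: op|exact: bp].
have ev : eigenvalues p lam.
  split=> // z; rewrite eigenvalue_jost // WW; split.
    move=> /ceval_root_prod[|x /mem_points[i ->] ->]; last by exists i.
    exact: points_neq0.
  move=> [i ->]; rewrite ceval_real; apply/eqP; rewrite fmorph_eq0 root_prod_root ?points_neq0 //.
  by apply/mem_points; exists i.
have W0 i : (jost_right p).1.[lam i] = 0.
  by apply/eqP; rewrite WW root_prod_root ?points_neq0 //; apply/mem_points; exists i.
have ej : jost p a = (half_exp a)^-1%:P * root_prod Sp.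
  rewrite /jost fr /value -/A -/B -rA mulrDr mulrA -polyCM; congr (_ + _ %:P * _).
  by rewrite /T -half_exp_sq expr2 mulKf // gt_eqF // half_exp_gt0.
have em : jost_minus p a = (half_exp a)%:P * root_prod Sm.
  rewrite /jost_minus fl jl /value /= -/C -/D -rA' mulrDr mulrA -polyCM addrC.
  congr (_ + _ %:P * _).
  by rewrite /T -half_exp_sq expr2 invfM mulrA divff ?mul1r // gt_eqF // half_exp_gt0.
have li i : lam i \in points lam by apply/mem_points; exists i.
have gE i : lam i * gamma2 p (lam i) = (omit_prod (points lam) (lam i)).[lam i] * (jost_right p).2.[lam i].
  have := deriv_gamma2 op (W0 i); rewrite {1}WW deriv_root_prod ?uniq_points //; last first.
    by rewrite lt0r_neq0.
  have l0 := lt0r_neq0 (lpos i).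
  by move=> /eqP; rewrite eq_sym eqr_oppLR => /eqP ->; field.
have g0 i : 0 < lam i * gamma2 p (lam i) by apply: norming_pos.
have prodE : jost p a * jost_minus p a = herglotz (1 - \sum_i f i ^+ 2) (weight lam f) (points lam).
  rewrite ej em (green_product gz) -prods mulrACA -polyCM mulVf ?mul1r //.
  by rewrite gt_eqF // half_exp_gt0.
have PMf i : (jost p a).[lam i] * (jost_minus p a).[lam i] =
    f i ^+ 2 * (omit_prod (points lam) (lam i)).[lam i].
  by rewrite -hornerM prodE herglotz_at ?uniq_points ?points_neq0 // weightE.
have Psq i : (jost p a).[lam i] ^+ 2 = f i ^+ 2 * (lam i * gamma2 p (lam i)).
  by rewrite expr2 {2}(jost_prop a op (W0 i)) mulrCA PMf gE; ring.
have Ek i : f i = 0 -> (jost p a).[lam i] = 0.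
  by move=> fi; apply/eqP; rewrite -sqrf_eq0 Psq fi expr0n /= mul0r.
exists p; split=> //.
  move=> i; have [fi|fi] := eqVneq (f i) 0; first by rewrite fi Ek // mul0r.
  have sg : 0 < (jost p a).[lam i] * f i.
    by rewrite ej hornerM hornerC -mulrA pmulr_rgt0 ?aS // invr_gt0 half_exp_gt0.
  have sq0 : 0 < Num.sqrt (lam i * gamma2 p (lam i)) by rewrite sqrtr_gt0.
  have : (jost p a).[lam i] ^+ 2 == (f i * Num.sqrt (lam i * gamma2 p (lam i))) ^+ 2.
    by rewrite Psq exprMn sqr_sqrtr // ltW.
  rewrite eqf_sqr => /orP[/eqP ->|/eqP e]; first by rewrite mulfK // gt_eqF.
  move: sg; rewrite e mulNr oppr_gt0 mulrAC -expr2 ltNge.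
  by rewrite mulr_ge0 ?sqr_ge0 // ltW.
move=> i fi; have lk : lam i \in kk by apply/blindP => //; exists i.
have [iZ _] := aK _ lk; have iSp := kSp _ lk; have iSm := kSm _ lk.
have [LA _] := LR _ (W0 i); rewrite gE.
set x := lam i in lk iZ iSp iSm LA *; set B2 := (jost_right p).2.[x] in LA *.
have x0 : x != 0 by rewrite lt0r_neq0 // lpos.
have opos (s : seq R) : uniq s -> (forall y, y \in s -> 0 < y) -> (omit_prod s x).[x] != 0.
  by move=> us sp; rewrite omit_root ?neq0_of_pos // eqxx andbF.
have oSp0 := opos Sp uSp Spp; have oSm0 := opos Sm uSm Smp.
have oZ0 := opos Z uZ Zp; have ok0 := opos kk ukk (blind_pos inc lpos (f := f)).
have Ax : A.[x] = - (x * (kp x * (omit_prod Sp x).[x])).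
  have -> : A = root_prod Sp - T%:P * B by rewrite -rA; ring.
  rewrite rB hornerD hornerN hornerM hornerX herglotz_at ?neq0_of_pos //.
  by have /eqP -> : (root_prod Sp).[x] == 0; rewrite ?sub0r // root_prod_root ?neq0_of_pos.
have Cx : C.[x] = T * (x * (km x * (omit_prod Sm x).[x])).
  have -> : C = T%:P * (T^-1%:P * C) by rewrite mulrA TT mul1r.
  by rewrite rB' !hornerM hornerX hornerC herglotz_at ?neq0_of_pos.
have sx0 : (root_prod ss).[x] != 0.
  rewrite root_prod_root; last exact/neq0_of_pos/seen_pos.
  by apply/negP => /(seenP f inc)[j /inj <-]; rewrite fi eqxx.
have oE : (omit_prod (points lam) x).[x] = (omit_prod kk x).[x] * (root_prod ss).[x].
  rewrite -hornerM; congr _.[x]; apply: (mulfI (lin0 x)).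
  rewrite mulrA -!root_prod_omit ?uniq_points //; last by apply/mem_points; exists i.
  exact: root_prod_filter.
have omits : (omit_prod Sp x).[x] * (omit_prod Sm x).[x] = (omit_prod kk x).[x] * (omit_prod Z x).[x].
  rewrite -!hornerM; congr _.[x]; apply: (mulfI (lin0 x)).
  rewrite mulrCA -root_prod_omit // Mp // mulrA -root_prod_omit //.
have m0 : mass x != 0 by rewrite gt_eqF // mass_pos.
have qh0 : q x + hx x != 0 by rewrite gt_eqF // addr_gt0 ?qp ?hxp.
have q0 : q x != 0 by rewrite gt_eqF // qp.
have Tn0 : T != 0 by rewrite gt_eqF.
rewrite -hxE -/x.
have B2E : B2 = - (kp x * (omit_prod Sp x).[x]) / (T * (km x * (omit_prod Sm x).[x])).
  have km0 : km x != 0 by rewrite gt_eqF // kmp.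
  have Cn0 : C.[x] != 0 by rewrite Cx !mulf_neq0.
  by apply: (mulIf Cn0); rewrite -LA Ax Cx; field; rewrite km0 oSm0 Tn0.
have kk_ratio : kp x = km x * (hx x / q x).
  by rewrite /kp /km lk; field; rewrite qh0 q0.
have km0 : km x != 0 by rewrite gt_eqF // kmp.
have -> : (omit_prod (points lam) x).[x] * B2 =
   - ((omit_prod kk x).[x] * (root_prod ss).[x] * (omit_prod Sp x).[x] / (T * (omit_prod Sm x).[x])) * (hx x / q x).
  by rewrite B2E oE kk_ratio; field; rewrite km0 oSm0 Tn0 q0.
have -> : (omit_prod Sm x).[x] = (omit_prod kk x).[x] * (omit_prod Z x).[x] / (omit_prod Sp x).[x].
  by rewrite -omits mulrC mulKf.
rewrite /q /mass; field.
by rewrite ?oSp0 ?x0 ?Tn0 ?oZ0 ?ok0 ?sx0.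
Qed.
End realize.

(** * Description of the norming data for positive eigenvalues *)

Section description.
Context {R : realType} (a : R).
Implicit Types (p : seq (atom R)).

Lemma points_sorted N (lam : 'I_N -> R) :
  (forall i j : 'I_N, (i < j)%N -> lam i < lam j) -> sorted <%R (points lam).
Proof.
move=> inc; rewrite /points sorted_map.
have : sorted ltn (map val (enum 'I_N)) by rewrite val_enum_ord iota_ltn_sorted.
by rewrite sorted_map; apply: sub_sorted => i j /=; apply: inc.
Qed.

Lemma eigenvalues_unique p N (lam1 lam2 : 'I_N -> R) :
  eigenvalues p lam1 -> eigenvalues p lam2 -> lam1 = lam2.
Proof.
move=> [inc1 ev1] [inc2 ev2].
have e : points lam1 = points lam2.
  apply: (irr_sorted_eq lt_trans ltxx); try exact: points_sorted.
  move=> x; apply/mem_points/mem_points => [[i ->]|[i ->]].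
    have /ev2[j /complexI ->] : Defs.eigenvalue p (lam1 i)%:C by apply/ev1; exists i.
    by exists j.
  have /ev1[j /complexI ->] : Defs.eigenvalue p (lam2 i)%:C by apply/ev2; exists i.
  by exists j.
by apply/funext => i; apply: (eq_in_map _ _ _).2 e i (mem_enum _ _).
Qed.

(** The vectors $(\lambda_i\gamma_i^2)_i$ of the pairs with the given interior data:
    the spectral data without the fixed eigenvalues. *)
Definition norming N (lam : 'I_N -> R) (phi : 'I_N -> R[i]) (g : 'I_N -> R) : Prop :=
  exists2 p, pairs_with a lam phi p & forall i, g i = lam i * gamma2 p (lam i).

Lemma spectral_setE N (lam : 'I_N -> R) (phi : 'I_N -> R[i]) d :
  spectral_set a lam phi d <->
  exists2 g, norming lam phi g & d = row_mx (\row_i lam i) (\row_i g i).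
Proof.
split=> [[p pp [lam' ev' ->]]|[g [p pp gE] ->]].
  have [ip [ev _]] := pp; rewrite (eigenvalues_unique ev' ev).
  by exists (fun i => lam i * gamma2 p (lam i)) => //; exists p.
have [ip [ev _]] := pp; exists p => //; exists lam => //.
by congr row_mx; apply/rowP => i; rewrite !mxE.
Qed.

(** Coordinates with $\varphi_i(a) = 0$ are arbitrary positive numbers, and the others
    are fixed by a sign $b$, which is free only if $\varphi_e(a) \neq 0$. *)
Definition union_of_orthants N (phi : 'I_N -> R[i]) (e : 'I_N)
    (D : ('I_N -> R) -> Prop) (c : bool -> 'I_N -> R) : Prop :=
  (phi e != 0 -> c true e != c false e) /\
  forall g, D g <-> exists b : bool, (phi e = 0 -> b = true) /\
    forall i, (phi i = 0 -> 0 < g i) /\ (phi i != 0 -> g i = c b i).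

Lemma norming_positive n (lam : 'I_n.+1 -> R) (phi : 'I_n.+1 -> R[i]) :
    (exists p, is_pair p /\ interior_data a p lam phi) -> alpha phi != 0 ->
    (exists i, phi i = 0) -> 0 < lam ord0 ->
  exists c, union_of_orthants phi ord_max (norming lam phi) c.
Proof.
move=> [p0 [ip0 [ev0 id0]]] al0 [i0 phi0] lam0.
have inc := ev0.1.
have lpos i : 0 < lam i.
  have [->//|ne] := eqVneq i ord0; apply: lt_trans lam0 (inc _ _ _).
  by rewrite /= lt0n; apply: contra ne => /eqP e; apply/eqP/val_inj.
pose f i := complex.Re (phi i).
have interior p : ordered p -> (forall i, phi i = varphi p (lam i) a) <->
    ((forall i, phi i = (f i)%:C) /\ residue_data lam f p a).
  move=> op; split=> [h|[h rd] i]; last by rewrite h rd varphi_jost.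
  split=> i; first by rewrite /f h varphi_jost.
  by rewrite /f h varphi_jost.
have [_ op0 _] := is_pairP ip0.
have [phif rd0] := (interior p0 op0).1 id0.
have f0 i : (phi i = 0) <-> (f i = 0).
  by rewrite phif; split=> [/complexI //|->]; rewrite rmorph0.
have nf0 i : (phi i != 0) = (f i != 0) by rewrite phif fmorph_eq0.
have exf : exists i, f i = 0 by exists i0; apply/f0.
have alE : alpha phi = 1 - \sum_i f i ^+ 2.
  rewrite /alpha; congr (_ - _); apply: eq_bigr => i _.
  by rewrite phif normc_real -normrX ger0_norm ?sqr_ge0.
have [alge _] := jost_product ip0 ev0 rd0 exf.
have algt : 0 < 1 - \sum_i f i ^+ 2 by rewrite lt_def alge -alE al0.
have [Z gz] := green_zeros_exist inc lpos alge.
set S0 := root (jost p0 a).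
have adm0 : admissible lam f Z S0 by apply: pair_admissible.
pose P b := (half_exp a)^-1%:P * root_prod [seq x <- Z | flip lam f b S0 x].
exists (fun b i => (P b).[lam i] ^+ 2 / f i ^+ 2); split.
  rewrite nf0 => fN; have := flip_differs inc lpos gz algt S0 fN.
  apply: contraNN => /eqP; set E := half_exp a.
  have E0 : E^-1 ^+ 2 != 0 by rewrite expf_neq0 // invr_eq0 gt_eqF // half_exp_gt0.
  have fi0 : (f ord_max ^+ 2)^-1 != 0 by rewrite invr_eq0 expf_neq0.
  move=> /(mulIf fi0); rewrite !hornerM hornerC !exprMn => /(mulfI E0) e.
  exact/eqP.
move=> g; split.
  move=> [p [ip [ev id]] gE]; have [_ op _] := is_pairP ip.
  have [_ rd] := (interior p op).1 id.
  have adm : admissible lam f Z (root (jost p a)) by apply: pair_admissible.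
  have [b [bN bS]] := admissible_cases inc lpos gz adm adm0.
  have [PE _ sg] := pair_zeros inc lpos gz ip ev rd exf.
  exists b; split; first by move=> /f0.
  move=> i; split=> [_|]; rewrite gE.
    apply: norming_pos => //; apply/(root_eigen _ op)/ev.2; by exists i.
  rewrite nf0 => fi; have [_ ->] := sg i fi; rewrite PE /P.
  by rewrite (eq_in_filter bS).
move=> [b [bN gP]].
have admb : admissible lam f Z (flip lam f b S0).
  case: b bN {gP} => // bN; apply: (admissible_flip inc lpos gz) => //.
  by apply/eqP => /f0 /bN.
have [|p [ip ev rd ej hg]] := realize a inc lpos gz algt admb exf (h := g).
  by move=> i /f0 pi; have [] := gP i; move=> /(_ pi).
have [_ op _] := is_pairP ip.
exists p; first by split=> //; split=> //; apply/interior.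
move=> i; have [fi|fi] := eqVneq (f i) 0; first by rewrite hg.
have [_ _ sg] := pair_zeros inc lpos gz ip ev rd exf.
have [_ ->] := sg i fi; rewrite ej.
by have [_ ->] := gP i; rewrite ?nf0.
Qed.
End description.

(** * Reversal of the sign of omega *)

Section symmetry.
Context {R : realType} (a : R).
Implicit Types (p : seq (atom R)) (z : R[i]) (f : R -> R[i]).

(** Replacing $\omega$ by $-\omega$ and $z$ by $-z$ preserves the equation. *)
Definition flip_sign p : seq (atom R) := [seq (pos t, - wgt t, dip t) | t <- p].

Lemma flip_signK p : flip_sign (flip_sign p) = p.
Proof.
rewrite /flip_sign -map_comp -[RHS]map_id; apply: eq_map => -[[x w] v].
by rewrite /= /pos /wgt /dip /= opprK.
Qed.

Lemma pos_flip p : map pos (flip_sign p) = map pos p.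
Proof. by rewrite /flip_sign -map_comp. Qed.

Lemma is_pair_flip p : is_pair (flip_sign p) = is_pair p.
Proof.
rewrite /is_pair pos_flip size_map all_map; congr [&& _, _ & _].
by apply: eq_all => t; rewrite /= /dip /wgt /= normrN.
Qed.

Lemma solution_flip1 p z f : solution p z f -> solution (flip_sign p) (- z) f.
Proof.
move=> [cf ode jump]; split=> //; first by move=> x; rewrite pos_flip; apply: ode.
move=> s /mapP[t tp ->]; have [dl [dr [cl cr e]]] := jump t tp.
exists dl, dr; split=> //; rewrite /wgt /dip /pos /= -/(pos t) -/(dip t) -/(wgt t) e.
by rewrite sqrrN rmorphN mulrNN.
Qed.

Lemma solution_flip p z f : solution (flip_sign p) (- z) f <-> solution p z f.
Proof.
split; last exact: solution_flip1.
by move=> /solution_flip1; rewrite flip_signK opprK.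
Qed.

Lemma phi_plus_flip p z : phi_plus (flip_sign p) (- z) = phi_plus p z.
Proof.
rewrite /phi_plus; congr (xget _ _); apply/seteqP; split=> f /= [s t];
  by split=> //; move: s => /solution_flip.
Qed.

Lemma realN (x : R) : (- x)%:C = - (x%:C) :> R[i].
Proof. exact: rmorphN. Qed.

Lemma gamma2_flip p (x : R) : gamma2 (flip_sign p) (- x) = - gamma2 p x.
Proof.
rewrite /gamma2 realN phi_plus_flip /int_omega /int_v !big_map opprD -sumrN; congr (_ + _).
  by apply: eq_bigr => t _; rewrite /wgt /pos /= mulNr.
by rewrite mulrN mulNr.
Qed.

Lemma eigenvalue_flip p z : Defs.eigenvalue (flip_sign p) (- z) <-> Defs.eigenvalue p z.
Proof. by split=> -[f [/solution_flip s e b]]; exists f; split. Qed.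

Definition opposite N (lam : 'I_N -> R) : 'I_N -> R := fun i => - lam (rev_ord i).

Lemma eigenvalues_flip p N (lam : 'I_N -> R) :
  eigenvalues p lam -> eigenvalues (flip_sign p) (opposite lam).
Proof.
move=> [inc ev]; split=> [i j ij|z].
  by rewrite /opposite ltrN2; apply: inc; rewrite /= ltn_sub2lE.
rewrite -[z]opprK eigenvalue_flip; split=> [/ev[i ->]|[i e]].
  by exists (rev_ord i); rewrite /opposite rev_ordK realN.
by apply/ev; exists (rev_ord i); rewrite -[LHS]opprK e /opposite realN opprK.
Qed.

Lemma pairs_flip p N (lam : 'I_N -> R) (phi : 'I_N -> R[i]) : pairs_with a lam phi p ->
  pairs_with a (opposite lam) (phi \o @rev_ord N) (flip_sign p).
Proof.
move=> [ip [ev id]]; split; first by rewrite is_pair_flip.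
split; first exact: eigenvalues_flip.
move=> i; rewrite /= id /varphi /opposite realN phi_plus_flip gamma2_flip.
by rewrite mulrNN.
Qed.

Lemma norming_flip N (lam : 'I_N -> R) (phi : 'I_N -> R[i]) g :
  norming a lam phi g -> norming a (opposite lam) (phi \o @rev_ord N) (g \o @rev_ord N).
Proof.
move=> [p pp gE]; exists (flip_sign p); first exact: pairs_flip.
by move=> i; rewrite /= gE /opposite gamma2_flip mulrNN.
Qed.

Lemma oppositeK N : involutive (@opposite N).
Proof. by move=> lam; apply/funext => i; rewrite /opposite rev_ordK opprK. Qed.

Lemma compK N T (g : 'I_N -> T) : (g \o @rev_ord N) \o @rev_ord N = g.
Proof. by apply/funext => i; rewrite /= rev_ordK. Qed.

Lemma norming_flipP N (lam : 'I_N -> R) (phi : 'I_N -> R[i]) g :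
  norming a lam phi g <-> norming a (opposite lam) (phi \o @rev_ord N) (g \o @rev_ord N).
Proof.
by split=> [|/norming_flip]; [exact: norming_flip|rewrite oppositeK !compK].
Qed.

(** Index reversal turns the largest eigenvalue into the smallest, and
    $\lambda\gamma^2$ is invariant. *)
Lemma norming_negative n (lam : 'I_n.+1 -> R) (phi : 'I_n.+1 -> R[i]) :
    (exists p, is_pair p /\ interior_data a p lam phi) -> alpha phi != 0 ->
    (exists i, phi i = 0) -> lam ord_max < 0 ->
  exists c, union_of_orthants phi ord0 (norming a lam phi) c.
Proof.
move=> [p [ip id]] al [i phii] lneg.
have r0 : rev_ord ord0 = ord_max :> 'I_n.+1 by apply: val_inj; rewrite /= subn1.
have rm : rev_ord ord_max = ord0 :> 'I_n.+1 by rewrite -r0 rev_ordK.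
have [||||c [ce cD]] := @norming_positive R a n (opposite lam) (phi \o @rev_ord n.+1).
- by have [ip' id'] := @pairs_flip p _ lam phi (conj ip id); exists (flip_sign p).
- rewrite (_ : alpha _ = alpha phi) // /alpha; congr (_ - _).
  by rewrite [RHS](reindex_inj rev_ord_inj).
- by exists (rev_ord i); rewrite /= rev_ordK.
- by rewrite /opposite r0 oppr_gt0.
exists (fun b => c b \o @rev_ord n.+1); split.
  by move=> pe; rewrite /= r0; apply: ce; rewrite /= rm.
move=> g; rewrite norming_flipP cD; split=> -[b [bN h]]; exists b; split.
- by move=> pe; apply: bN; rewrite /= rm.
- by move=> j; have := h (rev_ord j); rewrite /= !rev_ordK.
- by rewrite /= rm.
- by move=> j; have := h (rev_ord j); rewrite /= !rev_ordK.
Qed.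
End symmetry.

(** * Topology of orthants *)

Section topology.
Context {R : realType}.

(** The topology on matrices is the product topology. *)
Lemma continuous_to_mx (T : topologicalType) m n (f : T -> 'M[R]_(m, n)) :
  (forall i j, continuous (fun x => f x i j)) -> continuous f.
Proof.
move=> cf x A [P nP PA]; apply: filterS PA _; rewrite /=.
apply: filter_forall => i; apply: filter_forall => j; exact: cf (nP i j).
Qed.

Lemma convex_connected N (A : set 'rV[R]_N) :
  (forall x y (t : R), A x -> A y -> 0 <= t <= 1 -> A (\row_j ((1 - t) * x 0 j + t * y 0 j))) ->
  connected A.
Proof.
move=> cvx; have [->|/set0P[x0 A0]] := eqVneq A set0; first exact: connected0.
pose sg (y : 'rV[R]_N) (t : R) : 'rV[R]_N := \row_j ((1 - t) * x0 0 j + t * y 0 j).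
have -> : A = \bigcup_(y in A) (sg y @` `[0, 1]).
  apply/seteqP; split=> [y Ay|z [y Ay [t]]].
    exists y => //; exists 1; first by rewrite /= in_itv /= ler01 lexx.
    by apply/rowP => j; rewrite mxE subrr mul0r mul1r add0r.
  by rewrite /= in_itv /= => t01 <-; apply: cvx.
apply: bigcup_connected.
  exists x0 => y Ay; exists 0; first by rewrite /= in_itv /= ler01 lexx.
  by apply/rowP => j; rewrite mxE subr0 mul0r mul1r addr0.
move=> y Ay; apply: connected_continuous_connected; first exact: segment_connected.
apply: continuous_subspaceT; apply: continuous_to_mx => i j.
have -> : (fun t => sg y t i j) = (fun t => (1 - t) * x0 0 j + t * y 0 j).
  by apply/funext => t; rewrite /sg mxE.
move=> t; apply: cvgD; apply: cvgM; try exact: cvg_cst; last exact: cvg_id.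
by apply: cvgB; [exact: cvg_cst|exact: cvg_id].
Qed.

Section orthant.
Context (N : nat) (lam c : 'I_N -> R) (K : {set 'I_N}).

Definition orthant : set 'rV[R]_(N + N) :=
  [set d | exists2 g : 'I_N -> R, d = row_mx (\row_i lam i) (\row_i g i) &
     forall i, (i \in K -> 0 < g i) /\ (i \notin K -> g i = c i)].

Lemma orthantP d : orthant d <->
  [/\ forall i, d 0 (lshift N i) = lam i, forall i, i \in K -> 0 < d 0 (rshift N i)
    & forall i, i \notin K -> d 0 (rshift N i) = c i].
Proof.
split=> [[g -> h]|[h1 h2 h3]].
  split=> i; rewrite ?row_mxEl ?row_mxEr mxE //; by have [] := h i.
exists (fun i => d 0 (rshift N i)); last by move=> i; split; [exact: h2|exact: h3].
apply/rowP => j; rewrite -(fintype.splitK j); case: (fintype.split j) => i /=.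
  by rewrite row_mxEl mxE h1.
by rewrite row_mxEr mxE.
Qed.

Lemma orthant_connected : connected orthant.
Proof.
apply: convex_connected => x y t /orthantP[x1 x2 x3] /orthantP[y1 y2 y3] /andP[t0 t1].
apply/orthantP; split=> i; rewrite mxE.
- by rewrite x1 y1; ring.
- move=> iK; have xi := x2 i iK; have yi := y2 i iK.
  have [->|tn] := eqVneq t 0; first by rewrite subr0 mul1r mul0r addr0.
  rewrite ltr_wpDl // ?mulr_ge0 ?subr_ge0 ?(ltW xi) // mulr_gt0 // lt_def tn //.
- by move=> iK; rewrite x3 // y3 //; ring.
Qed.

Lemma orthant_nonempty : orthant !=set0.
Proof.
exists (row_mx (\row_i lam i) (\row_i (if i \in K then 1 else c i))).
exists (fun i => if i \in K then 1 else c i) => // i.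
by split=> [->|/negPf ->].
Qed.

(** A single chart: the coordinates in $K$. *)
Lemma orthant_manifold : manifold #|K| orthant.
Proof.
move=> x Ox; exists setT, [set y | forall j, 0 < y 0 j]; split => //.
- exact: openT.
- rewrite openE => y y0 /=; exists (fun _ j => [set v : R | 0 < v]).
    move=> i j; rewrite (ord1 i); apply: open_nbhs_nbhs; split; last exact: y0.
    exact: open_gt.
  by move=> z zP j; apply: zP.
rewrite setIT.
pose F (d : 'rV[R]_(N + N)) : 'rV[R]_#|K| := \row_j d 0 (rshift N (enum_val j)).
pose h (y : 'rV[R]_#|K|) i := if [pick j | enum_val j == i] is Some j then y 0 j else c i.
pose G (y : 'rV[R]_#|K|) : 'rV[R]_(N + N) := row_mx (\row_i lam i) (\row_i h y i).
have hK y j : h y (enum_val j) = y 0 j.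
  rewrite /h; case: pickP => [j' /eqP /enum_val_inj -> //|/(_ j)].
  by rewrite eqxx.
have hNK y i : i \notin K -> h y i = c i.
  move=> iK; rewrite /h; case: pickP => // j /eqP e.
  by move: iK; rewrite -e enum_valP.
exists F, G; split.
- apply: continuous_subspaceT; apply: continuous_to_mx => i j.
  have -> : (fun d => F d i j) = (fun d : 'rV[R]_(N + N) => d 0 (rshift N (enum_val j))).
    by apply/funext => d; rewrite /F mxE.
  exact: coord_continuous.
- apply: continuous_subspaceT; apply: continuous_to_mx => i j; rewrite (ord1 i).
  rewrite -(fintype.splitK j); case: (fintype.split j) => i' /=.
    have -> : (fun y => G y 0 (lshift N i')) = cst (lam i').
      by apply/funext => y; rewrite /G row_mxEl mxE.
    exact: cst_continuous.
  have -> : (fun y => G y 0 (rshift N i')) = (fun y => h y i').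
    by apply/funext => y; rewrite /G row_mxEr mxE.
  rewrite /h; case: pickP => [j' _|_]; first exact: coord_continuous.
  exact: cst_continuous.
- by move=> d /orthantP[_ d2 _] j; rewrite mxE; apply: d2; apply: enum_valP.
- move=> y y0; apply/orthantP; split=> i; rewrite /G ?row_mxEl ?row_mxEr mxE //.
    by move=> iK; rewrite -(enum_rankK_in iK iK) hK.
  exact: hNK.
split.
- move=> d /orthantP[d1 d2 d3]; apply/rowP => j.
  rewrite -(fintype.splitK j); case: (fintype.split j) => i /=.
    by rewrite /G row_mxEl mxE d1.
  rewrite /G row_mxEr mxE; have [iK|iK] := boolP (i \in K); last by rewrite hNK // d3.
  by rewrite -(enum_rankK_in iK iK) hK mxE.
- by move=> y _; apply/rowP => j; rewrite mxE /G row_mxEr mxE hK.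
Qed.
End orthant.

(** On a connected set the coordinate $e$ takes an interval of values, so it cannot
    take $c_1$ and $c_2$ only. *)
Lemma orthant_component N (lam c1 c2 : 'I_N -> R) (K : {set 'I_N}) e d :
    e \notin K -> c1 e != c2 e -> orthant lam c1 K d ->
  connected_component (orthant lam c1 K `|` orthant lam c2 K) d = orthant lam c1 K.
Proof.
move=> eK c12 O1; set A := _ `|` _.
apply/seteqP; split; last first.
  by apply: connected_component_max => //; [exact: subsetUl|exact: orthant_connected].
move=> d' [C [Cd CA cC]] Cd'; have [//|/orthantP[_ _ d3]] := CA _ Cd'.
have d1 : d 0 (rshift N e) = c1 e by case/orthantP: O1 => _ _; apply.
have d2 : d' 0 (rshift N e) = c2 e by apply: d3.
pose pr (v : 'rV[R]_(N + N)) := v 0 (rshift N e).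
have cI : connected (pr @` C).
  apply: connected_continuous_connected => //.
  by apply: continuous_subspaceT; apply: coord_continuous.
have /connected_intervalP iI := cI.
have vals v : (pr @` C) v -> v = c1 e \/ v = c2 e.
  by move=> [w /CA[/orthantP[_ _ h]|/orthantP[_ _ h]] <-]; [left|right]; apply: h.
have m1 : (pr @` C) (c1 e) by exists d.
have m2 : (pr @` C) (c2 e) by exists d'.
have [] : (c1 e + c2 e) / 2 = c1 e \/ (c1 e + c2 e) / 2 = c2 e.
  apply: vals; have [lt|lt|e'] := ltgtP (c1 e) (c2 e); last by rewrite e' eqxx in c12.
    by apply: (iI _ _ m1 m2); apply/andP; split; lra.
  by apply: (iI _ _ m2 m1); apply/andP; split; lra.
  by move=> h; case/eqP: c12; lra.
by move=> h; case/eqP: c12; lra.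
Qed.

Lemma orthants_disjoint N (lam c1 c2 : 'I_N -> R) (K : {set 'I_N}) e :
  e \notin K -> c1 e != c2 e ->
  disjoint_manifolds 2 #|K| (orthant lam c1 K `|` orthant lam c2 K).
Proof.
move=> eK c12; set A := _ `|` _.
have comp1 d : orthant lam c1 K d -> connected_component A d = orthant lam c1 K.
  exact: orthant_component eK c12.
have comp2 d : orthant lam c2 K d -> connected_component A d = orthant lam c2 K.
  by rewrite /A setUC; apply: orthant_component eK _; rewrite eq_sym.
pose O i := if i == 0%N then orthant lam c1 K else orthant lam c2 K.
have compE : [set connected_component A x | x in A] = O @` `I_2.
  apply/seteqP; split=> [C [d [Od|Od] <-]|C [i i2 <-]].
  - by exists 0%N => //; rewrite comp1.
  - by exists 1%N => //; rewrite comp2.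
  rewrite /O; case: eqP => _.
    by have [d Od] := orthant_nonempty lam c1 K; exists d; [left|exact: comp1].
  by have [d Od] := orthant_nonempty lam c2 K; exists d; [right|exact: comp2].
rewrite /disjoint_manifolds compE; split; last first.
  by move=> C [i _ <-]; rewrite /O; case: eqP => _; apply: orthant_manifold.
have ne : orthant lam c1 K <> orthant lam c2 K.
  have [d Od] := orthant_nonempty lam c1 K => e12.
  have := Od; rewrite e12 => /orthantP[_ _ /(_ e eK) d2].
  by case/orthantP: Od => _ _ /(_ e eK) d1; move: c12; rewrite -d1 -d2 eqxx.
apply: inj_card_eq => i j; rewrite !inE /= => i2 j2.
case: i i2 => [|[|//]] _; case: j j2 => [|[|//]] _; rewrite /O //= => h;
  by case: ne; rewrite h.
Qed.

End topology.

(** * Conclusion *)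

Section conclusion.
Context {R : realType} (a : R) (n : nat).
Context (lam : 'I_n.+1 -> R) (phi : 'I_n.+1 -> R[i]) (e : 'I_n.+1) (c : bool -> 'I_n.+1 -> R).
Context (D : union_of_orthants phi e (norming a lam phi) c).

Let K := [set i | phi i == 0]%SET.

Lemma mem_blind_indices i : (i \in K) = (phi i == 0). Proof. by rewrite inE. Qed.

Lemma spectral_orthant_eq : phi e = 0 -> spectral_set a lam phi = orthant lam (c true) K.
Proof.
move=> e0; apply/seteqP; split=> [d /spectral_setE[g /D.2[b [bN h]] ->]|d [g -> h]].
  exists g => // i; rewrite mem_blind_indices; have [h1 h2] := h i.
  by split=> [/eqP/h1 //|/h2]; rewrite (bN e0).
apply/spectral_setE; exists g => //; apply/D.2; exists true; split=> // i.
by have [h1 h2] := h i; rewrite mem_blind_indices in h1 h2; split=> [/eqP/h1|/h2].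
Qed.

Lemma spectral_orthants_neq : phi e != 0 ->
  spectral_set a lam phi = orthant lam (c true) K `|` orthant lam (c false) K.
Proof.
move=> e0; apply/seteqP; split=> [d /spectral_setE[g /D.2[b [_ h]] ->]|].
  have : orthant lam (c b) K (row_mx (\row_i lam i) (\row_i g i)).
    exists g => // i; rewrite mem_blind_indices; have [h1 h2] := h i.
    by split=> [/eqP/h1 //|/h2].
  by case: b {h} => ?; [left|right].
have sub b : orthant lam (c b) K `<=` spectral_set a lam phi.
  move=> d [g -> h]; apply/spectral_setE; exists g => //; apply/D.2; exists b.
  split=> [pe|i]; first by rewrite pe eqxx in e0.
  by have [h1 h2] := h i; rewrite mem_blind_indices in h1 h2; split=> [/eqP/h1|/h2].
by move=> d [|]; apply: sub.
Qed.

(** Infinitely many values of one free norming constant. *)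
Lemma pairs_infinite : (exists i, phi i = 0) -> infinite_set (pairs_with a lam phi).
Proof.
move=> [i0 p0] /(finite_image (fun p => lam i0 * gamma2 p (lam i0))) /finite_seqP[s sE].
pose v := 1 + \sum_(x <- s) `|x|.
have sum0 (q : seq R) : 0 <= \sum_(x <- q) `|x| by apply: sumr_ge0.
have v0 : 0 < v by rewrite ltr_pwDl.
have : norming a lam phi (fun i => if i == i0 then v else if phi i == 0 then 1 else c true i).
  apply/D.2; exists true; split=> // i; case: eqP => [->|_].
    by split=> //; rewrite p0 eqxx.
  by split=> [->|/negPf -> //]; rewrite eqxx.
move=> [p pp /(_ i0)]; rewrite eqxx => vE.
have : [set` s] v by rewrite -sE; exists p.
rewrite /= => /(@big_rem _ _ _ _ _ _ xpredT (fun x => `|x|)) /= e1.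
have h := sum0 (rem v s).
have e2 : v = 1 + (v + \sum_(x <- rem v s) `|x|) by rewrite {1}/v e1 gtr0_norm.
suff: (0 : R) < 0 by rewrite ltxx.
by clear p0 vE e1; lra.
Qed.

Lemma spectral_set_topology : (exists i, phi i = 0) ->
  [/\ infinite_set (pairs_with a lam phi),
      phi e = 0 -> connected (spectral_set a lam phi) /\
                   manifold #|K| (spectral_set a lam phi)
    & phi e != 0 -> disjoint_manifolds 2 #|K| (spectral_set a lam phi)].
Proof.
move=> ex; split; first exact: pairs_infinite.
  move=> e0; rewrite spectral_orthant_eq //; split.
    exact: orthant_connected.
  exact: orthant_manifold.
move=> e0; rewrite spectral_orthants_neq //.
by apply: (@orthants_disjoint _ _ _ _ _ _ e); rewrite ?mem_blind_indices ?D.1.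
Qed.
End conclusion.

(* The number N >= 1 of eigenvalues is n.+1. *)
Theorem theorem4p6 (R : realType) (a : R) (n k : nat)
    (lam : 'I_n.+1 -> R) (phi : 'I_n.+1 -> R[i]) :
  (exists p : seq (atom R), is_pair p /\ interior_data a p lam phi) ->
  alpha phi != 0 ->
  #|[set i | phi i == 0]%SET| = k ->
  (1 <= k)%N ->
  (0 < lam ord0 ->
     [/\ infinite_set (pairs_with a lam phi),
         phi ord_max = 0 ->
           connected (spectral_set a lam phi) /\
           manifold k (spectral_set a lam phi)
       & phi ord_max != 0 ->
           disjoint_manifolds 2 k (spectral_set a lam phi)]) /\
  (lam ord_max < 0 ->
     [/\ infinite_set (pairs_with a lam phi),
         phi ord0 = 0 ->
           connected (spectral_set a lam phi) /\
           manifold k (spectral_set a lam phi)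
       & phi ord0 != 0 ->
           disjoint_manifolds 2 k (spectral_set a lam phi)]).
Proof.
move=> ex al <- /card_gt0P[i1]; rewrite inE => /eqP phi0.
have exi : exists i, phi i = 0 by exists i1.
split=> lam0.
  by have [c D] := norming_positive ex al exi lam0; apply: (spectral_set_topology D).
by have [c D] := norming_negative ex al exi lam0; apply: (spectral_set_topology D).
Qed.
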